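(* Let $N\ge 1$, let $\Omega\subset\mathbb{R}^N$ be a smooth bounded domain, and let $M:[0,\infty)\to[0,\infty)$ be a function. Suppose that $M$ is not nonincreasing, in the sense that there exist $0<t_1<t_2$ with $M(t_1)<M(t_2)$. Then the Weak Comparison Principle, the Strong Comparison Principle and the Sub and Supersolution Method all fail in $\Omega$ for the operator $u\mapsto -M(\|u\|_H^2)\Delta u$. Precisely: (i) (failure of the Weak Comparison Principle) there exist $\ell,w\in H_0^1(\Omega)\cap C(\Omega)$ such that, in the weak sense, $-M(\|\ell\|_H^2)\Delta \ell< -M(\|w\|_H^2)\Delta w$ in $\Omega$, and $\ell\le w$ on $\partial\Omega$, but $\ell(p)>w(p)$ for some $p\in\Omega$; (ii) (failure of the Strong Comparison Principle) there exist $\ell,w\in H_0^1(\Omega)\cap C(\Omega)$ such that, in the weak sense, $-M(\|\ell\|_H^2)\Delta \ell< -M(\|w\|_H^2)\Delta w$ in $\Omega$, and $\ell\le w$ on $\partial\Omega$, but $\ell(p)=w(p)$ for some $p\in\Omega$; (iii) (failure of the Sub and Supersolution Method) there exist a number $\Theta>0$ and functions $\underline u,\overline u\in H_0^1(\Omega)\cap C(\Omega)$ such that, in the weak sense, $-M(\|\underline u\|_H^2)\Delta\underline u\le\Theta\,\underline u$ in $\Omega$ and $-M(\|\overline u\|_H^2)\Delta\overline u\ge\Theta\,\overline u$ in $\Omega$, with $\underline u\le\overline u$ in $\Omega$ and $\underline u\le 0\le\overline u$ on $\partial\Omega$, but the problem $$-M(\|u\|_H^2)\Delta u=\Theta u\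 \text{ in }\Omega,\qquad u=0\ \text{ on }\partial\Omega,$$ has no (weak) solution $u\in H_0^1(\Omega)$ satisfying $\underline u\le u\le\overline u$ in $\Omega$.
   Context: Here $\|u\|_H^2=\int_\Omega|\nabla u|^2\,dx$ is the squared norm of $H_0^1(\Omega)$. No continuity of $M$ is assumed. Weak sense: for $v\in H_0^1(\Omega)$ and $g\in L^2(\Omega)$, the inequality $-M(\|v\|_H^2)\Delta v\le g$ (resp. $\ge$) in $\Omega$ means that $M(\|v\|_H^2)\int_\Omega\nabla v\cdot\nabla\varphi\,dx\le\int_\Omega g\varphi\,dx$ (resp. $\ge$) for all $\varphi\in H_0^1(\Omega)$ with $\varphi\ge0$ a.e.; a weak solution satisfies equality for all $\varphi\in H_0^1(\Omega)$. The strict inequality $-M(\|\ell\|_H^2)\Delta\ell<-M(\|w\|_H^2)\Delta w$ in $\Omega$ means $M(\|\ell\|_H^2)\int_\Omega\nabla \ell\cdot\nabla\varphi\,dx< M(\|w\|_H^2)\int_\Omega\nabla w\cdot\nabla\varphi\,dx$ for all $\varphi\in H_0^1(\Omega)$ with $\varphi\ge0$ a.e. and $\varphi\not\equiv0$. Boundary inequalities are understood in the sense of traces; for functions in $H_0^1(\Omega)$ the boundary values are zero. Inequalities between functions in $\Omega$ are understood a.e. (everywhere when both functions are continuous). *)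

(* Defs.v *)
From HB Require Import structures.
From mathcomp Require Import all_boot all_order all_algebra.
From mathcomp Require Import all_classical all_reals all_analysis.

Set Implicit Arguments.
Unset Strict Implicit.
Unset Printing Implicit Defensive.

Import Order.TTheory GRing.Theory Num.Theory.
Import numFieldTopology.Exports numFieldNormedType.Exports.

Local Open Scope classical_set_scope.
Local Open Scope ring_scope.

(* The product sigma-algebra on row vectors, as the library does for tuples;
   on ['rV[R]_n] it is the Borel sigma-algebra. *)
Section measurable_rV.
Context {d : measure_display} {T : sigmaRingType d} (n : nat).

Let coor (i : 'I_n) (v : 'rV[T]_n) : T := v ord0 i.

Let rV_set0 : g_sigma_preimage coor set0.
Proof. exact: sigma_algebra0. Qed.

Let rV_setC A : g_sigma_preimage coor A -> g_sigma_preimage coor (~` A).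
Proof. exact: sigma_algebraC. Qed.

Let rV_bigcup (F : (set 'rV[T]_n)^nat) :
  (forall i, g_sigma_preimage coor (F i)) ->
  g_sigma_preimage coor (\bigcup_i (F i)).
Proof. exact: sigma_algebra_bigcup. Qed.

HB.instance Definition _ := @isMeasurable.Build (measure_tuple_display d)
  'rV[T]_n (g_sigma_preimage coor) rV_set0 rV_setC rV_bigcup.

End measurable_rV.

Lemma measurable_coor d (T : sigmaRingType d) n (i : 'I_n) :
  measurable_fun [set: 'rV[T]_n] (fun v : 'rV[T]_n => v ord0 i).
Proof.
move=> _ Y mY; rewrite setTI; apply: sub_sigma_algebra => /=.
rewrite -bigcup_seq/=; exists i => /=; first by rewrite mem_index_enum.
by exists Y => //; rewrite setTI.
Qed.

Lemma measurable_fun_rV d1 d2 (T1 : measurableType d1) (T2 : measurableType d2)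
    n (f : T1 -> 'rV[T2]_n) :
  (forall i, measurable_fun [set: T1] (fun x => f x ord0 i)) ->
  measurable_fun [set: T1] f.
Proof.
move=> mf; apply: measurability => //.
move=> _ [A + <-]; rewrite -bigcup_seq => -[i _] [B mB <-].
by rewrite !setTI; have := mf i measurableT B mB; rewrite setTI.
Qed.

Definition rV_cons (R : Type) n (p : R * 'rV[R]_n) : 'rV[R]_n.+1 :=
  \row_i (if unlift ord0 i is Some j then p.2 ord0 j else p.1).

Lemma measurable_rV_cons (R : realType) n :
  measurable_fun [set: R * 'rV[R]_n] (@rV_cons R n).
Proof.
apply: measurable_fun_rV => i; have [j ->|->] := unliftP ord0 i.
  rewrite (_ : (fun x => _) = (fun v : 'rV[R]_n => v ord0 j) \o snd).
    exact: measurableT_comp (measurable_coor j) measurable_snd.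
  by apply/funext => x /=; rewrite mxE liftK.
rewrite (_ : (fun x => _) = fst); first exact: measurable_fst.
by apply/funext => x; rewrite mxE unlift_none.
Qed.

Section lebesgue_rVS.
Context {R : realType} {n : nat}.
Variable m : {sigma_finite_measure set 'rV[R]_n -> \bar R}.

Definition lebesgue_rVS : set 'rV[R]_n.+1 -> \bar R :=
  pushforward (lebesgue_measure \x m)%E (@rV_cons R n).

Let lebesgue_rVS0 : lebesgue_rVS set0 = 0%E.
Proof. by rewrite /lebesgue_rVS /pushforward preimage_set0 measure0. Qed.

Let lebesgue_rVS_ge0 A : (0 <= lebesgue_rVS A)%E.
Proof. by rewrite /lebesgue_rVS /pushforward; exact: measure_ge0. Qed.

Let lebesgue_rVS_sigma_additive : semi_sigma_additive lebesgue_rVS.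
Proof.
move=> F mF tF mUF; rewrite /lebesgue_rVS /pushforward preimage_bigcup.
have mc := @measurable_rV_cons R n.
apply: measure_semi_sigma_additive.
- by move=> k; rewrite -[X in measurable X]setTI; exact: mc.
- apply/trivIsetP => /= i j _ _ ij; rewrite -preimage_setI.
  by move/trivIsetP : tF => /(_ _ _ _ _ ij) ->//; rewrite preimage_set0.
- by rewrite -preimage_bigcup -[X in measurable X]setTI; exact: mc.
Qed.

HB.instance Definition _ := isMeasure.Build _ _ _
  lebesgue_rVS lebesgue_rVS0 lebesgue_rVS_ge0 lebesgue_rVS_sigma_additive.

Let lebesgue_rVS_sigma_finite : sigma_finite setT lebesgue_rVS.
Proof.
have /sigma_finiteP[F [FT ndF Foo]] := sigma_finiteT (@lebesgue_measure R).
have /sigma_finiteP[G [GT ndG Goo]] := sigma_finiteT m.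
pose g (v : 'rV[R]_n.+1) := (v ord0 ord0, \row_(j < n) v ord0 (lift ord0 j)).
have mg : measurable_fun setT g.
  apply: measurable_fun_pair; first exact: measurable_coor.
  apply: measurable_fun_rV => j.
  by under eq_fun do rewrite mxE; exact: measurable_coor.
exists (fun k => g @^-1` (F k `*` G k)).
  rewrite predeqE => v; split=> // _.
  have [i _ Fi] : (\bigcup_i F i) (g v).1 by rewrite -FT.
  have [j _ Gj] : (\bigcup_i G i) (g v).2 by rewrite -GT.
  exists (maxn i j) => //; split.
    by move: Fi; exact/subsetPset/ndF/leq_maxl.
  by move: Gj; exact/subsetPset/ndG/leq_maxr.
move=> k; have [mF Fk] := Foo k; have [mG Gk] := Goo k; split.
  by rewrite -[X in measurable X]setTI; apply: mg => //; exact: measurableX.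
rewrite /lebesgue_rVS /pushforward -comp_preimage.
rewrite (_ : g \o _ = idfun).
  by rewrite preimage_id product_measure1E// lte_mul_pinfty// ge0_fin_numE.
apply/funext => -[x v]; congr pair => /=; first by rewrite mxE unlift_none.
by apply/rowP => j; rewrite !mxE liftK.
Qed.

HB.instance Definition _ := Measure_isSigmaFinite.Build _ _ _
  lebesgue_rVS lebesgue_rVS_sigma_finite.

End lebesgue_rVS.

(* ['rV[R]_0] is a singleton, of mass 1; Lebesgue measure on ['rV[R]_n.+1] is
   the product of those on [R] and ['rV[R]_n]. *)
Fixpoint lebesgue_rV (R : realType) (n : nat) :
    {sigma_finite_measure set 'rV[R]_n -> \bar R} :=
  match n with
  | 0 => \d_(0 : 'rV[R]_0)
  | n'.+1 => lebesgue_rVS (lebesgue_rV R n')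
  end.

Section calculus.
Context {R : realType} {N : nat}.
Implicit Types (i : 'I_N) (f : 'rV[R]_N -> R) (k : nat).

Definition partial i f : 'rV[R]_N -> R := 'D_(delta_mx 0 i) f.

Fixpoint Ck k f : Prop :=
  continuous f /\
  if k is k'.+1 then
    forall i, (forall x, derivable f x (delta_mx 0 i)) /\ Ck k' (partial i f)
  else True.

Definition smooth f : Prop := forall k, Ck k f.

End calculus.

Section domains.
Context {R : realType} {N : nat}.
Implicit Types Omega : set 'rV[R]_N.

Definition frontier Omega : set 'rV[R]_N := closure Omega `\` interior Omega.

(* Near every boundary point, Omega is, up to relabelling and reorienting the
   coordinate axes, the region above the graph of a smooth function of the
   other N - 1 coordinates; such a function is encoded as a smooth function on
   the whole space that does not depend on the i-th coordinate. *)
Definition smooth_boundary Omega : Prop :=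
  forall p, frontier Omega p ->
    exists (U : set 'rV[R]_N) (i : 'I_N) (s : bool) (gamma : 'rV[R]_N -> R),
      [/\ open_nbhs p U,
          smooth gamma,
          forall x y : 'rV[R]_N,
            (forall j, j != i -> x ord0 j = y ord0 j) -> gamma x = gamma y &
          forall x, U x -> (Omega x <-> gamma x < (-1) ^+ s * x ord0 i)].

Definition smooth_bounded_domain Omega : Prop :=
  [/\ Omega !=set0, open Omega, connected Omega, bounded_set Omega &
      smooth_boundary Omega].

End domains.

Section sobolev.
Context {R : realType} {N : nat}.
Variable Omega : set 'rV[R]_N.
Implicit Types (u v f g : 'rV[R]_N -> R) (G : 'I_N -> 'rV[R]_N -> R).

Let mu := lebesgue_rV R N.

Definition test_function f : Prop :=
  smooth f /\
  exists K : set 'rV[R]_N,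
    [/\ compact K, K `<=` Omega & forall x, ~ K x -> f x = 0].

Definition L2 f : Prop :=
  measurable_fun Omega f /\ (\int[mu]_(x in Omega) (f x ^+ 2)%:E < +oo)%E.

Definition L2_inner f g : R := \int[mu]_(x in Omega) (f x * g x).

Definition L2_cvg (phi : nat -> 'rV[R]_N -> R) f : Prop :=
  (fun n => \int[mu]_(x in Omega) ((phi n x - f x) ^+ 2)%:E)%E @ \oo --> 0%E.

Definition weak_gradient u G : Prop :=
  forall i, L2 (G i) /\
    forall phi, test_function phi ->
      L2_inner u (partial i phi) = - L2_inner (G i) phi.

Definition H1 u : Prop := L2 u /\ exists G, weak_gradient u G.

(* u lies in H^1(Omega), with weak gradient G, and is a limit in the H^1 norm
   of functions in C_c^oo(Omega). *)
Definition H10_gradient u G : Prop :=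
  [/\ L2 u, weak_gradient u G &
      exists phi : nat -> 'rV[R]_N -> R,
        [/\ forall n, test_function (phi n), L2_cvg phi u &
            forall i, L2_cvg (fun n => partial i (phi n)) (G i)]].

Definition H10 u : Prop := exists G, H10_gradient u G.

(* A representative of the weak gradient, which is unique up to a.e. equality;
   a junk value when u is not in H_0^1(Omega). *)
Definition grad u : 'I_N -> 'rV[R]_N -> R :=
  xget (fun _ _ => 0) [set G | H10_gradient u G].

Definition dirichlet u v : R :=
  \int[mu]_(x in Omega) \sum_(i < N) grad u i x * grad v i x.

Definition normH_sq u : R :=
  \int[mu]_(x in Omega) \sum_(i < N) grad u i x ^+ 2.

Definition ae_le u v : Prop := {ae mu, forall x, Omega x -> u x <= v x}.

Definition ae_eq u v : Prop := {ae mu, forall x, Omega x -> u x = v x}.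

(* The trace of u on the boundary is the continuous function g: up to an
   element of H_0^1(Omega), u is an H^1 function that is continuous up to the
   boundary, with boundary values g.  Only continuous traces are covered, which
   avoids the surface measure; functions in H_0^1(Omega) have trace 0. *)
Definition has_trace u g : Prop :=
  exists U : 'rV[R]_N -> R,
    [/\ H1 U, {within closure Omega, continuous U},
        forall x, frontier Omega x -> U x = g x &
        H10 (fun x => u x - U x)].

Definition le_on_boundary u v : Prop :=
  exists g h, [/\ has_trace u g, has_trace v h &
                  forall x, frontier Omega x -> g x <= h x].

Section kirchhoff.
Variable M : R -> R.

(* The pairing of - M(||v||_H^2) Delta v with phi. *)
Definition kirchhoff v phi : R := M (normH_sq v) * dirichlet v phi.

Definition weak_lt u v : Prop :=
  forall phi, H10 phi -> ae_le (cst 0) phi -> ~ ae_eq phi (cst 0) ->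
    kirchhoff u phi < kirchhoff v phi.

Definition weak_subsolution v g : Prop :=
  forall phi, H10 phi -> ae_le (cst 0) phi -> kirchhoff v phi <= L2_inner g phi.

Definition weak_supersolution v g : Prop :=
  forall phi, H10 phi -> ae_le (cst 0) phi -> L2_inner g phi <= kirchhoff v phi.

Definition weak_solution v g : Prop :=
  forall phi, H10 phi -> kirchhoff v phi = L2_inner g phi.

End kirchhoff.
End sobolev.

(* Main.v *)
(* Only the two values M t1 < M t2 matter: functions of energy t1 and t2 obey
   linear equations with different coefficients.

   For (i) and (ii), let - Delta V = 1 and let phi be a test function close to V
   and scaled so that V - phi is orthogonal to V. Take l = s (V - phi) of energy
   t1, where s is as large as one likes, and for w the combination of l and V of
   energy t2 with - M(t2) Delta w = - M(t1) Delta l + const, const > 0. Off the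
   support of phi, l = s V exceeds w; the integral of l is <l, V> = 0, so l is
   negative somewhere, where w exceeds l; in between they touch.

   For (iii), let phi1 be the first eigenfunction, Theta = lam1 (M t1 + M t2) / 2,
   usub = c (phi1 + eta psi) for a small bump psi, and usup = usub + s d, where
   - Delta d - (Theta / M t2) d = h >= 0. A solution u in between must be an
   eigenfunction, as one sees by testing it with phi1. Testing u - c phi1 with a
   bump chi such that - Delta chi - lam1 chi > 0 on the support of psi bounds
   eta from above by a multiple of s <d, phi1>, which is arbitrarily small when
   h is supported near the boundary.

   The eigenfunction and d are obtained by minimisation over test functions;
   compactness comes from finitely many averages. They are continuous because
   averages with the kernels r^-N f(1 - |x - y|^2 / r^2) satisfy an ODE in r:
   the r-derivative of such a kernel is r times the Laplacian of a smoother one.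
   The boundary of Omega plays no role, as elements of H_0^1 have trace 0. *)

(* Since [M] is arbitrary apart from two of its values, it may well take the value [Theta / lam1],
   and then suitable multiples of the first eigenfunction do solve the problem. A solution therefore
   cannot be excluded through its energy: the order interval between [usub] and [usup] must contain
   no eigenfunction at all. A multiple of the first eigenfunction is useless as [usub], being one
   itself. The bump added to it has the effect that, for a fixed test function [g], the pairing of
   [u - usub] with [g] is the same positive number for all eigenfunctions [u]. Against this,
   [usup - usub] has bounded energy norm, because both energies are prescribed, and can be made
   almost orthogonal to the first eigenfunction. The order of the choices matters: the size of the
   bump is limited only by the gaps between [Theta] and [lam1 * M t1], [lam1 * M t2], so it is fixed
   before [d] is chosen. In (i) and (ii) the conflict is to have energy [t1] and still be large at a
   point: subtracting a test function makes the energy of [V] almost vanish without changing [V] off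
   a compact set. *)
From Pilot Require Import Defs.
From HB Require Import structures.
From mathcomp Require Import all_boot all_order all_algebra.
From mathcomp Require Import all_classical all_reals all_analysis.
From mathcomp Require Import measurable_realfun ring lra.
(* Again, so that [ae_eq] is not the one of the library. *)
Import Pilot.Defs.

Import Order.TTheory GRing.Theory Num.Theory.
Import numFieldTopology.Exports numFieldNormedType.Exports.

Local Open Scope classical_set_scope.
Local Open Scope ring_scope.

Set Implicit Arguments.
Unset Strict Implicit.
Unset Printing Implicit Defensive.

(** * Lebesgue measure on row vectors *)

Section measure_rV.
Context {R : realType}.

Lemma rV_ballP n (x y : 'rV[R]_n) (e : R) : 0 < e ->
  ball x e y <-> forall i, `|x ord0 i - y ord0 i| < e.
Proof.
move=> e0; split=> [[_ h] i|h]; first exact: h.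
by split => // i j; rewrite (ord1 i); exact: h.
Qed.

Lemma coord_le_norm n (x : 'rV[R]_n) i : `|x ord0 i| <= `|x|.
Proof.
by rewrite [leRHS]/Num.norm /= mx_normrE; apply/bigmax_geP; right => /=;
  exists (ord0, i).
Qed.

Lemma norm_le_coord n (x : 'rV[R]_n) (r : R) : 0 <= r ->
  (forall i, `|x ord0 i| <= r) -> `|x| <= r.
Proof.
move=> r0 h; rewrite [leLHS]/Num.norm /= mx_normrE; apply/bigmax_leP; split => //.
by move=> [i j] _ /=; rewrite (ord1 i).
Qed.

Lemma measurable_coor_ball n (q : 'I_n -> R) (e : R) :
  measurable [set y : 'rV[R]_n | forall i, `|q i - y ord0 i| < e].
Proof.
have -> : [set y : 'rV[R]_n | forall i, `|q i - y ord0 i| < e] =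
    \bigcap_(i in [set: 'I_n]) ((fun v : 'rV[R]_n => v ord0 i) @^-1` (ball (q i) e)).
  by apply/seteqP; split => y /= h i; [move=> _; exact: h | exact: (h i I)].
apply: fin_bigcap_measurable => // i _; rewrite -[X in measurable X]setTI; apply: measurable_coor => //.
exact: measurable_ball.
Qed.

(** An open set is the union of the countably many cubes with rational centre and radius
    [k.+1%:R^-1] that it contains; [P] selects these cubes. *)
Lemma open_measurable_rV n (U : set 'rV[R]_n) : open U -> measurable U.
Proof.
move=> oU.
pose B (qk : 'rV[rat]_n * nat) : set 'rV[R]_n :=
  [set y | forall i, `|ratr (qk.1 ord0 i) - y ord0 i| < qk.2.+1%:R^-1].
pose P qk := `[< B qk `<=` U >].
have -> : U = \bigcup_qk (if P qk then B qk else set0).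
  apply/seteqP; split => [x Ux|x [qk _]]; last first.
    by case: ifPn => // /asboolP; exact.
  have : nbhs x U by exact: open_nbhs_nbhs.
  move=> /nbhs_ballP[e /= e0 eU].
  have [k ke] : exists k : nat, k.+1%:R^-1 < e / 2.
    have [k hk] := @ltr_add_invr R 0 (e / 2) (divr_gt0 e0 (ltr0Sn _ 1)).
    by exists k; rewrite add0r in hk.
  have k0 : (0 : R) < k.+1%:R^-1 by rewrite invr_gt0.
  have hq i : exists q : rat, `|ratr q - x ord0 i| < k.+1%:R^-1.
    have /rat_in_itvoo[q] : x ord0 i - k.+1%:R^-1 < x ord0 i + k.+1%:R^-1.
      by rewrite ltrBlDr -addrA ltrDl addr_gt0.
    rewrite in_itv/= => /andP[q1 q2]; exists q.
    by rewrite distrC ltr_distlC q1 q2.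
  pose q : 'rV[rat]_n := \row_i xget 0%Q [set q | `|ratr q - x ord0 i| < k.+1%:R^-1].
  have qP i : `|ratr (q ord0 i) - x ord0 i| < k.+1%:R^-1.
    by rewrite mxE; case: xgetP => // h; have [q' /h] := hq i.
  exists (q, k) => //.
  have -> : P (q, k).
    apply/asboolP => y /= By; apply: eU; apply/rV_ballP => // i.
    have := By i; have := qP i.
    move=> h1 h2; rewrite -[_ - _](subrKA (ratr (q ord0 i))) (le_lt_trans (ler_normD _ _))//.
    by rewrite distrC (lt_trans (ltrD h1 h2))//= [e]splitr ltrD.
  exact: qP.
apply: countable_bigcupT_measurable => // qk; case: ifPn => // _.
exact: measurable_coor_ball.
Qed.

Lemma continuous_measurable_rV n (f : 'rV[R]_n -> R) :
  continuous f -> measurable_fun setT f.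
Proof.
move=> cf; apply: (measurability _ (RGenOpens.measurableE R)).
move=> _ [_ [a [b ->] <-]]; rewrite setTI.
apply: open_measurable_rV; move/continuousP : cf; apply.
exact: interval_open.
Qed.

Lemma measurable_shift n (v : 'rV[R]_n) :
  measurable_fun setT (fun x : 'rV[R]_n => x + v).
Proof.
apply: measurable_fun_rV => i.
under eq_fun do rewrite mxE.
by apply: measurable_funD => //; exact: measurable_coor.
Qed.

Lemma measurable_addrV n :
  measurable_fun setT (fun p : 'rV[R]_n * 'rV[R]_n => p.1 + p.2).
Proof.
apply: measurable_fun_rV => i.
under eq_fun do rewrite mxE.
apply: measurable_funD.
  exact: measurableT_comp (measurable_coor i) measurable_fst.
exact: measurableT_comp (measurable_coor i) measurable_snd.
Qed.

(** The image measure under the shift agrees with Lebesgue measure on half-open intervals, which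
    determine it. *)
Lemma lebesgue_measure_shift (v : R) (A : set (measurableTypeR R)) : measurable A ->
  lebesgue_measure ((fun x : measurableTypeR R => (x + v : measurableTypeR R)) @^-1` A) =
  lebesgue_measure A.
Proof.
move=> mA.
have mv : measurable_fun setT (fun x : measurableTypeR R => (x + v : measurableTypeR R)).
  by apply: measurable_funD.
pose pm := measure_function_pushforward__canonical__measure_function_Measure
  (@lebesgue_measure R) mv.
have := @lebesgue_measure_unique R pm.
rewrite /pm /= => h; rewrite (h _ A mA)// => X.
move=> /ocitvP[->|[[a b] /= ab ->]].
  by rewrite /pushforward preimage_set0 !measure0.
rewrite /pushforward.
have -> : (fun x : measurableTypeR R => (x + v : measurableTypeR R)) @^-1` `]a, b] =
    `]a - v, b - v]%classic.
  by apply/seteqP; split => x /=; rewrite !in_itv/= ltrBlDr lerBrDr.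
rewrite !lebesgue_measure_itv/= !lte_fin ab ltrD2r ab -!EFinB; congr EFin; ring.
Qed.

(** Induction on the dimension: the shift acts on each factor of the product separately, and a
    product measure is determined by its values on rectangles. *)
Lemma lebesgue_rV_shift n (v : 'rV[R]_n) (A : set 'rV[R]_n) : measurable A ->
  lebesgue_rV R n ((fun x => x + v) @^-1` A) = lebesgue_rV R n A.
Proof.
elim: n v A => [|n IH] v A mA.
  rewrite /= !diracE; congr (_%:E); congr (nat_of_bool _)%:R.
  by apply/idP/idP; rewrite !inE/= ?add0r (thinmx0 v).
have [v1 [v2 ->]] : exists v1 v2, v = rV_cons (v1, v2).
  exists (v ord0 ord0), (\row_(j < n) v ord0 (lift ord0 j)); apply/rowP => i.
  by rewrite mxE; have [j ->|->] := unliftP ord0 i; rewrite ?mxE.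
rewrite /= /lebesgue_rVS /pushforward.
have mc := @measurable_rV_cons R n.
set m := lebesgue_rV R n.
have mAc : measurable (@rV_cons R n @^-1` A) by rewrite -[X in measurable X]setTI; exact: mc.
pose S (p : measurableTypeR R * 'rV[R]_n) : measurableTypeR R * 'rV[R]_n :=
  (p.1 + v1, p.2 + v2).
have mS : measurable_fun setT S.
  apply: measurable_fun_pair.
    by apply: measurable_funD => //; exact: measurable_fst.
  exact: measurableT_comp (measurable_shift v2) measurable_snd.
pose pm := measure_function_pushforward__canonical__measure_function_Measure
  (lebesgue_measure \x m)%E mS.
rewrite [RHS](product_measure_unique (m' := pm))//=.
  have SE p : rV_cons (S p) = rV_cons p + rV_cons (v1, v2).
    apply/rowP => i; rewrite !mxE.
    by case: (unlift ord0 i) => [j|]; rewrite ?mxE.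
  by rewrite /pushforward; congr (_ _); apply/seteqP; split => p /=; rewrite SE.
move=> X Y mX mY; rewrite /pushforward.
have -> : S @^-1` (X `*` Y) =
    ((fun x : measurableTypeR R => (x + v1 : measurableTypeR R)) @^-1` X) `*`
    ((fun x => x + v2) @^-1` Y) by [].
rewrite product_measure1E.
- by congr (_ * _)%E; [exact: (lebesgue_measure_shift v1 mX)|exact: IH].
- rewrite -[X in measurable X]setTI.
  by have := measurable_funD (@measurable_id _ (measurableTypeR R) setT) (measurable_cst v1);
     apply.
- by rewrite -[X in measurable X]setTI; exact: measurable_shift.
Qed.

Lemma ge0_integral_shift n (v : 'rV[R]_n) (f : 'rV[R]_n -> \bar R) :
  measurable_fun setT f -> (forall x, (0 <= f x)%E) ->
  (\int[lebesgue_rV R n]_x f (x + v)%R = \int[lebesgue_rV R n]_x f x)%E.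
Proof.
move=> mf f0.
pose pm := measure_function_pushforward__canonical__measure_function_Measure
  (lebesgue_rV R n) (measurable_shift v).
transitivity (\int[pm]_x f x)%E.
  rewrite /pm/= ge0_integral_pushforward ?preimage_setT//; exact: measurable_shift.
apply: eq_measure_integral => A mA _; exact: lebesgue_rV_shift.
Qed.

Lemma measurable_box n (r : R) :
  measurable [set x : 'rV[R]_n | forall i, `|x ord0 i| <= r].
Proof.
have -> : [set x : 'rV[R]_n | forall i, `|x ord0 i| <= r] =
  \bigcap_(i in [set: 'I_n]) ((fun v : 'rV[R]_n => v ord0 i) @^-1` `[- r, r]%classic).
  apply/seteqP; split => y /= h i.
    by move=> _ /=; rewrite in_itv/= -ler_norml.
  by have := h i I => /=; rewrite in_itv/= -ler_norml.
apply: fin_bigcap_measurable => // i _.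
by rewrite -[X in measurable X]setTI; apply: measurable_coor.
Qed.

Lemma lebesgue_rV_box n (r : R) : 0 <= r ->
  (lebesgue_rV R n [set x : 'rV[R]_n | forall i, (`|x ord0 i| <= r)%R] < +oo)%E.
Proof.
move=> r0; elim: n => [|n IH].
  by rewrite /= diracE ltry.
rewrite /= /lebesgue_rVS /pushforward.
have -> : @rV_cons R n @^-1` [set x : 'rV[R]_n.+1 | forall i, `|x ord0 i| <= r] =
    `[- r, r]%classic `*` [set x : 'rV[R]_n | forall i, `|x ord0 i| <= r].
  apply/seteqP; split => [[x y] /= h|[x y] /= [h1 h2] i].
    split; first by have := h ord0; rewrite mxE unlift_none in_itv/= ler_norml.
    by move=> i; have := h (lift ord0 i); rewrite mxE liftK.
  rewrite mxE; case: unliftP => [j _|_] /=; first exact: h2.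
  by move: h1; rewrite in_itv/= ler_norml.
rewrite product_measure1E//; last exact: measurable_box.
apply: lte_mul_pinfty => //.
have -> : lebesgue_measure_lebesgue_measure__canonical__measure_function_Measure R
  `[- r, r]%classic = lebesgue_measure (`[- r, r]%classic : set R) by [].
by rewrite lebesgue_measure_itv/=; case: ifP.
Qed.

Lemma bounded_lebesgue_rV n (D : set 'rV[R]_n) : measurable D ->
  bounded_set D -> (lebesgue_rV R n D < +oo)%E.
Proof.
move=> mD [M [_ hM]].
pose r := Num.max 0 (M + 1).
have r0 : 0 <= r by rewrite le_max lexx.
apply: le_lt_trans (lebesgue_rV_box n r0); apply: le_measure; rewrite ?inE//.
  exact: measurable_box.
move=> x Dx /= i; apply: le_trans (coord_le_norm _ _) _.
apply: le_trans (hM (M + 1) _ x Dx) _; first by rewrite ltrDl.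
by rewrite le_max lexx orbT.
Qed.

End measure_rV.

(** * Semi-inner products and L2 *)

Section semi_inner_product.
Context {R : realType} {V : lmodType R}.

(** The laws are relative to a predicate because the integrals make sense only on [L2] or [H10].
    Definiteness is left out: functions equal a.e. are not identified, and [energy lam1] vanishes on
    first eigenfunctions. *)
Record semi_inner (P : V -> Prop) (B : V -> V -> R) : Prop := SemiInner {
  sipD : forall u v, P u -> P v -> P (u + v);
  sipZ : forall a u, P u -> P (a *: u);
  sipC : forall u v, P u -> P v -> B u v = B v u;
  sipDl : forall u v w, P u -> P v -> P w -> B (u + v) w = B u w + B v w;
  sipZl : forall a u w, P u -> P w -> B (a *: u) w = a * B u w;
  sip_ge0 : forall u, P u -> 0 <= B u u }.

Variables (P : V -> Prop) (B : V -> V -> R).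
Hypothesis sB : semi_inner P B.

Lemma sipN u : P u -> P (- u).
Proof. by move=> Pu; rewrite -scaleN1r; exact: (sipZ sB). Qed.

Lemma sipB u v : P u -> P v -> P (u - v).
Proof. by move=> Pu Pv; apply: (sipD sB) => //; exact: sipN. Qed.

Lemma sipDr u v w : P u -> P v -> P w -> B w (u + v) = B w u + B w v.
Proof.
move=> Pu Pv Pw; rewrite (sipC sB Pw (sipD sB Pu Pv)) (sipDl sB)//.
by rewrite (sipC sB Pu)// (sipC sB Pv).
Qed.

Lemma sipZr a u w : P u -> P w -> B w (a *: u) = a * B w u.
Proof.
move=> Pu Pw; rewrite (sipC sB Pw (sipZ sB a Pu)) (sipZl sB)//.
by rewrite (sipC sB Pu).
Qed.

Lemma sipNl u w : P u -> P w -> B (- u) w = - B u w.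
Proof. by move=> Pu Pw; rewrite -scaleN1r (sipZl sB)// mulN1r. Qed.

Lemma sipNr u w : P u -> P w -> B w (- u) = - B w u.
Proof. by move=> Pu Pw; rewrite -scaleN1r sipZr// mulN1r. Qed.

Lemma sipBl u v w : P u -> P v -> P w -> B (u - v) w = B u w - B v w.
Proof. by move=> Pu Pv Pw; rewrite (sipDl sB) ?sipNl//; exact: sipN. Qed.

Lemma sipBr u v w : P u -> P v -> P w -> B w (u - v) = B w u - B w v.
Proof. by move=> Pu Pv Pw; rewrite sipDr ?sipNr//; exact: sipN. Qed.

Lemma sip_sqD u v : P u -> P v ->
  B (u + v) (u + v) = B u u + 2 * B u v + B v v.
Proof.
move=> Pu Pv; have Puv := sipD sB Pu Pv.
rewrite (sipDl sB)// !sipDr// (sipC sB Pv Pu); ring.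
Qed.

Lemma sip_sqB u v : P u -> P v ->
  B (u - v) (u - v) = B u u - 2 * B u v + B v v.
Proof.
move=> Pu Pv; rewrite sip_sqD ?sipNr ?sipNl//; try exact: sipN.
by rewrite opprK; ring.
Qed.

Lemma sip_parallelogram u v : P u -> P v ->
  B (u - v) (u - v) = 2 * B u u + 2 * B v v - B (u + v) (u + v).
Proof. by move=> Pu Pv; rewrite sip_sqB// sip_sqD//; ring. Qed.

Lemma sip_sqD_le u v : P u -> P v ->
  B (u + v) (u + v) <= 2 * B u u + 2 * B v v.
Proof.
move=> Pu Pv; have := sip_parallelogram Pu Pv.
by have := sip_ge0 sB (sipB Pu Pv); lra.
Qed.

Lemma sip_CS u v : P u -> P v -> B u v ^+ 2 <= B u u * B v v.
Proof.
move=> Pu Pv.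
have h t : 0 <= B u u + 2 * t * B u v + t ^+ 2 * B v v.
  have := sip_ge0 sB (sipD sB Pu (sipZ sB t Pv)).
  rewrite sip_sqD//; last exact: (sipZ sB).
  rewrite sipZr// (sipZl sB)// ?sipZr//; last exact: (sipZ sB).
  by rewrite expr2 !mulrA.
have [v0|v0] := eqVneq (B v v) 0.
  suff -> : B u v = 0 by rewrite v0 mulr0 expr0n.
  apply/eqP; apply: contraT => uv0.
  (* With [B v v = 0] the expression in [h] is affine in [t], and it takes the value -1 here. *)
  have := h (- (B u u + 1) / (2 * B u v)).
  rewrite v0 mulr0 addr0.
  have -> : 2 * (- (B u u + 1) / (2 * B u v)) * B u v = - (B u u + 1) by field.
  by rewrite opprD addrA subrr; lra.
have vp : 0 < B v v by rewrite lt_neqAle eq_sym v0/= (sip_ge0 sB).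
have := h (- B u v / B v v).
have -> : B u u + 2 * (- B u v / B v v) * B u v + (- B u v / B v v) ^+ 2 * B v v
   = (B u u * B v v - B u v ^+ 2) / B v v by field.
by rewrite pmulr_lge0 ?invr_gt0// subr_ge0.
Qed.

Definition snorm u := Num.sqrt (B u u).

Lemma snorm_sq u : P u -> snorm u ^+ 2 = B u u.
Proof. by move=> Pu; rewrite sqr_sqrtr// (sip_ge0 sB). Qed.

Lemma sip_le_snorm u v : P u -> P v -> `|B u v| <= snorm u * snorm v.
Proof.
move=> Pu Pv; rewrite -(@ler_pXn2r _ 2)// ?nnegrE ?mulr_ge0 ?sqrtr_ge0//.
by rewrite exprMn !snorm_sq// real_normK ?num_real// sip_CS.
Qed.

Lemma snormD u v : P u -> P v -> snorm (u + v) <= snorm u + snorm v.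
Proof.
move=> Pu Pv; rewrite -(@ler_pXn2r _ 2)// ?nnegrE ?addr_ge0 ?sqrtr_ge0//.
rewrite snorm_sq ?sip_sqD//; last exact: (sipD sB).
rewrite sqrrD !snorm_sq// lerD2r lerD2l -[leRHS]mulr_natl.
by rewrite ler_pM2l// (le_trans (ler_norm _))// sip_le_snorm.
Qed.

Lemma snormZ a u : P u -> snorm (a *: u) = `|a| * snorm u.
Proof.
move=> Pu; rewrite /snorm (sipZl sB)// ?sipZr//; last exact: (sipZ sB).
by rewrite mulrA -expr2 sqrtrM ?sqr_ge0// sqrtr_sqr.
Qed.

Lemma sip_comb (a b : R) u v : P u -> P v -> P (a *: u + b *: v).
Proof. by move=> Pu Pv; apply: (sipD sB); exact: (sipZ sB). Qed.

Lemma sip_combl (a b : R) u v w : P u -> P v -> P w ->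
  B (a *: u + b *: v) w = a * B u w + b * B v w.
Proof.
move=> Pu Pv Pw; rewrite (sipDl sB (sipZ sB a Pu) (sipZ sB b Pv) Pw).
by rewrite (sipZl sB _ Pu Pw) (sipZl sB _ Pv Pw).
Qed.

Lemma sip_combr (a b : R) u v w : P u -> P v -> P w ->
  B w (a *: u + b *: v) = a * B w u + b * B w v.
Proof.
move=> Pu Pv Pw; rewrite (sipC sB Pw (sip_comb a b Pu Pv)) sip_combl//.
by rewrite (sipC sB Pu Pw) (sipC sB Pv Pw).
Qed.

Lemma sip_sq_comb (a b : R) u v : P u -> P v ->
  B (a *: u + b *: v) (a *: u + b *: v) = a ^+ 2 * B u u + 2 * a * b * B u v + b ^+ 2 * B v v.
Proof.
move=> Pu Pv; have Pw := sip_comb a b Pu Pv.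
rewrite (sip_combl a b Pu Pv Pw) !sip_combr// (sipC sB Pv Pu).
by move: (B u u) (B u v) (B v v) => x y z; ring.
Qed.

End semi_inner_product.

(** * The space L2 and its completeness *)

Section L2_space.
Context {R : realType} {N : nat}.
Variable Omega : set 'rV[R]_N.
Hypothesis mO : measurable Omega.
Let mu := lebesgue_rV R N.
Implicit Types f g h : 'rV[R]_N -> R.

Lemma L2_sq_integrable f : L2 Omega f ->
  mu.-integrable Omega (EFin \o (fun x => f x ^+ 2)).
Proof.
move=> [mf fi]; apply/integrableP; split.
  by apply/measurable_EFinP; exact: measurable_funX.
apply: le_lt_trans fi; apply: ge0_le_integral => //=.
- by apply/measurable_EFinP; apply: measurableT_comp => //; exact: measurable_funX.
- by apply/measurable_EFinP; exact: measurable_funX.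
by move=> x _; rewrite lee_fin ger0_norm// sqr_ge0.
Qed.

Lemma L2M_integrable f g : L2 Omega f -> L2 Omega g ->
  mu.-integrable Omega (EFin \o (fun x => f x * g x)).
Proof.
move=> Lf Lg; have [mf _] := Lf; have [mg _] := Lg.
apply: (le_integrable mO _ _ (integrableD mO (L2_sq_integrable Lf) (L2_sq_integrable Lg))).
  by apply/measurable_EFinP; exact: measurable_funM.
move=> x _ /=; rewrite lee_fin normrM.
rewrite [leRHS]ger0_norm ?addr_ge0 ?sqr_ge0// -[f x ^+ 2]real_normK ?num_real//.
rewrite -[g x ^+ 2]real_normK ?num_real//.
by have := sqr_ge0 (`|f x| - `|g x|); have := sqr_ge0 (`|f x| + `|g x|); nra.
Qed.

Lemma L2_dom f (g : 'rV[R]_N -> R) : measurable_fun Omega f ->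
  mu.-integrable Omega (EFin \o g) ->
  (forall x, Omega x -> f x ^+ 2 <= g x) -> L2 Omega f.
Proof.
move=> mf /integrableP[mg]; move=> gi fg; split => //.
apply: le_lt_trans gi; apply: ge0_le_integral => //=.
- by move=> x _; rewrite lee_fin sqr_ge0.
- by apply/measurable_EFinP; exact: measurable_funX.
- by apply/measurable_EFinP; apply: measurableT_comp => //; apply/measurable_EFinP.
by move=> x Ox; rewrite lee_fin (le_trans (fg x Ox))// ler_norm.
Qed.

Lemma integrable_cst (c : R) : (mu Omega < +oo)%E ->
  mu.-integrable Omega (EFin \o (cst c)).
Proof.
move=> Ofin; apply/integrableP; split.
  by apply/measurable_EFinP; exact: measurable_cst.
rewrite (_ : (fun x => _) = cst (`|c|%:E)) //.
by rewrite integral_cst//= lte_mul_pinfty// lee_fin.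
Qed.

Lemma L2_bounded f (c : R) : (mu Omega < +oo)%E -> measurable_fun Omega f ->
  (forall x, Omega x -> `|f x| <= c) -> L2 Omega f.
Proof.
move=> Ofin mf fc; apply: (L2_dom (g := cst (c ^+ 2))) => //.
  exact: integrable_cst.
move=> x Ox; rewrite -[f x ^+ 2]real_normK ?num_real//.
by rewrite ler_pXn2r ?nnegrE ?fc// (le_trans _ (fc _ Ox)).
Qed.

Lemma L2D f g : L2 Omega f -> L2 Omega g -> L2 Omega (f + g).
Proof.
move=> Lf Lg; have [mf _] := Lf; have [mg _] := Lg.
apply: (@L2_dom _ (fun x => 2 * (f x ^+ 2 + g x ^+ 2))).
- exact: measurable_funD.
- apply: (eq_integrable mO _ _ _ (integrableZl mO 2
    (integrableD mO (L2_sq_integrable Lf) (L2_sq_integrable Lg)))).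
  by move=> x _ /=; rewrite EFinM EFinD.
by move=> x _; have := sqr_ge0 (f x - g x); rewrite -[(f + g) x]/(f x + g x); nra.
Qed.

Lemma L2Z a f : L2 Omega f -> L2 Omega (a *: f).
Proof.
move=> Lf; have [mf _] := Lf.
apply: (@L2_dom _ (fun x => a ^+ 2 * f x ^+ 2)).
- by apply: measurable_funM => //; exact: measurable_cst.
- apply: (eq_integrable mO _ _ _ (integrableZl mO (a ^+ 2) (L2_sq_integrable Lf))).
  by move=> x _ /=; rewrite EFinM.
by move=> x _; rewrite -exprMn.
Qed.

Lemma L2_inner_semi_inner : semi_inner (L2 Omega) (L2_inner Omega).
Proof.
split.
- exact: L2D.
- exact: L2Z.
- by move=> f g _ _; apply: eq_Rintegral => x _; rewrite mulrC.
- move=> f g h Lf Lg Lh; rewrite /L2_inner -RintegralD//; try exact: L2M_integrable.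
  by apply: eq_Rintegral => x _; rewrite mulrDl.
- move=> a f h Lf Lh; rewrite /L2_inner -RintegralZl//; last exact: L2M_integrable.
  by apply: eq_Rintegral => x _; rewrite mulrA.
- by move=> f _; apply: Rintegral_ge0 => x _; rewrite -expr2 sqr_ge0.
Qed.

Lemma L2_innerE f : L2 Omega f ->
  (\int[mu]_(x in Omega) (f x ^+ 2)%:E)%E = (L2_inner Omega f f)%:E.
Proof.
move=> Lf; rewrite /L2_inner /Rintegral fineK.
  by apply: eq_integral => x _; rewrite expr2.
exact: (integrable_fin_num mO (L2M_integrable Lf Lf)).
Qed.

Lemma L2_cvgP (phi : nat -> 'rV[R]_N -> R) f :
  (forall n, L2 Omega (phi n)) -> L2 Omega f ->
  L2_cvg Omega phi f <->
  (fun n => L2_inner Omega (phi n - f) (phi n - f)) @ \oo --> (0 : R).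
Proof.
move=> Lp Lf; rewrite /L2_cvg.
have -> : (fun n => \int[mu]_(x in Omega) ((phi n x - f x) ^+ 2)%:E)%E =
    EFin \o (fun n => L2_inner Omega (phi n - f) (phi n - f)).
  apply/funext => n /=; rewrite -L2_innerE//.
  exact: (sipB L2_inner_semi_inner).
split=> [|h]; first by move/fine_cvg.
by apply/fine_cvgP; split => //; apply: nearW.
Qed.

Lemma L2_inner_ae f f' g g' : L2 Omega f -> L2 Omega g ->
  L2 Omega f' -> L2 Omega g' -> ae_eq Omega f f' -> ae_eq Omega g g' ->
  L2_inner Omega f g = L2_inner Omega f' g'.
Proof.
move=> Lf Lg Lf' Lg' ff' gg'; congr fine; apply: ae_eq_integral => //.
- by have /integrableP[] := L2M_integrable Lf Lg.
- by have /integrableP[] := L2M_integrable Lf' Lg'.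
by near=> x => Ox; rewrite (near ff' x)// (near gg' x).
Unshelve. all: by end_near. Qed.

Lemma L2_inner_eq0 f g : L2 Omega f -> L2 Omega g ->
  L2_inner Omega (f - g) (f - g) = 0 -> ae_eq Omega f g.
Proof.
move=> Lf Lg h0; have Lfg : L2 Omega (f - g) by exact: (sipB L2_inner_semi_inner).
have := L2_innerE Lfg; rewrite h0 => i0.
have mfg : measurable_fun Omega (fun x => ((f - g) x ^+ 2)%:E).
  by have /integrableP[] := L2_sq_integrable Lfg.
have := (ae_eq_integral_abs mu mO mfg).1.
move=> H; have {}H : measure_negligible.ae_eq mu Omega (fun x => ((f - g) x ^+ 2)%:E) (cst 0%E).
  apply: H; rewrite -[RHS]i0; apply: eq_integral => x _.
  by rewrite gee0_abs// lee_fin sqr_ge0.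
apply: filterS H => x Hx Ox.
have /eqP := Hx Ox; rewrite eqe sqrf_eq0 => h.
by apply/eqP; rewrite -subr_eq0; exact: h.
Qed.

(** The sum of the squares has integral at most [2 * c], so it is finite a.e., and it dominates each
    term. This turns geometric L2 bounds into pointwise convergence, both for completeness and for
    averages over shrinking balls. *)
Lemma ae_bounded_of_geometric (g : nat -> 'rV[R]_N -> R) (c : R) :
  (forall k, measurable_fun Omega (g k)) ->
  (forall k, (\int[mu]_(x in Omega) (g k x ^+ 2)%:E <= (c * 2 ^- k)%:E)%E) ->
  {ae mu, forall x, Omega x -> exists C, forall k, g k x ^+ 2 <= C}.
Proof.
move=> mg hg.
have mg2 k : measurable_fun Omega (fun x => (g k x ^+ 2)%:E).
  by apply/measurable_EFinP; exact: measurable_funX.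
pose S x := (\big[+%E/0%R]_(0 <= k <oo) (g k x ^+ 2)%:E)%E.
have Sge k x : ((g k x ^+ 2)%:E <= S x)%E.
  apply: (le_trans _ (nneseries_lim_ge k.+1 _)) => [|n _ _]; last first.
    by rewrite lee_fin sqr_ge0.
  by rewrite big_nat_recr//= leeDr// sume_ge0// => n _; rewrite lee_fin sqr_ge0.
have S0 x : (0 <= S x)%E by apply: le_trans (Sge 0%N x); rewrite lee_fin sqr_ge0.
have mS : measurable_fun Omega S.
  by apply: ge0_emeasurable_sum => // k x _ _; rewrite lee_fin sqr_ge0.
have : mu.-integrable Omega S.
  apply/integrableP; split => //.
  under eq_integral do rewrite gee0_abs//.
  rewrite integral_nneseries//; last by move=> n x _; rewrite lee_fin sqr_ge0.
  apply: (@le_lt_trans _ _ (2 * c)%:E); last exact: ltry.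
  apply: lime_le.
    by apply: is_cvg_nneseries => n _ _; apply: integral_ge0 => x _; rewrite lee_fin sqr_ge0.
  apply: nearW => n.
  have c0 : 0 <= c.
    rewrite -lee_fin; have := hg 0%N; rewrite expr0 invr1 mulr1; apply: le_trans.
    by apply: integral_ge0 => x _; rewrite lee_fin sqr_ge0.
  apply: (@le_trans _ _ (\sum_(0 <= k < n) (c * 2 ^- k)%:E)%E); first exact: lee_sum.
  rewrite sumEFin lee_fin.
  suff -> : \sum_(0 <= k < n) c * 2 ^- k = 2 * c * (1 - 2 ^- n).
    by rewrite ler_piMr ?mulr_ge0// gerBl invr_ge0 exprn_ge0.
  elim: n => [|n IH]; first by rewrite big_geq// expr0 invr1 subrr mulr0.
  rewrite big_nat_recr//= IH exprS invfM; have : (2 : R) ^+ n != 0 by rewrite expf_neq0.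
  by move=> ?; field.
move/(integrable_ae mO); apply: filterS => x Sx Ox.
exists (fine (S x)) => k; rewrite -lee_fin fineK//; exact: Sx.
Qed.

(** The Riesz-Fischer argument: a fast subsequence converges a.e., and Fatou's lemma makes its limit
    the L2 limit of the whole sequence. *)
Lemma L2_complete (f : nat -> 'rV[R]_N -> R) : (forall n, L2 Omega (f n)) ->
  (forall e, 0 < e -> exists n0, forall m n, (n0 <= m)%N -> (n0 <= n)%N ->
    L2_inner Omega (f m - f n) (f m - f n) <= e) ->
  exists g, L2 Omega g /\ L2_cvg Omega f g.
Proof.
move=> Lf cf; have sI := L2_inner_semi_inner.
have mf n : measurable_fun Omega (f n) by have [] := Lf n.
have /choice[s hs] : forall k, exists s, forall m n, (s <= m)%N -> (s <= n)%N ->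
    L2_inner Omega (f m - f n) (f m - f n) <= 8 ^- k.
  by move=> k; apply: cf; rewrite invr_gt0 exprn_gt0.
(* Summing the thresholds makes [t k] at least [s j] for every [j <= k], so that [t k] and [t k.+1]
   both lie beyond [s k]. *)
pose t k := (k + \sum_(j < k.+1) s j)%N.
have st j k : (j <= k)%N -> (s j <= t k)%N.
  by move=> jk; rewrite /t (bigD1 (Ordinal (jk : (j < k.+1)%N)))//= addnCA leq_addr.
pose h k := f (t k).
have hh k : L2_inner Omega (h k.+1 - h k) (h k.+1 - h k) <= 8 ^- k.
  by apply: hs; apply: st.
(* The squared norm of [d k] is at most [4 ^+ k * 8 ^- k = 2 ^- k]; a bound on [d k x] uniform in
   [k] then makes the increments of [h] at [x] geometrically small. *)
pose d k x := 2 ^+ k * (h k.+1 x - h k x).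
have aeb : {ae mu, forall x, Omega x -> exists C, forall k, d k x ^+ 2 <= C}.
  apply: (@ae_bounded_of_geometric d 1) => k.
    by apply: measurable_funM; [exact: measurable_cst|by apply: measurable_funB; exact: mf].
  have Ld : L2 Omega (2 ^+ k *: (h k.+1 - h k)).
    by apply: (sipZ sI); apply: (sipB sI); exact: Lf.
  rewrite [leLHS](L2_innerE Ld) lee_fin mul1r (sipZl sI)// ?(sipZr sI)//.
  - rewrite mulrA -exprMn; apply: (@le_trans _ _ ((2 * 2) ^+ k * 8 ^- k)).
      by rewrite ler_pM2l ?exprn_gt0.
    rewrite -exprVn -exprMn -exprVn.
    by have -> : (2 * 2 * 8^-1 : R) = 2^-1 by field.
  - by apply: (sipB sI); exact: Lf.
  - by apply: (sipB sI); exact: Lf.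
  - by apply: (sipB sI); exact: Lf.
(* The upper limit is measurable and defined everywhere; [fine] gives 0 where it is infinite, which
   happens only on a null set. *)
pose g x := fine (limn_esup (fun k => (h k x)%:E)).
have mg : measurable_fun Omega g.
  apply: measurableT_comp => //.
  by apply: measurable_fun_limn_esup => k; apply/measurable_EFinP; exact: mf.
have hg : {ae mu, forall x, Omega x -> (fun k => h k x) @ \oo --> g x}.
  apply: filterS aeb => x + Ox => /(_ Ox)[C hC].
  suff /cvg_ex[l hl] : cvgn (fun k => h k x).
    have El : (fun k => (h k x)%:E) @ \oo --> l%:E by exact: cvg_comp hl _.
    rewrite /g is_cvg_limn_esupE; last by apply/cvg_ex; exists l%:E.
    by move/cvg_lim : El => ->.
  have C0 : 0 <= C by apply: le_trans (hC 0%N); exact: sqr_ge0.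
  have dC k : `|h k.+1 x - h k x| <= Num.sqrt C * 2^-1 ^+ k.
    rewrite exprVn ler_pdivlMr ?exprn_gt0// mulrC -[2 ^+ k]ger0_norm ?exprn_ge0//.
    rewrite -normrM -[leLHS]ger0_norm// -sqrtr_sqr ler_sqrt// real_normK ?num_real//.
    exact: hC.
  have -> : (fun k => h k x) = (fun k => h 0%N x + series (fun k => h k.+1 x - h k x) k).
    apply/funext => k; rewrite /series/= telescope_sumr//; ring.
  apply: is_cvgD; first exact: is_cvg_cst.
  apply: normed_cvg.
  apply: (series_le_cvg _ _ dC) => //.
  apply: is_cvg_geometric_series.
  by rewrite ger0_norm// invf_lt1// ltr1n.
have fat n : (\int[mu]_(x in Omega) ((f n x - g x) ^+ 2)%:E <=
    limn_einf (fun k => \int[mu]_(x in Omega) ((f n x - h k x) ^+ 2)%:E))%E.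
  apply: le_trans (fatou mu mO _ _) => [|k|k x _]; last 2 first.
  - by apply/measurable_EFinP; apply: measurable_funX; apply: measurable_funB => //; exact: mf.
  - by rewrite lee_fin sqr_ge0.
  apply: ae_ge0_le_integral => //.
  - by move=> x _; rewrite lee_fin sqr_ge0.
  - by apply/measurable_EFinP; apply: measurable_funX; apply: measurable_funB => //; exact: mf.
  - move=> x _; rewrite limn_einf_lim; apply: lime_ge; first exact: is_cvg_einfs.
    apply: nearW => k; apply: le_ereal_inf_tmp => _ [m _ <-].
    by rewrite lee_fin sqr_ge0.
  - under eq_fun do rewrite -[limn_einf _]oppeK -limn_esupN.
    apply: measurableT_comp => //; apply: measurable_fun_limn_esup => k.
    apply: measurableT_comp => //; apply/measurable_EFinP.
    by apply: measurable_funX; apply: measurable_funB => //; exact: mf.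
  apply: filterS hg => x hx Ox.
  have hl : (fun k => ((f n x - h k x) ^+ 2)%:E) @ \oo --> ((f n x - g x) ^+ 2)%:E.
    apply: cvg_EFin; first exact: nearW.
    have hx' : f n x - h k x @[k --> \oo] --> f n x - g x.
      by apply: cvgB; [exact: cvg_cst|exact: hx].
    exact: (cvgM hx' hx').
  rewrite is_cvg_limn_einfE; last by apply/cvg_ex; eexists; exact: hl.
  by move/cvg_lim : hl => ->.
have bnd e n0 n : (forall m n, (n0 <= m)%N -> (n0 <= n)%N ->
    L2_inner Omega (f m - f n) (f m - f n) <= e) -> (n0 <= n)%N ->
    (\int[mu]_(x in Omega) ((f n x - g x) ^+ 2)%:E <= e%:E)%E.
  move=> he n0n; apply: le_trans (fat n) _; rewrite limn_einf_lim.
  apply: lime_le; first exact: is_cvg_einfs.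
  apply: nearW => k; rewrite /einfs/=.
  apply: ge_ereal_inf.
  exists (\int[mu]_(x in Omega) ((f n x - h (maxn k n0) x) ^+ 2)%:E)%E.
    by exists (maxn k n0) => //=; exact: leq_maxl.
  rewrite [leLHS](L2_innerE (sipB sI (Lf n) (Lf _))) lee_fin; apply: he => //.
  by rewrite (leq_trans (leq_maxr k n0))// leq_addr.
have mfg n : measurable_fun Omega (f n - g) by apply: measurable_funB => //; exact: mf.
have Lg : L2 Omega g.
  have [n0 hn0] := cf 1 ltr01.
  have -> : g = f n0 - (f n0 - g) by rewrite subKr.
  apply: (sipB sI) => //; split; first exact: mfg.
  exact: le_lt_trans (bnd 1 n0 n0 hn0 (leqnn _)) (ltry _).
exists g; split => //; apply/(L2_cvgP Lf Lg).
apply/cvgrPdist_le => e e0; have [n0 hn0] := cf e e0.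
exists n0 => // n /= n0n; rewrite sub0r normrN ger0_norm; last first.
  by apply: (sip_ge0 sI); exact: (sipB sI).
rewrite -lee_fin -(L2_innerE (sipB sI (Lf n) Lg)).
exact: (bnd e n0).
Qed.

End L2_space.

(** * Bump functions *)

Section smooth_functions_of_one_variable.
Context {R : realType}.
Implicit Types g : R -> R.

(** All the derivatives are given at once, so that smoothness is shown by exhibiting a family of
    functions that is stable under differentiation. *)
Definition smooth1 g := exists G : nat -> R -> R,
  G 0%N = g /\ forall n x, is_derive x (1 : R) (G n) (G n.+1 x).

Lemma is_derive_continuous g (x dg : R) : is_derive x (1 : R) g dg -> {for x, continuous g}.
Proof. by move=> [h _]; apply/differentiable_continuous/derivable1_diffP. Qed.

Lemma is_derive_quadratic g (C : R) : (forall h, `|g h| <= C * h ^+ 2) ->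
  is_derive (0 : R) (1 : R) g 0.
Proof.
move=> hg; have g0 : g 0 = 0.
  by apply/normr0_eq0/le_anti; rewrite normr_ge0 andbT (le_trans (hg 0))// expr0n mulr0.
have C0 : 0 <= C by have := hg 1; rewrite expr1n mulr1; apply: le_trans.
have cv : h^-1 *: ((g \o shift 0) (h *: (1 : R)) - g 0) @[h --> (0 : R)^'] --> (0 : R).
  apply/cvgrPdist_le => e e0; near=> h.
  rewrite sub0r normrN g0 subr0 /= addr0 [h *: 1]mulr1 normrM normfV.
  have h0 : h != 0 by near: h; exact: nbhs_dnbhs_neq.
  have hp : 0 < `|h| by rewrite normr_gt0.
  rewrite mulrC ler_pdivrMr// (le_trans (hg h))// -real_normK ?num_real// expr2 mulrA.
  rewrite ler_pM2r//.
  apply: (@le_trans _ _ ((C + 1) * `|h|)); first by rewrite ler_pM2r// lerDl.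
  rewrite -ler_pdivlMl; last by rewrite ltr_wpDl.
  near: h; apply: dnbhs0_le.
  by rewrite mulr_gt0// invr_gt0 ltr_wpDl.
split; first by apply/cvg_ex; exists 0.
exact/cvg_lim.
Unshelve. all: by end_near. Qed.

End smooth_functions_of_one_variable.

(** * Flat functions and their iterated primitives *)

Section flat_profile.
Context {R : realType}.

Definition flat (P : {poly R}) (p : R) : R :=
  if 0 < p then P.[p^-1] * expR (- p^-1) else 0.

Lemma expR_ge_pow (n : nat) (s : R) : 0 <= s -> (s / n.+1%:R) ^+ n.+1 <= expR s.
Proof.
move=> s0; have n0 : (n.+1%:R : R) != 0 by rewrite pnatr_eq0.
have -> : expR s = expR (s / n.+1%:R) ^+ n.+1 by rewrite -expRM_natl mulrCA divff// mulr1.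
rewrite ler_pXn2r ?nnegrE ?expR_ge0 ?divr_ge0//.
by apply: le_trans (expR_ge1Dx _); rewrite lerDr.
Qed.

Lemma pow_expRN_le (n : nat) : exists C : R, forall s, 0 < s ->
  s ^+ n * expR (- s) <= C / s.
Proof.
exists (n.+1%:R ^+ n.+1) => s s0.
rewrite expRN -ler_pdivlMr ?invr_gt0 ?expR_gt0// invrK.
rewrite mulrAC ler_pdivlMr// -exprSr mulrC -ler_pdivrMr ?exprn_gt0//.
by rewrite -expr_div_n expR_ge_pow// ltW.
Qed.

Lemma flat_le (P : {poly R}) : exists C : R, forall p, `|flat P p| <= C * `|p|.
Proof.
(* The additional power [s ^+ n] feeds the induction on [P]: multiplying [P] by ['X] raises [n] by
   one. *)
suff h : forall n, exists C : R, forall s, 0 < s -> `|P.[s]| * s ^+ n * expR (- s) <= C / s.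
  have [C hC] := h 0%N; exists `|C| => p; rewrite /flat; case: ifPn => [p0|_].
    rewrite normrM [`|expR _|]ger0_norm ?expR_ge0// (gtr0_norm p0).
    have := hC p^-1; rewrite invr_gt0 p0 => /(_ isT); rewrite expr0 mulr1 invrK.
    by move=> /le_trans; apply; rewrite ler_pM2r// ler_norm.
  by rewrite normr0 mulr_ge0.
elim/poly_ind: P => [|P c IH] n.
  exists 0 => s s0; rewrite horner0 normr0 !mul0r//.
have [C1 h1] := IH n.+1; have [C2 h2] := pow_expRN_le n.
exists (C1 + `|c| * C2) => s s0.
rewrite hornerMXaddC mulrDl -mulrA.
apply: (@le_trans _ _ (`|P.[s]| * s ^+ n.+1 * expR (- s) + `|c| * (s ^+ n * expR (- s)))).
  rewrite !mulrA -mulrDl ler_pM2r ?expR_gt0// exprS mulrA -mulrDl ler_pM2r ?exprn_gt0//.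
  by rewrite (le_trans (ler_normD _ _))// normrM (gtr0_norm s0).
by apply: lerD; [exact: h1|rewrite -mulrA ler_wpM2l// h2].
Qed.

Lemma is_derive_flat (P : {poly R}) p :
  is_derive p (1 : R) (flat P) (flat ((P - P^`()) * 'X^2) p).
Proof.
have [p0|p0|->] := ltgtP p 0.
- have -> : flat ((P - P^`()) * 'X^2) p = 0 by rewrite /flat ltNge ltW.
  apply: (@near_eq_is_derive _ _ _ (cst 0)).
  near=> q; rewrite /flat/= ltNge; suff -> : q <= 0 by [].
  by apply/ltW; near: q; exact: lt_nbhsl.
- rewrite {2}/flat p0.
  have p1 : p != 0 by rewrite gt_eqF.
  have dinv : is_derive p (1 : R) (fun q : R => q^-1) (- p ^- 2).
    by have := @is_deriveV R id p 1 1 p1 _; rewrite /GRing.scale /= mulr1; apply.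
  have dP : is_derive p (1 : R) (fun q => P.[q^-1]) (P^`().[p^-1] * (- p ^- 2)).
    exact: (@is_derive1_comp R (horner P) (fun q => q^-1)).
  have dE : is_derive p (1 : R) (fun q => expR (- q^-1)) (expR (- p^-1) * (- - p ^- 2)).
    exact: (@is_derive1_comp R expR (fun q => - q^-1)).
  have dPE : is_derive p (1 : R) (fun q => P.[q^-1] * expR (- q^-1))
      (((P - P^`()) * 'X^2).[p^-1] * expR (- p^-1)).
    apply: is_derive_eq; rewrite !hornerE /GRing.scale /=; field.
    exact: p1.
  apply: near_eq_is_derive dPE.
  near=> q; rewrite /flat; suff -> : 0 < q by [].
  by near: q; exact: lt_nbhsr.
- have -> : flat ((P - P^`()) * 'X^2) 0 = 0 by rewrite /flat ltxx.
  (* Bounding [flat (P * 'X) h], which is [flat P h / h], by a multiple of [h] gives a quadratic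
     bound on [flat P] at 0, hence derivative 0. *)
  have [C hC] := flat_le (P * 'X).
  apply: (@is_derive_quadratic _ _ `|C|) => h.
  have [->|h0] := eqVneq h 0; first by rewrite /flat ltxx normr0 mulr_ge0// sqr_ge0.
  have := hC h; rewrite /flat; case: ifPn => [hp|_ _].
    rewrite hornerMX !normrM normfV (gtr0_norm hp) => hh.
    have : `|P.[h^-1]| * h^-1 * `|expR (- h^-1)| * h <= C * h * h by rewrite ler_pM2r.
    rewrite mulrAC mulfVK// => /le_trans; apply.
    by rewrite expr2 -mulrA ler_wpM2r ?ler_norm// mulr_ge0// ltW.
  by rewrite normr0 mulr_ge0// sqr_ge0.
Unshelve. all: by end_near. Qed.

Lemma smooth1_flat (P : {poly R}) : smooth1 (flat P).
Proof.
exists (fun n => flat (iter n (fun Q => (Q - Q^`()) * 'X^2) P)); split => // n x.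
exact: is_derive_flat.
Qed.

(* Iterated primitives of [exp (- 1 / p)], so that the Laplacian of a bump of
   index [m + 2] only involves the bumps of indices [m + 1] and [m]. *)
Fixpoint profile (m : nat) (p : R) : R :=
  if m is m'.+1 then 2^-1 * \int[lebesgue_measure]_(t in `[0, p]) profile m' t
  else flat 1 p.

Lemma profile_le0 m p : p <= 0 -> profile m p = 0.
Proof.
case: m => [|m] p0 /=; first by rewrite /flat ltNge p0.
move: p0; rewrite le_eqVlt => /predU1P[->|p0].
  by rewrite set_itv1 Rintegral_set1 mulr0.
by rewrite set_itv_ge ?Rintegral_set0 ?mulr0// bnd_simp -ltNge.
Qed.

Lemma is_derive_integral0 (g : R -> R) (p : R) : continuous g ->
  (forall t, t <= 0 -> g t = 0) ->
  is_derive p (1 : R) (fun y => \int[lebesgue_measure]_(t in `[0, y]) g t) (g p).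
Proof.
move=> cg g0.
(* The integrand vanishes on the negative axis, so the lower endpoint may be moved to the left of
   both 0 and [p]; then [p] is interior and the fundamental theorem applies for either sign of
   [p]. *)
pose a : R := - 1 - `|p|.
have ap : a < p by rewrite /a; have := ler_norm (- p); rewrite normrN; lra.
have a0 : a <= 0 by rewrite /a; have := normr_ge0 p; lra.
have -> : (fun y => \int[lebesgue_measure]_(t in `[0, y]) g t) =
    (fun y => \int[lebesgue_measure]_(t in `[a, y]) g t).
  apply/funext => y; rewrite Rintegral_mkcond [RHS]Rintegral_mkcond.
  congr (Rintegral _ _ _); apply/funext => t; rewrite !patchE !mem_setE !in_itv/=.
  have [t0|t0] := leP 0 t; first by rewrite (le_trans a0 t0).
  by rewrite /= g0 ?if_same// ltW.
have pp1 : p < p + 1 by rewrite ltrDl.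
have [|d1 d2] := @continuous_FTC1_closed R g a p (p + 1) pp1 _ ap (cg p).
- apply: continuous_compact_integrable; first exact: segment_compact.
  exact: continuous_subspaceT.
by split; [exact: d1|rewrite -derive1E; exact: d2].
Qed.

(** The factor [2^-1] is there to cancel the 2 in the gradient of [sqdist]; see [partial_bump]. *)
Lemma is_derive_profile m p :
  is_derive p (1 : R) (profile m.+1) (2^-1 * profile m p).
Proof.
have step n : continuous (profile n) ->
    forall p, is_derive p (1 : R) (profile n.+1) (2^-1 * profile n p).
  move=> cn q; apply: is_deriveZ; apply: is_derive_integral0 => // t.
  exact: profile_le0.
have st := step; apply: step; elim: m => [|m IH] x; first exact/is_derive_continuous/is_derive_flat.
exact/is_derive_continuous/st.
Qed.

Lemma smooth1_profile m : smooth1 (profile m).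
Proof.
elim: m => [|m [G [G0 hG]]]; first exact: smooth1_flat.
exists (fun n => if n is n'.+1 then (fun x => 2^-1 * G n' x) else profile m.+1).
split => // -[|n] x; first by rewrite G0; exact: is_derive_profile.
by apply: is_deriveZ; exact: hG.
Qed.

Lemma profile_ge0 m p : 0 <= profile m p.
Proof.
elim: m p => [|m IH] p /=.
  by rewrite /flat; case: ifPn => // _; rewrite hornerC mul1r expR_ge0.
by rewrite mulr_ge0// Rintegral_ge0.
Qed.

Lemma profile0_gt0 p : 0 < p -> 0 < profile 0 p.
Proof. by move=> p0; rewrite /= /flat p0 hornerC mul1r expR_gt0. Qed.

End flat_profile.

Section smooth_absolute_value.
Context {R : realType} (e : R).
Hypothesis e0 : 0 < e.

(** A smooth substitute for the absolute value, with derivative at most 1 in modulus: up to the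
    constant [e], it makes minimising sequences nonnegative while they remain test functions. *)
Definition sabs (t : R) : R := Num.sqrt (t ^+ 2 + e ^+ 2).
Let w (t : R) : R := (sabs t)^-1.

Lemma sabs_gt0 t : 0 < sabs t.
Proof. by rewrite sqrtr_gt0 ltr_wpDl ?sqr_ge0 ?exprn_gt0. Qed.

Lemma sqr_sabs t : sabs t ^+ 2 = t ^+ 2 + e ^+ 2.
Proof. by rewrite sqr_sqrtr// addr_ge0 ?sqr_ge0. Qed.

Lemma is_derive_sabs t : is_derive t (1 : R) sabs (t / sabs t).
Proof.
have p0 : 0 < t ^+ 2 + e ^+ 2 by rewrite ltr_wpDl ?sqr_ge0 ?exprn_gt0.
have d1 := @is_derive1_sqrt R _ p0.
have d2 : is_derive t (1 : R) (fun x => x ^+ 2 + e ^+ 2) (2 * t).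
  by apply: is_derive_eq; rewrite /GRing.scale/=; ring.
have := @is_derive1_comp R Num.sqrt (fun x => x ^+ 2 + e ^+ 2) t _ _ d1 d2.
rewrite -/(sabs t); have := sabs_gt0 t => s0.
suff -> : (2 * sabs t)^-1 * (2 * t) = t / sabs t by [].
by field; rewrite gt_eqF.
Qed.

Lemma smooth1_sabs : smooth1 sabs.
Proof.
have dw t : is_derive t (1 : R) w (- t * w t ^+ 3).
  have s0 : sabs t != 0 by rewrite gt_eqF// sabs_gt0.
  have := is_deriveV s0 (is_derive_sabs t).
  suff -> : - sabs t ^- 2 *: (t / sabs t) = - t * w t ^+ 3 by [].
  by rewrite /w /GRing.scale/=; field.
(* Derivatives of [sabs] have the form [Q w^j] with [w = 1 / sabs]. Since [w' = - t w^3], the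
   derivative of such a term is [(Q' (t^2 + e^2) - j t Q) w^(j+2)]. *)
pose D (Qj : {poly R} * nat) : {poly R} * nat :=
  (Qj.1^`() * ('X^2 + (e ^+ 2)%:P) - Qj.1 * 'X *+ Qj.2, Qj.2.+2).
(* The starting pair expresses [sabs] itself as [(t^2 + e^2) w]. *)
pose G n t := let Qj := iter n D ('X^2 + (e ^+ 2)%:P, 1%N) in Qj.1.[t] * w t ^+ Qj.2.
exists G; split.
  apply/funext => t; rewrite /G/= expr1 !hornerE -sqr_sabs expr2 /w mulfK//.
  by rewrite gt_eqF// sabs_gt0.
move=> n x; rewrite /G /=; case: (iter n D _) => Q j /=.
have s0 : sabs x != 0 by rewrite gt_eqF// sabs_gt0.
have dwj := @is_deriveX _ _ w j x _ _ (dw x).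
have -> : (fun t => Q.[t] * w t ^+ j) = (horner Q * w ^+ j).
  by apply/funext => t; rewrite -[in RHS]/(horner Q t * (w ^+ j) t) exprfctE.
have -> : (Q^`() * ('X^2 + (e ^+ 2)%:P) - Q * 'X *+ j).[x] =
    Q^`().[x] * sabs x ^+ 2 - Q.[x] * x *+ j.
  by rewrite hornerD hornerN hornerMn !hornerM hornerD hornerXn hornerC hornerX sqr_sabs.
have wE : (w ^+ j) x = w x ^+ j by rewrite exprfctE.
apply: is_derive_eq; rewrite wE /GRing.scale /= {dwj wE}.
have wx : w x = (sabs x)^-1 by [].
case: j => [|j]; first by rewrite mulr0n mul0r mul0r mulr0 add0r expr0 subr0 wx; field.
rewrite -(mulr_natr (Q.[x] * x)) succnK !exprS !expr0 wx.
by move: ((sabs x)^-1 ^+ j) (j.+1%:R) => W J; field.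
Qed.

Lemma sabs_bounds t : `|t| <= sabs t /\ sabs t <= `|t| + e.
Proof.
split; rewrite -(@ler_pXn2r _ 2)// ?nnegrE ?sqrtr_ge0 ?addr_ge0 ?(ltW e0)//;
  rewrite sqr_sabs.
  by rewrite real_normK ?num_real// lerDl sqr_ge0.
by rewrite sqrrD real_normK ?num_real// lerD2r lerDl mulrn_wge0// mulr_ge0// ltW.
Qed.

End smooth_absolute_value.

Section smooth_functions.
Context {R : realType} {N : nat}.
Implicit Types (i : 'I_N) (f g : 'rV[R]_N -> R) (k : nat).

Lemma CkS_intro k f : continuous f ->
  (forall i, exists2 g, (forall x, is_derive x (delta_mx 0 i) f (g x)) & Ck k g) ->
  Ck k.+1 f.
Proof.
move=> cf hf; split => // i; have [g hg Cg] := hf i; split.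
  by move=> x; have [] := hg x.
suff -> : partial i f = g by [].
by apply/funext => x; have [_] := hg x.
Qed.

Lemma Ck_continuous k f : Ck k f -> continuous f.
Proof. by case: k => [|k] []. Qed.

Lemma Ck_is_derive k f i x : Ck k.+1 f ->
  is_derive x (delta_mx 0 i) f (partial i f x).
Proof. by move=> [_ /(_ i)[/(_ x) h _]]; exact: derivableP. Qed.

Lemma Ck_partial k f i : Ck k.+1 f -> Ck k (partial i f).
Proof. by move=> [_ /(_ i)[]]. Qed.

Lemma CkW k f : Ck k.+1 f -> Ck k f.
Proof.
elim: k f => [|k IH] f Cf; first by split => //; exact: Ck_continuous Cf.
apply: CkS_intro; first exact: Ck_continuous Cf.
move=> i; exists (partial i f); first by move=> x; exact: Ck_is_derive Cf.
exact/IH/Ck_partial.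
Qed.

Lemma Ck_cst k (c : R) : Ck k (cst c : 'rV[R]_N -> R).
Proof.
elim: k c => [|k IH] c; first by split => //; exact: cst_continuous.
apply: CkS_intro; first exact: cst_continuous.
by move=> i; exists (cst 0) => // x; exact: is_derive_cst.
Qed.

Lemma CkD k f g : Ck k f -> Ck k g -> Ck k (f + g).
Proof.
elim: k f g => [|k IH] f g Cf Cg.
  by split => // x; apply: continuousD; [exact: Ck_continuous Cf x|exact: Ck_continuous Cg x].
apply: CkS_intro.
  by move=> x; apply: continuousD; [exact: Ck_continuous Cf x|exact: Ck_continuous Cg x].
move=> i; exists (partial i f + partial i g); last by apply: IH; exact: Ck_partial.
by move=> x; exact: (is_deriveD (Ck_is_derive i x Cf) (Ck_is_derive i x Cg)).
Qed.

Lemma CkM k f g : Ck k f -> Ck k g -> Ck k (f * g).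
Proof.
elim: k f g => [|k IH] f g Cf Cg.
  by split => // x; apply: continuousM; [exact: Ck_continuous Cf x|exact: Ck_continuous Cg x].
apply: CkS_intro.
  by move=> x; apply: continuousM; [exact: Ck_continuous Cf x|exact: Ck_continuous Cg x].
move=> i; exists (f * partial i g + g * partial i f).
  by move=> x; exact: (is_deriveM (Ck_is_derive i x Cf) (Ck_is_derive i x Cg)).
by apply: CkD; apply: IH; by [exact: CkW|exact: Ck_partial].
Qed.

Lemma is_derive_coor j i (x : 'rV[R]_N) :
  is_derive x (delta_mx 0 i) (fun v : 'rV[R]_N => v ord0 j) ((i == j)%:R).
Proof.
have E : h^-1 *: (((fun v : 'rV[R]_N => v ord0 j) \o shift x) (h *: delta_mx 0 i) - x ord0 j)
    @[h --> (0 : R)^'] --> ((i == j)%:R : R).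
  apply: cvg_near_cst; near=> h; rewrite /= !mxE addrK eqxx/= eq_sym.
  by rewrite /GRing.scale/= mulKf//; near: h; exact: nbhs_dnbhs_neq.
split; first by apply/cvg_ex; exists (i == j)%:R.
exact/cvg_lim.
Unshelve. all: by end_near. Qed.

Lemma Ck_coor k j : Ck k (fun v : 'rV[R]_N => v ord0 j).
Proof.
case: k => [|k]; first by split => //; exact: coord_continuous.
apply: CkS_intro; first exact: coord_continuous.
move=> i; exists (cst (i == j)%:R); last exact: Ck_cst.
by move=> x; exact: is_derive_coor.
Qed.

Lemma is_derive_comp1 f (g : R -> R) (x v : 'rV[R]_N) (df dg : R) :
  is_derive x v f df -> is_derive (f x) (1 : R) g dg ->
  is_derive x v (g \o f) (dg * df).
Proof.
move=> [f1 f2] hg.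
pose phi (h : R) := f (h *: v + x).
have E F (y : R) : h^-1 *: ((F \o shift x) (h *: v) - F x) @[h --> (0 : R)^'] --> y <->
    h^-1 *: (((fun h => F (h *: v + x)) \o shift 0) (h *: (1 : R)) -
      (fun h => F (h *: v + x)) 0) @[h --> (0 : R)^'] --> y.
  have -> // : (fun h : R => h^-1 *: ((F \o shift x) (h *: v) - F x)) =
    (fun h => h^-1 *: (((fun h => F (h *: v + x)) \o shift 0) (h *: (1 : R)) -
      (fun h => F (h *: v + x)) 0)).
  by apply/funext => h /=; rewrite scale0r add0r addr0 [h *: 1]mulr1.
have dphi : is_derive (0 : R) (1 : R) phi df.
  have c : h^-1 *: ((f \o shift x) (h *: v) - f x) @[h --> (0 : R)^'] --> df.
    by rewrite -f2; exact: f1.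
  by split; [apply/cvg_ex; exists df; apply/E|apply/cvg_lim => //; apply/E].
have hg' : is_derive (phi 0) (1 : R) g dg by rewrite /phi scale0r add0r.
have [d1 d2] := is_derive1_comp hg' dphi.
have c : h^-1 *: (((g \o f) \o shift x) (h *: v) - (g \o f) x) @[h --> (0 : R)^'] --> dg * df.
  by apply/E; rewrite -d2; exact: d1.
by split; [apply/cvg_ex; exists (dg * df)|exact/cvg_lim].
Qed.

Lemma Ck_comp k f (g : R -> R) : Ck k f -> smooth1 g -> Ck k (g \o f).
Proof.
move=> Cf [G [<- hG]].
suff h : forall k f n, Ck k f -> Ck k (G n \o f) by exact: h.
move=> {k f Cf}; elim=> [|k IH] f n Cf.
all: have cGf : continuous (G n \o f).
1,3: move=> x; apply: continuous_comp; first exact: Ck_continuous Cf x.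
1,2: exact: is_derive_continuous (hG n (f x)).
  by split.
apply: CkS_intro => // i; exists ((G n.+1 \o f) * partial i f).
  by move=> x; exact: is_derive_comp1 (Ck_is_derive i x Cf) (hG n (f x)).
by apply: CkM; [apply: IH; exact: CkW|exact: Ck_partial].
Qed.

Lemma smooth_continuous f : smooth f -> continuous f.
Proof. by move=> sf; exact: Ck_continuous (sf 0%N). Qed.

Lemma smooth_is_derive f i x : smooth f -> is_derive x (delta_mx 0 i) f (partial i f x).
Proof. by move=> sf; exact: Ck_is_derive (sf 1%N). Qed.

Lemma smooth_partial f i : smooth f -> smooth (partial i f).
Proof. by move=> sf k; exact: Ck_partial (sf k.+1). Qed.

Lemma smooth_cst (c : R) : smooth (cst c : 'rV[R]_N -> R).
Proof. by move=> k; exact: Ck_cst. Qed.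

Lemma smooth_coor j : smooth (fun v : 'rV[R]_N => v ord0 j).
Proof. by move=> k; exact: Ck_coor. Qed.

Lemma smoothD f g : smooth f -> smooth g -> smooth (f + g).
Proof. by move=> sf sg k; exact: CkD. Qed.

Lemma smoothM f g : smooth f -> smooth g -> smooth (f * g).
Proof. by move=> sf sg k; exact: CkM. Qed.

Lemma smoothZ (a : R) f : smooth f -> smooth (a *: f).
Proof. by move=> sf; apply: (@smoothM (cst a)) => //; exact: smooth_cst. Qed.

Lemma smooth_sum (I : Type) (s : seq I) (F : I -> 'rV[R]_N -> R) :
  (forall j, smooth (F j)) -> smooth (\sum_(j <- s) F j).
Proof.
move=> sF; elim/big_ind: _ => //; [exact: (smooth_cst 0)|exact: smoothD].
Qed.

Lemma smooth_comp f (g : R -> R) : smooth f -> smooth1 g -> smooth (g \o f).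
Proof. by move=> sf sg k; exact: Ck_comp. Qed.

Lemma partialD i f g : smooth f -> smooth g ->
  partial i (f + g) = partial i f + partial i g.
Proof.
move=> sf sg; apply/funext => x.
by have [_] := is_deriveD (smooth_is_derive i x sf) (smooth_is_derive i x sg).
Qed.

Lemma partialZ i (a : R) f : smooth f -> partial i (a *: f) = a *: partial i f.
Proof.
move=> sf; apply/funext => x.
by have [_] := is_deriveZ a (smooth_is_derive i x sf).
Qed.

Lemma partialM i f g : smooth f -> smooth g ->
  partial i (f * g) = f * partial i g + g * partial i f.
Proof.
move=> sf sg; apply/funext => x.
by have [_] := is_deriveM (smooth_is_derive i x sf) (smooth_is_derive i x sg).
Qed.

Lemma partial_cst i (c : R) : partial i (cst c) = cst 0.
Proof. by apply/funext => x; exact: derive_cst. Qed.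

Lemma partial_coor i j : partial i (fun v : 'rV[R]_N => v ord0 j) = cst (i == j)%:R.
Proof. by apply/funext => x; have [_] := is_derive_coor j i x. Qed.

End smooth_functions.

(** * Radial bumps and their Laplacians *)

Section bump_functions.
Context {R : realType} {N : nat}.
Implicit Types (i : 'I_N) (x y : 'rV[R]_N) (m : nat) (r : R).

(** The norm on row vectors is the sup norm; smooth radial functions need the square of the
    Euclidean distance. *)
Definition sqdist x y : R := \sum_(j < N) (y ord0 j - x ord0 j) ^+ 2.

Lemma sqdist_ge0 x y : 0 <= sqdist x y.
Proof. by apply: sumr_ge0 => j _; exact: sqr_ge0. Qed.

Lemma sqdistxx x : sqdist x x = 0.
Proof. by apply: big1 => j _; rewrite subrr expr0n. Qed.

Lemma coord_le_sqdist x y i : (y ord0 i - x ord0 i) ^+ 2 <= sqdist x y.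
Proof.
by rewrite /sqdist (bigD1 i)//= lerDl sumr_ge0// => j _; exact: sqr_ge0.
Qed.

Let lin x (j : 'I_N) : 'rV[R]_N -> R := (fun v => v ord0 j) + cst (- x ord0 j).

Let smooth_lin x j : smooth (lin x j).
Proof. by apply: smoothD; [exact: smooth_coor|exact: smooth_cst]. Qed.

Let partial_lin x i j : partial i (lin x j) = cst (i == j)%:R.
Proof.
rewrite partialD; [|exact: smooth_coor|exact: smooth_cst].
by rewrite partial_coor partial_cst; apply/funext => y; exact: addr0.
Qed.

Let sqdistE x : sqdist x = \sum_(j < N) lin x j * lin x j.
Proof.
by apply/funext => y; rewrite fct_sumE; apply: eq_bigr => j _; rewrite expr2.
Qed.

Lemma smooth_sqdist x : smooth (sqdist x).
Proof. by rewrite sqdistE; apply: smooth_sum => j; apply: smoothM; exact: smooth_lin. Qed.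

Lemma partial_sqdist i x y : partial i (sqdist x) y = 2 * (y ord0 i - x ord0 i).
Proof.
have h (s : seq 'I_N) : partial i (\sum_(j <- s) lin x j * lin x j) y =
    \sum_(j <- s) 2 * (i == j)%:R * lin x j y.
  elim: s => [|j s IH].
    by rewrite !big_nil -[0]/(cst 0) partial_cst.
  rewrite !big_cons partialD; last 2 first.
  - by apply: smoothM; exact: smooth_lin.
  - by apply: smooth_sum => k; apply: smoothM; exact: smooth_lin.
  rewrite -[LHS]/(partial i _ y + partial i _ y) IH partialM//.
  by rewrite partial_lin; congr (_ + _); rewrite -[LHS]/(lin x j y * _ + lin x j y * _) /cst; ring.
rewrite sqdistE h (bigD1 i)//= eqxx mulr1 big1 ?addr0// => j ji.
by rewrite eq_sym (negbTE ji) mulr0 mul0r.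
Qed.

Definition bump m x r y : R := profile m (1 - sqdist x y / r ^+ 2).

Let bumpE m x r : bump m x r = profile m \o ((- r ^- 2) *: sqdist x + cst 1).
Proof.
apply/funext => y; rewrite /bump /=; congr profile.
by rewrite -[RHS]/(- r ^- 2 * sqdist x y + 1); ring.
Qed.

Let smooth_arg x r : smooth ((- r ^- 2) *: sqdist x + cst 1).
Proof. by apply: smoothD; [apply: smoothZ; exact: smooth_sqdist|exact: smooth_cst]. Qed.

Lemma smooth_bump m x r : smooth (bump m x r).
Proof. by rewrite bumpE; apply: smooth_comp => //; exact: smooth1_profile. Qed.

Lemma bump_ge0 m x r y : 0 <= bump m x r y. Proof. exact: profile_ge0. Qed.

Lemma bump_out m x r y : 0 < r -> r ^+ 2 <= sqdist x y -> bump m x r y = 0.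
Proof.
by move=> r0 h; apply: profile_le0; rewrite subr_le0 ler_pdivlMr ?exprn_gt0// mul1r.
Qed.

Lemma partial_bump i m x r :
  partial i (bump m.+1 x r) = (- r ^- 2) *: (lin x i * bump m x r).
Proof.
apply/funext => y; rewrite [in LHS]bumpE.
have d1 := smooth_is_derive i y (smooth_arg x r).
have [_ h] := is_derive_comp1 d1 (is_derive_profile m _); rewrite [LHS]h {h}.
rewrite partialD; [|by apply: smoothZ; exact: smooth_sqdist|exact: smooth_cst].
rewrite partial_cst partialZ; last exact: smooth_sqdist.
rewrite -[(_ + cst 0) y]/(- r ^- 2 * partial i (sqdist x) y + 0) partial_sqdist.
have -> : profile m (((- r ^- 2) *: sqdist x + cst 1) y) = bump m x r y.
  by rewrite bumpE.
rewrite -[RHS]/(- r ^- 2 * ((y ord0 i - x ord0 i) * bump m x r y)).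
by set W := r ^- 2; field.
Qed.

Lemma partial2_bump i m x r y : partial i (partial i (bump m.+2 x r)) y =
  - r ^- 2 * bump m.+1 x r y + r ^- 4 * ((y ord0 i - x ord0 i) ^+ 2 * bump m x r y).
Proof.
rewrite partial_bump partialZ; last by apply: smoothM => //; exact: smooth_bump.
rewrite partialM//; last exact: smooth_bump.
rewrite partial_lin partial_bump eqxx.
rewrite -[LHS]/(- r ^- 2 * ((y ord0 i - x ord0 i) * (- r ^- 2 * ((y ord0 i - x ord0 i) *
  bump m x r y)) + bump m.+1 x r y * 1%:R)).
rewrite [r ^- 4](_ : _ = r ^- 2 * r ^- 2); first by ring.
by rewrite -invfM -exprD.
Qed.

Definition laplacian (f : 'rV[R]_N -> R) y : R := \sum_i partial i (partial i f) y.

(** Each differentiation lowers the index by one, so only two neighbouring bumps occur. The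
    right-hand side is what differentiating [r ^- N * bump m.+1 x r y] in [r] produces, up to the
    factor [r * r ^- N]. *)
Lemma laplacian_bump m x r y : laplacian (bump m.+2 x r) y =
  - r ^- 2 * N%:R * bump m.+1 x r y + r ^- 4 * sqdist x y * bump m x r y.
Proof.
rewrite /laplacian; under eq_bigr do rewrite partial2_bump.
rewrite big_split/= sumr_const card_ord -[_ *+ N]mulr_natr mulrAC; congr (_ + _).
by rewrite -mulr_sumr -mulr_suml mulrA.
Qed.

End bump_functions.

(** * Integration by parts for test functions *)

Section dominated.
Context {R : realType} d {T : measurableType d} {mu : {measure set T -> \bar R}}.

Lemma Rintegral_dominated_cvg (D : set T) (f_ : nat -> T -> R) (f g : T -> R) :
  measurable D -> (forall n, measurable_fun D (f_ n)) ->
  (forall x, D x -> f_ n x @[n --> \oo] --> f x) ->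
  mu.-integrable D (EFin \o g) ->
  (forall n x, D x -> `|f_ n x| <= g x) ->
  \int[mu]_(x in D) f_ n x @[n --> \oo] --> \int[mu]_(x in D) f x.
Proof.
move=> mD mf ff ig fg.
have [||||h1 _ h2] := @dominated_convergence _ _ _ mu D mD (fun n => EFin \o f_ n)
  (EFin \o f) (EFin \o g) _ _ _ ig _.
- by move=> n; apply/measurable_EFinP.
- by apply/measurable_EFinP; exact: measurable_fun_cvg mf ff.
- by apply: aeW => x Dx; apply: cvg_EFin; [exact: nearW|exact: ff].
- by apply: aeW => x n Dx; rewrite lee_fin; exact: fg.
apply: fine_cvg; rewrite fineK//; exact: integrable_fin_num.
Qed.

End dominated.

Section shift_invariance.
Context {R : realType} {N : nat}.
Let mu := lebesgue_rV R N.

Lemma integrable_shift (v : 'rV[R]_N) (f : 'rV[R]_N -> R) :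
  mu.-integrable setT (EFin \o f) -> mu.-integrable setT (EFin \o (fun x => f (x + v))).
Proof.
move=> /integrableP[mE fi]; apply/integrableP; split.
  exact: measurableT_comp mE (measurable_shift v).
rewrite (ge0_integral_shift v (f := fun x => `|(EFin \o f) x|%E))//.
exact: measurableT_comp.
Qed.

Lemma Rintegral_shift (v : 'rV[R]_N) (f : 'rV[R]_N -> R) :
  mu.-integrable setT (EFin \o f) -> \int[mu]_x f (x + v) = \int[mu]_x f x.
Proof.
move=> intf; have /integrableP[mE _] := intf.
pose pm := measure_function_pushforward__canonical__measure_function_Measure
  mu (measurable_shift v).
congr fine.
transitivity (\int[pm]_x (EFin \o f) x)%E; last first.
  by apply: eq_measure_integral => A mA _; exact: lebesgue_rV_shift.
rewrite /pm/= integral_pushforward ?preimage_setT//; first exact: measurable_shift.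
exact: integrable_shift.
Qed.

Lemma L2_shift (v : 'rV[R]_N) (f : 'rV[R]_N -> R) :
  L2 setT f -> L2 setT (fun x => f (x + v)).
Proof.
move=> Lf; have [mf _] := Lf.
apply: (@L2_dom _ _ _ measurableT _ (fun x => f (x + v) ^+ 2)) => //.
  exact: measurableT_comp mf (measurable_shift v).
apply: (@integrable_shift v (fun x => f x ^+ 2)).
exact: (L2_sq_integrable measurableT Lf).
Qed.

Lemma L2_inner_shift (v : 'rV[R]_N) (f : 'rV[R]_N -> R) : L2 setT f ->
  L2_inner setT (fun x => f (x + v)) (fun x => f (x + v)) = L2_inner setT f f.
Proof.
move=> Lf; apply: (@Rintegral_shift v (fun x => f x * f x)).
exact: (L2M_integrable measurableT Lf Lf).
Qed.

Lemma integrable_scaled_indic (c : R) (B : set 'rV[R]_N) : measurable B ->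
  (mu B < +oo)%E -> mu.-integrable setT (EFin \o (fun x => c * \1_B x)).
Proof.
move=> mB Bfin.
have iB : mu.-integrable setT (fun x => (\1_B x)%:E).
  apply/integrableP; split; first exact/measurable_EFinP/measurable_indic.
  under eq_integral do rewrite gee0_abs ?lee_fin//.
  by rewrite integral_indic// setIT.
by apply: (eq_integrable measurableT _ _ _ (integrableZl measurableT c iB)).
Qed.

End shift_invariance.

Section test_functions.
Context {R : realType} {N : nat}.
Variable Omega : set 'rV[R]_N.
Hypotheses (oO : open Omega) (bO : bounded_set Omega).
Let mu := lebesgue_rV R N.
Implicit Types (f g : 'rV[R]_N -> R) (i : 'I_N).

Lemma measurable_Omega : measurable Omega.
Proof. exact: open_measurable_rV. Qed.
Let mO := measurable_Omega.

Lemma Omega_fin : (mu Omega < +oo)%E.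
Proof. exact: bounded_lebesgue_rV. Qed.

Lemma test_smooth f : test_function Omega f -> smooth f.
Proof. by case. Qed.

Lemma test_continuous f : test_function Omega f -> continuous f.
Proof. by move=> /test_smooth/smooth_continuous. Qed.

Lemma test_out f x : test_function Omega f -> ~ Omega x -> f x = 0.
Proof. by move=> [_ [K [_ KO Kf]]] Ox; apply: Kf => /KO. Qed.

(** Vanishing of [f] in a neighbourhood, rather than at a point, is what partial derivatives
    inherit; so one criterion covers products, compositions and derivatives. *)
Lemma test_sub f g : test_function Omega f -> smooth g ->
  (forall x, (\forall y \near x, f y = 0) -> g x = 0) -> test_function Omega g.
Proof.
move=> [sf [K [cK KO Kf]]] sg fg; split => //; exists K; split => // x Kx.
apply: fg; have oK : open (~` K).
  by rewrite openC; apply: compact_closed => //; exact: norm_hausdorff.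
apply: filterS (open_nbhs_nbhs (conj oK Kx)) => y; exact: Kf.
Qed.

Lemma test0 : test_function Omega (0 : 'rV[R]_N -> R).
Proof.
split; first exact: (smooth_cst 0).
by exists set0; split => //; exact: compact0.
Qed.

Lemma testD f g : test_function Omega f -> test_function Omega g ->
  test_function Omega (f + g).
Proof.
move=> [sf [K [cK KO Kf]]] [sg [L [cL LO Lg]]]; split; first exact: smoothD.
exists (K `|` L); split; first exact: compactU.
  by move=> x [/KO|/LO].
by move=> x /not_orP[Kx Lx]; rewrite -[LHS]/(f x + g x) Kf// Lg// addr0.
Qed.

Lemma testMr f g : test_function Omega f -> smooth g -> test_function Omega (f * g).
Proof.
move=> tf sg; apply: (test_sub tf); first by apply: smoothM => //; exact: test_smooth.
by move=> x /nbhs_singleton fx; rewrite -[LHS]/(f x * g x) fx mul0r.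
Qed.

Lemma testZ a f : test_function Omega f -> test_function Omega (a *: f).
Proof.
move=> tf; apply: (test_sub tf); first by apply: smoothZ; exact: test_smooth.
by move=> x /nbhs_singleton fx; rewrite -[LHS]/(a * f x) fx mulr0.
Qed.

Lemma testB f g : test_function Omega f -> test_function Omega g ->
  test_function Omega (f - g).
Proof. by move=> tf tg; apply: testD => //; rewrite -scaleN1r; exact: testZ. Qed.

Lemma test_comp f (g : R -> R) : test_function Omega f -> smooth1 g -> g 0 = 0 ->
  test_function Omega (g \o f).
Proof.
move=> tf sg g0; apply: (test_sub tf); first by apply: smooth_comp => //; exact: test_smooth.
by move=> x /nbhs_singleton fx /=; rewrite fx.
Qed.

Lemma test_partial f i : test_function Omega f -> test_function Omega (partial i f).
Proof.
move=> tf; apply: (test_sub tf); first by apply: smooth_partial; exact: test_smooth.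
move=> x fx; rewrite /partial; have -> : 'D_(delta_mx 0 i) f x = 'D_(delta_mx 0 i) (cst 0) x.
  exact: near_eq_derive.
exact: derive_cst.
Qed.

Lemma test_laplacian f : test_function Omega f -> test_function Omega (laplacian f).
Proof.
move=> tf; have -> : laplacian f = \sum_i partial i (partial i f).
  by apply/funext => x; rewrite fct_sumE.
elim/big_ind: _ => //; [exact: test0|exact: testD|].
by move=> i _; do 2!apply: test_partial.
Qed.

Lemma test_measurable f : test_function Omega f -> measurable_fun setT f.
Proof. by move=> /test_continuous; exact: continuous_measurable_rV. Qed.

Lemma test_bounded f : test_function Omega f -> exists2 C : R, 0 < C & forall x, `|f x| <= C.
Proof.
move=> tf; have [_ [K [cK KO Kf]]] := tf.
have : compact (f @` K).
  by apply: continuous_compact => //; apply: continuous_subspaceT; exact: test_continuous.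
move=> /compact_bounded[M [_ hM]]; exists (Num.max 1 (M + 1)).
  by rewrite lt_max ltr01.
move=> x; have [Kx|Kx] := pselect (K x); last by rewrite Kf// normr0 le_max ler01.
by rewrite le_max (hM (M + 1)) ?orbT// ltrDl.
Qed.

Lemma test_L2 f : test_function Omega f -> L2 Omega f.
Proof.
move=> tf; have [C _ hC] := test_bounded tf.
apply: (@L2_bounded _ _ _ mO _ C) => //; first exact: Omega_fin.
by apply: measurable_funTS; exact: test_measurable.
Qed.

Lemma integral_Omega f : (forall x, ~ Omega x -> f x = 0) ->
  \int[mu]_(x in Omega) f x = \int[mu]_x f x.
Proof.
move=> f0; rewrite Rintegral_mkcond; congr (Rintegral _ _ _); apply/funext => x.
by rewrite patchE; case: ifPn => // /negP; rewrite inE => /f0.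
Qed.

Lemma integrable_setT f : (forall x, ~ Omega x -> f x = 0) ->
  mu.-integrable Omega (EFin \o f) -> mu.-integrable setT (EFin \o f).
Proof.
move=> f0; rewrite integrable_mkcond//; congr (_.-integrable _ _); apply/funext => x.
by rewrite patchE /=; case: ifPn => // /negP; rewrite inE => /f0 ->.
Qed.

Lemma test_L2T f : test_function Omega f -> L2 setT f.
Proof.
move=> tf; apply: (@L2_dom _ _ _ measurableT _ (fun x => f x ^+ 2)) => //.
  exact: test_measurable.
apply: integrable_setT; first by move=> x Ox; rewrite (test_out tf Ox) expr0n.
exact: (L2_sq_integrable mO (test_L2 tf)).
Qed.

Lemma L2_innerT f g : test_function Omega f ->
  L2_inner Omega f g = L2_inner setT f g.
Proof. by move=> tf; apply: integral_Omega => x Ox; rewrite (test_out tf Ox) mul0r. Qed.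

(** Difference quotients with steps of length at most 1 are supported in this bounded set, which
    yields their common integrable bound. *)
Definition bigbox : set 'rV[R]_N := [set x | exists2 y, Omega y & `|x - y| <= 1].

Lemma bounded_dominated : exists r : R, 0 <= r /\
  forall x, bigbox x -> forall i, `|x ord0 i| <= r.
Proof.
have [M [_ hM]] := bO; exists (Num.max 0 (M + 2)); split; first by rewrite le_max lexx.
move=> x [y Oy xy] i; apply: le_trans (coord_le_norm _ _) _.
rewrite -[x](subrK y) (le_trans (ler_normD _ _))// le_max; apply/orP; right.
have -> : M + 2 = 1 + (M + 1) by ring.
by apply: lerD => //; apply: hM => //; rewrite ltrDl.
Qed.

Lemma is_derive_line (f df : 'rV[R]_N -> R) (v x : 'rV[R]_N) (h : R) :
  (forall y, is_derive y v f (df y)) ->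
  is_derive h (1 : R) (fun h => f (x + h *: v)) (df (x + h *: v)).
Proof.
move=> hf; have [f1 f2] := hf (x + h *: v).
have E : (fun k : R => k^-1 *: ((f \o shift (x + h *: v)) (k *: v) - f (x + h *: v))) =
    (fun k => k^-1 *: (((fun h => f (x + h *: v)) \o shift h) (k *: (1 : R)) -
      (fun h => f (x + h *: v)) h)).
  apply/funext => k /=; congr (_ *: (f _ - _)).
  by rewrite [k *: 1]mulr1 addrCA -scalerDl.
have c : k^-1 *: (((fun h => f (x + h *: v)) \o shift h) (k *: (1 : R)) -
      (fun h => f (x + h *: v)) h) @[k --> (0 : R)^'] --> df (x + h *: v).
  by rewrite -E -f2; exact: f1.
by split; [apply/cvg_ex; eexists; exact: c|exact/cvg_lim].
Qed.

Lemma test_quotient f i (s : R) x : test_function Omega f -> s != 0 ->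
  exists2 c, `|c| <= `|s| & s^-1 * (f (x + s *: delta_mx 0 i) - f x) =
    partial i f (x + c *: delta_mx 0 i).
Proof.
move=> tf s0.
have dphi h := @is_derive_line f (partial i f) (delta_mx 0 i) x h
  (fun y => smooth_is_derive i y (test_smooth tf)).
have cphi : continuous (fun h : R => f (x + h *: delta_mx 0 i)).
  by move=> h; exact: is_derive_continuous (dphi h).
have [sp|sn] := leP 0 s.
  have [c] := MVT_segment sp (fun h _ => dphi h) (continuous_subspaceT cphi).
  rewrite in_itv/= => /andP[c0 cs]; rewrite scale0r addr0 subr0 => ->.
  by exists c; [rewrite !ger0_norm|rewrite mulrC mulfK].
have [c] := MVT_segment (ltW sn) (fun h _ => dphi h) (continuous_subspaceT cphi).
rewrite in_itv/= => /andP[c0 cs]; rewrite scale0r addr0 sub0r => h.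
exists c; first by rewrite !ler0_norm ?(ltW sn)// lerN2.
by rewrite -opprB h; field.
Qed.

Lemma test_quotient_out f i (s : R) x : test_function Omega f -> `|s| <= 1 ->
  ~ bigbox x -> s^-1 * (f (x + s *: delta_mx 0 i) - f x) = 0.
Proof.
move=> tf s1 bx; rewrite (test_out tf); last first.
  move=> Ox; apply: bx; exists (x + s *: delta_mx 0 i) => //.
  rewrite opprD addrA subrr sub0r normrN normrZ.
  apply: (le_trans _ s1); rewrite ler_piMr//; apply: norm_le_coord => // j.
  by rewrite mxE /=; case: eqP; rewrite ?normr1 ?normr0.
rewrite (test_out tf) ?subrr ?mulr0// => Ox; apply: bx; exists x => //.
by rewrite subrr normr0.
Qed.

(** Dominated convergence for difference quotients, bounded by the mean value theorem. It serves
    with [psi] the identity for integration by parts, and with [psi] the square for the norm of a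
    translation. *)
Lemma quotient_cvg f i (psi : R -> R) (t : R) : test_function Omega f ->
  continuous psi -> psi 0 = 0 -> t != 0 ->
  \int[mu]_x psi ((t / n.+1%:R)^-1 * (f (x + (t / n.+1%:R) *: delta_mx 0 i) - f x))
    @[n --> \oo] --> \int[mu]_x psi (partial i f x).
Proof.
move=> tf cpsi psi0 t0.
have [C C0 hC] := test_bounded (test_partial i tf).
have [r [r0 hr]] := bounded_dominated.
pose B := [set x : 'rV[R]_N | forall i, `|x ord0 i| <= r].
have sn n : t / n.+1%:R != 0 by rewrite mulf_neq0// invr_neq0// pnatr_eq0.
have st : t / n.+1%:R @[n --> \oo] --> 0.
  rewrite -[X in _ --> X](mulr0 t); apply: cvgM; first exact: cvg_cst.
  exact: (@cvg_harmonic R).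
pose g (n : nat) (x : 'rV[R]_N) := (t / n.+1%:R)^-1 * (f (x + (t / n.+1%:R) *: delta_mx 0 i) - f x).
have gC n x : `|g n x| <= C.
  by rewrite /g; have [c _ ->] := test_quotient i x tf (sn n).
have [D hD] : exists D : R, forall u, `|u| <= C -> `|psi u| <= D.
  have : compact (psi @` [set` `[- C, C]]).
    by apply: continuous_compact; [exact: continuous_subspaceT|exact: segment_compact].
  move=> /compact_bounded[M [_ hM]]; exists (M + 1) => u uC.
  by apply: (hM (M + 1)); [rewrite ltrDl|exists u => //; rewrite /= in_itv/= -ler_norml].
have mg n : measurable_fun setT (g n).
  apply: measurable_funM; first exact: measurable_cst.
  apply: measurable_funB; last exact: test_measurable.
  exact: (measurableT_comp (test_measurable tf) (measurable_shift _)).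
(* Only from [n0] on are the steps short enough for the quotients to vanish off [bigbox], so the
   sequence is shifted by [n0]. *)
have [n0 hn0] : exists n0 : nat, forall n, (n0 <= n)%N -> `|t / n.+1%:R| <= 1.
  move/cvgr0_norm_le : st => /(_ 1 ltr01)[n0 _ hn0]; exists n0 => n nn0; exact: hn0.
rewrite -(cvg_shiftn n0).
apply: (@Rintegral_dominated_cvg _ _ _ _ _ _ _ (fun x => D * \1_B x)) => //.
- move=> n; apply: (measurableT_comp _ (mg _)).
  by apply: continuous_measurable_fun.
- move=> x _; apply: (continuous_cvg _ (cpsi _)).
  rewrite (cvg_shiftn n0 (fun n => g n x)).
  have cp := test_continuous (test_partial i tf).
  apply/cvgrPdist_le => e e0.
  have cpx : partial i f (x + h *: delta_mx 0 i) @[h --> (0 : R)] --> partial i f x.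
    rewrite -[X in _ --> partial i f X](addr0 x) -[X in _ --> partial i f (x + X)](scale0r (delta_mx 0 i)).
    apply: continuous_cvg; first exact: cp.
    apply: cvgD; first exact: cvg_cst.
    by apply: cvgZr_tmp; exact: cvg_id.
  move/cvgrPdist_le : cpx => /(_ e e0) /nbhs_ballP[d /= d0 hd].
  move/cvgrPdist_lt : st => /(_ d d0)[m _ hm]; exists m => // n mn.
  rewrite /g; have [c cs ->] := test_quotient i x tf (sn n).
  apply: hd; rewrite /ball/= sub0r normrN; apply: le_lt_trans cs _.
  by have := hm n mn; rewrite sub0r normrN.
- apply: integrable_scaled_indic; first exact: measurable_box.
  exact: lebesgue_rV_box.
- move=> n x _; have [xB|xB] := pselect (bigbox x).
    by rewrite indicE mem_set ?mulr1; [exact: hD (gC _ _)|exact: hr].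
  rewrite test_quotient_out// ?psi0 ?normr0; last by apply: hn0; rewrite leq_addl.
  by rewrite mulr_ge0// (le_trans _ (hD 0 _))// normr0 ltW.
Qed.

Lemma test_integrableT f : test_function Omega f -> mu.-integrable setT (EFin \o f).
Proof.
move=> tf; apply: integrable_setT; first by move=> x Ox; exact: test_out tf Ox.
have [C C0 hC] := test_bounded tf.
apply: (le_integrable mO _ _ (integrable_cst mO C Omega_fin)).
  by apply/measurable_EFinP; apply: measurable_funTS; exact: test_measurable.
by move=> x _ /=; rewrite lee_fin [`|C|]ger0_norm ?hC// ltW.
Qed.

(** By translation invariance every difference quotient has integral 0. *)
Lemma integral_partial f i : test_function Omega f ->
  \int[mu]_(x in Omega) partial i f x = 0.
Proof.
move=> tf; rewrite integral_Omega; last by move=> x Ox; exact: test_out (test_partial i tf) Ox.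
have cid : continuous (id : R -> R) by move=> x; exact: cvg_id.
have := quotient_cvg (i := i) tf cid erefl (oner_neq0 R).
rewrite (_ : (fun n => _) = cst 0); first by move/cvg_lim => <- //; rewrite lim_cst.
apply/funext => n; have it := test_integrableT tf.
have ish v := integrable_shift v it.
rewrite RintegralZl//; last exact: (integrableB measurableT (ish _) it).
by rewrite RintegralB// Rintegral_shift// subrr mulr0.
Qed.

Lemma L2_inner_partial f g i : test_function Omega f -> smooth g ->
  L2_inner Omega (partial i f) g = - L2_inner Omega f (partial i g).
Proof.
move=> tf sg; have tfg := testMr tf sg.
have := integral_partial i tfg; rewrite partialM//; last exact: test_smooth tf.
have i1 : mu.-integrable Omega (EFin \o (f * partial i g)).
  have := test_integrableT (testMr tf (smooth_partial i sg)).
  by apply: integrableS.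
have i2 : mu.-integrable Omega (EFin \o (g * partial i f)).
  have := test_integrableT (testMr (test_partial i tf) sg).
  rewrite mulrC; exact: integrableS.
rewrite [LHS]RintegralD// => /eqP; rewrite addrC addr_eq0 => /eqP <-.
by apply: eq_Rintegral => x _; rewrite mulrC.
Qed.

Notation nrmT := (snorm (L2_inner setT)).

Lemma snorm_shift (v : 'rV[R]_N) f : L2 setT f -> nrmT (fun x => f (x + v)) = nrmT f.
Proof. by move=> Lf; rewrite /snorm L2_inner_shift. Qed.

Let sT := @L2_inner_semi_inner R N setT measurableT.

Let shift0 f : (fun x => f (x + 0)) - f = 0.
Proof.
by rewrite (_ : (fun x => f (x + 0)) = f) ?subrr//; apply/funext => x; rewrite addr0.
Qed.

Let nrmT0 : nrmT (0 : 'rV[R]_N -> R) = 0.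
Proof.
by rewrite -(scale0r (0 : 'rV[R]_N -> R)) (snormZ sT) ?normr0 ?mul0r//; exact: test_L2T test0.
Qed.

(** The translation is cut into [n.+1] equal steps. Each contributes the same norm by invariance,
    and [n.+1] times that norm tends to the right-hand side. *)
Lemma test_shift1 f i (t : R) : test_function Omega f ->
  nrmT ((fun x => f (x + t *: delta_mx 0 i)) - f) <= `|t| * nrmT (partial i f).
Proof.
move=> tf; have [->|t0] := eqVneq t 0.
  by rewrite normr0 mul0r scale0r shift0 nrmT0.
have Lf := test_L2T tf.
pose e : 'rV[R]_N := delta_mx 0 i.
pose d n : 'rV[R]_N -> R := (fun x => f (x + (t / n.+1%:R) *: e)) - f.
have Ld n : L2 setT (d n) by apply: (sipB sT) => //; exact: L2_shift.
have tel n : nrmT ((fun x => f (x + t *: e)) - f) <= n.+1%:R * nrmT (d n).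
  suff h k : nrmT ((fun x => f (x + (k%:R * (t / n.+1%:R)) *: e)) - f) <= k%:R * nrmT (d n).
    by have := h n.+1; rewrite mulrCA divff ?pnatr_eq0// mulr1.
  elim: k => [|k IH].
    by rewrite !mul0r scale0r shift0 nrmT0.
  have -> : (fun x => f (x + (k.+1%:R * (t / n.+1%:R)) *: e)) - f =
      (fun x => d n (x + (k%:R * (t / n.+1%:R)) *: e)) +
      ((fun x => f (x + (k%:R * (t / n.+1%:R)) *: e)) - f).
    apply/funext => x; set c := k%:R * _; set c' := k.+1%:R * _.
    rewrite -[LHS]/(f (x + c' *: e) - f x).
    rewrite -[RHS]/(f (x + c *: e + (t / n.+1%:R) *: e) - f (x + c *: e) +
      (f (x + c *: e) - f x)) addrA subrK /c /c'; congr (f _ - f x).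
    by rewrite -addrA -scalerDl -[k.+1%:R]natr1 mulrDl mul1r.
  apply: le_trans (snormD sT _ _) _; first exact: L2_shift.
    by apply: (sipB sT) => //; exact: L2_shift.
  by rewrite snorm_shift// -[k.+1%:R]natr1 mulrDl mul1r addrC lerD2r.
have cv : `|t| * Num.sqrt (\int[mu]_x ((t / n.+1%:R)^-1 * (f (x + (t / n.+1%:R) *: e) - f x)) ^+ 2)
    @[n --> \oo] --> `|t| * nrmT (partial i f).
  apply: cvgM; first exact: cvg_cst.
  apply: (continuous_cvg _ (@sqrt_continuous _ _)).
  have c2 : continuous (fun u : R => u ^+ 2) by exact: exprn_continuous.
  exact: (quotient_cvg (i := i) tf c2 (expr0n _ _) t0).
have cE n : `|t| * Num.sqrt (\int[mu]_x ((t / n.+1%:R)^-1 * (f (x + (t / n.+1%:R) *: e) - f x)) ^+ 2) =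
    n.+1%:R * nrmT (d n).
  have -> : \int[mu]_x ((t / n.+1%:R)^-1 * (f (x + (t / n.+1%:R) *: e) - f x)) ^+ 2 =
     L2_inner setT ((t / n.+1%:R)^-1 *: d n) ((t / n.+1%:R)^-1 *: d n).
    by apply: eq_Rintegral => x _; rewrite expr2.
  rewrite -/(nrmT _) (snormZ sT)// mulrA -normrM invf_div mulrCA divff// mulr1.
  by rewrite ger0_norm.
rewrite -(cvg_lim _ cv)//; apply: limr_ge; first by apply/cvg_ex; eexists; exact: cv.
by apply: nearW => n; rewrite cE.
Qed.

Lemma test_shift f (v : 'rV[R]_N) : test_function Omega f ->
  nrmT ((fun x => f (x + v)) - f) <= \sum_i `|v ord0 i| * nrmT (partial i f).
Proof.
move=> tf; have Lf := test_L2T tf.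
suff h (s : seq 'I_N) : nrmT ((fun x => f (x + \sum_(i <- s) v ord0 i *: delta_mx 0 i)) - f)
    <= \sum_(i <- s) `|v ord0 i| * nrmT (partial i f).
  by rewrite {1}(row_sum_delta v).
elim: s => [|j s IH].
  by rewrite !big_nil shift0 nrmT0.
rewrite !big_cons.
set a := _ *: _; set b := \sum_(i <- s) _ *: _.
have -> : (fun x => f (x + (a + b))) - f =
    (fun x => ((fun x => f (x + a)) - f) (x + b)) + ((fun x => f (x + b)) - f).
  apply/funext => x; rewrite -[LHS]/(f (x + (a + b)) - f x).
  rewrite -[RHS]/(f (x + b + a) - f (x + b) + (f (x + b) - f x)) [RHS]addrA subrK.
  by rewrite [a + b]addrC addrA.
have Lab : L2 setT ((fun x => f (x + a)) - f) by apply: (sipB sT) => //; exact: L2_shift.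
apply: le_trans (snormD sT _ _) _; first exact: L2_shift.
  by apply: (sipB sT) => //; exact: L2_shift.
by rewrite snorm_shift//; apply: lerD => //; exact: test_shift1.
Qed.

End test_functions.

(** * The space H_0^1 *)

Section real_sequences.
Context {R : realType}.

Lemma cvg_ext (f g : nat -> R) (l : R) : f =1 g -> g @ \oo --> l -> f @ \oo --> l.
Proof. by move=> /funext ->. Qed.

Lemma cvgR_unique (f : nat -> R) (a b : R) : f @ \oo --> a -> f @ \oo --> b -> a = b.
Proof. by move=> /cvg_lim <- // /cvg_lim <-. Qed.

Lemma cvg0D (f g : nat -> R) : f @ \oo --> 0 -> g @ \oo --> 0 ->
  (fun n => f n + g n) @ \oo --> 0.
Proof. by move=> cf cg; rewrite -[X in _ --> X](addr0 0); exact: cvgD cf cg. Qed.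

Lemma cvg0_sum (I : finType) (F : I -> nat -> R) : (forall i, F i @ \oo --> 0) ->
  (fun n => \sum_i F i n) @ \oo --> 0.
Proof.
move=> cF; suff h (s : seq I) : (fun n => \sum_(i <- s) F i n) @ \oo --> 0 by exact: h.
elim: s => [|i s IH].
  by apply: (@cvg_ext _ (cst 0)); [move=> n; rewrite big_nil|exact: cvg_cst].
by apply: (@cvg_ext _ (fun n => F i n + \sum_(i <- s) F i n));
  [move=> n; rewrite big_cons|exact: cvg0D].
Qed.

Lemma cvg0Zl (a : R) (f : nat -> R) : f @ \oo --> 0 -> (fun n => a * f n) @ \oo --> 0.
Proof. by move=> cf; rewrite -(mulr0 a); apply: cvgM => //; exact: cvg_cst. Qed.

Lemma cvg0_le (f g : nat -> R) : (forall n, 0 <= f n <= g n) -> g @ \oo --> 0 ->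
  f @ \oo --> 0.
Proof.
move=> fg cg; apply: (squeeze_cvgr _ (cvg_cst 0) cg).
by apply: nearW => n; exact: fg.
Qed.

End real_sequences.

Section sobolev_space.
Context {R : realType} {N : nat}.
Variable Omega : set 'rV[R]_N.
Hypotheses (oO : open Omega) (bO : bounded_set Omega).
Let mu := lebesgue_rV R N.
Let mO : measurable Omega := measurable_Omega oO.
Let sI := @L2_inner_semi_inner R N Omega mO.
Implicit Types (f g u v w : 'rV[R]_N -> R) (i : 'I_N) (G H : 'I_N -> 'rV[R]_N -> R).
Local Notation ip := (L2_inner Omega).
Local Notation test := (test_function Omega).

Let tL2 f : test f -> L2 Omega f. Proof. exact: test_L2. Qed.

Lemma sip_cvg (V : lmodType R) (P : V -> Prop) (B : V -> V -> R) (f_ : nat -> V) (f g : V) :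
  semi_inner P B -> (forall n, P (f_ n)) -> P f -> P g ->
  B (f_ n - f) (f_ n - f) @[n --> \oo] --> 0 -> B (f_ n) g @[n --> \oo] --> B f g.
Proof.
move=> sB Pn Pf Pg c.
have Pd n : P (f_ n - f) by exact: (sipB sB).
have E n : B (f_ n) g = B (f_ n - f) g + B f g by rewrite (sipBl sB)// subrK.
apply: (cvg_ext E).
rewrite -[X in _ --> X]add0r; apply: cvgD; last exact: cvg_cst.
have c2 : Num.sqrt (B (f_ n - f) (f_ n - f) * B g g) @[n --> \oo] --> 0.
  rewrite -(@sqrtr0 R); apply: (continuous_cvg _ (@sqrt_continuous _ _)).
  by rewrite -(mul0r (B g g)); apply: cvgM => //; exact: cvg_cst.
apply/norm_cvg0P; apply: cvg0_le c2 => n; rewrite normr_ge0/=.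
rewrite -ler_sqr ?nnegrE ?sqrtr_ge0// sqr_sqrtr ?mulr_ge0 ?(sip_ge0 sB)//.
by rewrite real_normK ?num_real// (sip_CS sB).
Qed.

Lemma sip_cvg_sq (V : lmodType R) (P : V -> Prop) (B : V -> V -> R) (f_ : nat -> V) (f : V) :
  semi_inner P B -> (forall n, P (f_ n)) -> P f ->
  B (f_ n - f) (f_ n - f) @[n --> \oo] --> 0 -> B (f_ n) (f_ n) @[n --> \oo] --> B f f.
Proof.
move=> sB Pn Pf c.
have E n : B (f_ n) (f_ n) = B (f_ n - f) (f_ n - f) + (2 * B (f_ n) f - B f f).
  by rewrite (sip_sqB sB)//; ring.
apply: (cvg_ext E).
rewrite -[X in _ --> X]add0r; apply: cvgD => //.
have {2}-> : B f f = 2 * B f f - B f f by ring.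
apply: cvgB; last exact: cvg_cst.
by apply: cvgM; [exact: cvg_cst|exact: (sip_cvg sB)].
Qed.

Lemma L2_inner_cvg (f_ : nat -> 'rV[R]_N -> R) f g : (forall n, L2 Omega (f_ n)) ->
  L2 Omega f -> L2 Omega g -> L2_cvg Omega f_ f -> ip (f_ n) g @[n --> \oo] --> ip f g.
Proof. by move=> Ln Lf Lg /(L2_cvgP mO Ln Lf); exact: (sip_cvg sI). Qed.

Definition gdot G H : R := \sum_i ip (G i) (H i).

Lemma gdot_semi_inner : semi_inner (fun G => forall i, L2 Omega (G i)) gdot.
Proof.
split.
- by move=> G H LG LH i; exact: (sipD sI).
- by move=> a G LG i; exact: (sipZ sI).
- by move=> G H LG LH; apply: eq_bigr => i _; exact: (sipC sI).
- move=> G H K LG LH LK; rewrite /gdot -big_split/=; apply: eq_bigr => i _.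
  exact: (sipDl sI).
- move=> a G K LG LK; rewrite /gdot mulr_sumr; apply: eq_bigr => i _.
  exact: (sipZl sI).
- by move=> G LG; apply: sumr_ge0 => i _; exact: (sip_ge0 sI).
Qed.

Local Notation pgrad f := (fun i => partial i f).

(** Both sides of the integration by parts formula are continuous under L2 convergence, so
    membership in [H10] only requires the approximating sequence. *)
Lemma weak_gradient_lim (phi : nat -> 'rV[R]_N -> R) u G :
  (forall n, test (phi n)) -> L2 Omega u -> (forall i, L2 Omega (G i)) ->
  L2_cvg Omega phi u -> (forall i, L2_cvg Omega (fun n => partial i (phi n)) (G i)) ->
  weak_gradient Omega u G.
Proof.
move=> tphi Lu LG cu cG i; split => // psi tpsi.
have Lpsi := tL2 tpsi; have Ldpsi := tL2 (test_partial i tpsi).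
have Lphi n := tL2 (tphi n); have Ldphi n := tL2 (test_partial i (tphi n)).
have c1 := L2_inner_cvg Lphi Lu Ldpsi cu.
have c2 := cvgN (L2_inner_cvg Ldphi (LG i) Lpsi (cG i)).
apply: (cvgR_unique c1); apply: cvg_ext (c2 _) => n.
rewrite -[RHS]/(- ip (partial i (phi n)) psi) (L2_inner_partial oO bO i (tphi n) (test_smooth tpsi)).
by rewrite opprK.
Qed.

Lemma L2_cvg_cst f : L2_cvg Omega (fun=> f) f.
Proof.
rewrite /L2_cvg (_ : (fun n => _) = cst 0%E); first exact: cvg_cst.
by apply/funext => n; apply: integral0_eq => x _; rewrite subrr expr0n.
Qed.

Lemma test_H10_gradient f : test f -> H10_gradient Omega f (pgrad f).
Proof.
move=> tf; split; first exact: tL2.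
  apply: (@weak_gradient_lim (fun=> f)) => //; first exact: tL2.
  - by move=> i; apply: tL2; exact: test_partial.
  - exact: L2_cvg_cst.
  - by move=> i; exact: L2_cvg_cst.
by exists (fun=> f); split => //; [exact: L2_cvg_cst|move=> i; exact: L2_cvg_cst].
Qed.

Lemma test_H10 f : test f -> H10 Omega f.
Proof. by move=> /test_H10_gradient ?; eexists; eassumption. Qed.

Lemma H10_gradient_L2 u G i : H10_gradient Omega u G -> L2 Omega (G i).
Proof. by move=> [_ /(_ i)[]]. Qed.

Lemma H10_L2 u : H10 Omega u -> L2 Omega u.
Proof. by move=> [G []]. Qed.

Lemma gradP u : H10 Omega u -> H10_gradient Omega u (grad Omega u).
Proof. by rewrite /grad => -[G hG]; case: xgetP => [H _ //|/(_ G)]. Qed.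

Lemma grad_L2 u i : H10 Omega u -> L2 Omega (grad Omega u i).
Proof. by move=> /gradP/H10_gradient_L2. Qed.

Lemma H10_gradientD u v G H : H10_gradient Omega u G -> H10_gradient Omega v H ->
  H10_gradient Omega (u + v) (G + H).
Proof.
move=> hu hv; have [Lu _ [phi [tphi cphi dphi]]] := hu.
have [Lv _ [psi [tpsi cpsi dpsi]]] := hv.
have LG i : L2 Omega (G i) := H10_gradient_L2 i hu.
have LH i : L2 Omega (H i) := H10_gradient_L2 i hv.
have sum (f_ g_ : nat -> 'rV[R]_N -> R) f g : (forall n, L2 Omega (f_ n)) ->
    (forall n, L2 Omega (g_ n)) -> L2 Omega f -> L2 Omega g -> L2_cvg Omega f_ f ->
    L2_cvg Omega g_ g -> L2_cvg Omega (fun n => f_ n + g_ n) (f + g).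
  move=> Lf_ Lg_ Lf Lg /(L2_cvgP mO Lf_ Lf) cf /(L2_cvgP mO Lg_ Lg) cg.
  apply/L2_cvgP => //; [by move=> n; exact: (sipD sI)|exact: (sipD sI)|].
  apply: (@cvg0_le _ _ (fun n => 2 * ip (f_ n - f) (f_ n - f) +
     2 * ip (g_ n - g) (g_ n - g))).
    move=> n; rewrite opprD addrACA.
    have L1 : L2 Omega (f_ n - f) by exact: (sipB sI).
    have L2 : L2 Omega (g_ n - g) by exact: (sipB sI).
    by rewrite (sip_ge0 sI) ?(sip_sqD_le sI)//; exact: (sipD sI).
  by apply: cvg0D; exact: cvg0Zl.
have tsum n : test (phi n + psi n) by exact: testD.
have c1 : L2_cvg Omega (fun n => phi n + psi n) (u + v).
  by apply: sum => // n; exact: tL2.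
have c2 i : L2_cvg Omega (fun n => partial i (phi n + psi n)) (G i + H i).
  rewrite (_ : (fun n => _) = (fun n => partial i (phi n) + partial i (psi n))).
    by apply: sum => // n; apply: tL2; exact: test_partial.
  by apply/funext => n; rewrite partialD//; exact: test_smooth.
have Luv : L2 Omega (u + v) by exact: (sipD sI).
split => //; last by exists (fun n => phi n + psi n).
by apply: (weak_gradient_lim tsum) => // i; exact: (sipD sI).
Qed.

Lemma H10_gradientZ a u G : H10_gradient Omega u G -> H10_gradient Omega (a *: u) (a *: G).
Proof.
move=> hu; have [Lu _ [phi [tphi cphi dphi]]] := hu.
have LG i : L2 Omega (G i) := H10_gradient_L2 i hu.
have sc (f_ : nat -> 'rV[R]_N -> R) f : (forall n, L2 Omega (f_ n)) -> L2 Omega f ->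
    L2_cvg Omega f_ f -> L2_cvg Omega (fun n => a *: f_ n) (a *: f).
  move=> Lf_ Lf /(L2_cvgP mO Lf_ Lf) cf.
  apply/L2_cvgP => //; [by move=> n; exact: (sipZ sI)|exact: (sipZ sI)|].
  apply: (@cvg_ext _ _ (fun n => a ^+ 2 * ip (f_ n - f) (f_ n - f))); last exact: cvg0Zl.
  move=> n; have L1 : L2 Omega (f_ n - f) by exact: (sipB sI).
  by rewrite -scalerBr (sipZl sI) ?(sipZr sI) ?mulrA//; exact: (sipZ sI).
have tsc n : test (a *: phi n) by exact: testZ.
have c1 : L2_cvg Omega (fun n => a *: phi n) (a *: u).
  by apply: sc => // n; exact: tL2.
have c2 i : L2_cvg Omega (fun n => partial i (a *: phi n)) (a *: G i).
  rewrite (_ : (fun n => _) = (fun n => a *: partial i (phi n))).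
    by apply: sc => // n; apply: tL2; exact: test_partial.
  by apply/funext => n; rewrite partialZ//; exact: test_smooth.
have Lau : L2 Omega (a *: u) by exact: (sipZ sI).
split => //; last by exists (fun n => a *: phi n).
by apply: (weak_gradient_lim tsc) => // i; exact: (sipZ sI).
Qed.

(* A gradient of [0] is orthogonal to every test function, and it is itself an
   L2 limit of test functions. *)
Lemma H10_gradient_uniq u G H i : H10_gradient Omega u G -> H10_gradient Omega u H ->
  ae_eq Omega (G i) (H i).
Proof.
move=> hG hH; have LG := H10_gradient_L2 i hG; have LH := H10_gradient_L2 i hH.
have hD := H10_gradientD hG (H10_gradientZ (-1) hH).
rewrite !scaleN1r !subrr in hD.
have LD : L2 Omega ((G - H) i) := H10_gradient_L2 i hD.
have [_ /(_ i)[_ w] [phi [tphi _ /(_ i) cphi]]] := hD.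
have Lphi n : L2 Omega (partial i (phi n)) by apply: tL2; exact: test_partial.
apply: (L2_inner_eq0 mO LG LH).
have c := L2_inner_cvg Lphi LD LD cphi.
apply: (cvgR_unique c); apply: (@cvg_ext _ _ (cst 0)); last exact: cvg_cst.
move=> n; have tp := test_partial i (tphi n).
rewrite (sipC sI)//; apply/eqP; rewrite -oppr_eq0 -w//; apply/eqP.
rewrite -[RHS](mul0r (ip 0 (partial i (partial i (phi n))))).
have L0 : L2 Omega (0 : 'rV[R]_N -> R) by apply: tL2; exact: test0.
rewrite -(sipZl sI) ?scale0r//; exact/tL2/test_partial.
Qed.

(** By a.e. uniqueness, the gradient picked by [grad] may be replaced by any gradient at hand; this
    is how sums, multiples and test functions are computed. *)
Lemma dirichletE u v G H : H10_gradient Omega u G -> H10_gradient Omega v H ->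
  dirichlet Omega u v = gdot G H.
Proof.
move=> hu hv; have Hu : H10 Omega u by exists G.
have Hv : H10 Omega v by exists H.
have LG i : L2 Omega (G i) := H10_gradient_L2 i hu.
have LH i : L2 Omega (H i) := H10_gradient_L2 i hv.
have E (s : seq 'I_N) : mu.-integrable Omega (EFin \o
      (fun x => \sum_(i <- s) grad Omega u i x * grad Omega v i x)) /\
    \int[mu]_(x in Omega) \sum_(i <- s) grad Omega u i x * grad Omega v i x =
    \sum_(i <- s) ip (grad Omega u i) (grad Omega v i).
  elim: s => [|j s [IH1 IH2]].
    under eq_fun do rewrite big_nil; split.
      exact: integrable0.
    by rewrite big_nil Rintegral_cst// mul0r.
  have i1 := L2M_integrable mO (grad_L2 j Hu) (grad_L2 j Hv).
  under eq_fun do rewrite big_cons; rewrite big_cons RintegralD// IH2; split => //.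
  exact: (integrableD mO i1 IH1).
rewrite /dirichlet (E _).2; apply: eq_bigr => i _.
by apply: (L2_inner_ae mO); rewrite //; by [exact: grad_L2|
   apply: H10_gradient_uniq (gradP _) _].
Qed.

Lemma normH_sqE u : normH_sq Omega u = dirichlet Omega u u.
Proof. by apply: eq_Rintegral => x _; apply: eq_bigr => i _; rewrite expr2. Qed.

Lemma dirichlet_semi_inner : semi_inner (H10 Omega) (dirichlet Omega).
Proof.
have sG := gdot_semi_inner.
have Lg u (Hu : H10 Omega u) i := grad_L2 i Hu.
split.
- by move=> u v /gradP hu /gradP hv; eexists; exact: H10_gradientD hu hv.
- by move=> a u /gradP hu; exists (a *: grad Omega u); exact: H10_gradientZ.
- move=> u v /[dup] /Lg Lu /gradP hu /[dup] /Lg Lv /gradP hv.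
  by rewrite (dirichletE hu hv) (dirichletE hv hu) (sipC sG).
- move=> u v w /[dup] /Lg Lu /gradP hu /[dup] /Lg Lv /gradP hv /[dup] /Lg Lw /gradP hw.
  by rewrite (dirichletE (H10_gradientD hu hv) hw) (dirichletE hu hw) (dirichletE hv hw) (sipDl sG).
- move=> a u w /[dup] /Lg Lu /gradP hu /[dup] /Lg Lw /gradP hw.
  by rewrite (dirichletE (H10_gradientZ a hu) hw) (dirichletE hu hw) (sipZl sG).
- by move=> u /[dup] /Lg Lu /gradP hu; rewrite (dirichletE hu hu) (sip_ge0 sG).
Qed.

Local Notation dir := (dirichlet Omega).
Let sD := dirichlet_semi_inner.

Lemma H10_approx u : H10 Omega u -> exists phi : nat -> 'rV[R]_N -> R,
  [/\ forall n, test (phi n), ip (phi n - u) (phi n - u) @[n --> \oo] --> 0 &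
      dir (phi n - u) (phi n - u) @[n --> \oo] --> 0].
Proof.
move=> [G hG]; have [Lu _ [phi [tphi c1 c2]]] := hG; exists phi; split => //.
  by apply/L2_cvgP => // n; exact: tL2.
have E n : dir (phi n - u) (phi n - u) =
    \sum_i ip (partial i (phi n) - G i) (partial i (phi n) - G i).
  have h := H10_gradientD (test_H10_gradient (tphi n)) (H10_gradientZ (-1) hG).
  by rewrite !scaleN1r in h; rewrite (dirichletE h h).
apply: (cvg_ext E).
apply: cvg0_sum => i; apply/L2_cvgP => //; last exact: H10_gradient_L2 hG.
by move=> n; apply: tL2; exact: test_partial.
Qed.

Lemma dirichlet_test u psi : H10 Omega u -> test psi ->
  dir u psi = - ip u (laplacian psi).
Proof.
move=> /gradP hu tpsi; have Lu : L2 Omega u by case: hu.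
rewrite (dirichletE hu (test_H10_gradient tpsi)) /gdot.
have -> : laplacian psi = \sum_i partial i (partial i psi).
  by apply/funext => x; rewrite fct_sumE.
have E (s : seq 'I_N) : L2 Omega (\sum_(i <- s) partial i (partial i psi)) /\
    \sum_(i <- s) ip (grad Omega u i) (partial i psi) =
    - ip u (\sum_(i <- s) partial i (partial i psi)).
  have Lp j : L2 Omega (partial j (partial j psi)).
    by apply: tL2; do 2!apply: test_partial.
  elim: s => [|j s [IH1 IH2]].
    have L0 : L2 Omega (0 : 'rV[R]_N -> R) by apply: tL2; exact: test0.
    split; rewrite !big_nil//.
    by rewrite -(scale0r (0 : 'rV[R]_N -> R)) (sipZr sI)// mul0r oppr0.
  rewrite !big_cons; split; first exact: (sipD sI).
  rewrite IH2 (sipDr sI)// opprD; congr (_ + _).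
  have [_ /(_ j)[_ w] _] := hu; rewrite w ?opprK//; exact: test_partial.
exact: (E _).2.
Qed.

(** The approximating sequence and the gradient of [u] serve for [v] as well. This will let a weak
    solution be replaced by its continuous representative. *)
Lemma H10_ae u v : H10 Omega u -> measurable_fun Omega v -> ae_eq Omega u v ->
  H10 Omega v /\ (forall w, H10 Omega w -> dir v w = dir u w).
Proof.
move=> [G hG] mv uv; have [Lu wg [phi [tphi c1 c2]]] := hG.
have mu_ : measurable_fun Omega u by case: Lu.
have Lv : L2 Omega v.
  split => //; have [_] := Lu; congr (_ < _)%E; apply: ge0_ae_eq_integral => //.
  - by apply/measurable_EFinP; exact: measurable_funX.
  - by apply/measurable_EFinP; exact: measurable_funX.
  - by move=> x _; rewrite lee_fin sqr_ge0.
  - by move=> x _; rewrite lee_fin sqr_ge0.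
  by apply: filterS uv => x h Ox; rewrite h.
have hv : H10_gradient Omega v G.
  have c1' : L2_cvg Omega phi v.
    rewrite /L2_cvg (_ : (fun n => _) =
      (fun n => \int[mu]_(x in Omega) ((phi n x - u x) ^+ 2)%:E)%E) //.
    apply/funext => n; have [mp _] := tL2 (tphi n).
    apply: ge0_ae_eq_integral => //.
    - by apply/measurable_EFinP; apply: measurable_funX; exact: measurable_funB.
    - by apply/measurable_EFinP; apply: measurable_funX; exact: measurable_funB.
    - by move=> x _; rewrite lee_fin sqr_ge0.
    - by move=> x _; rewrite lee_fin sqr_ge0.
    by apply: filterS uv => x h Ox; rewrite h.
  split => //; last by exists phi.
  apply: (weak_gradient_lim tphi) => // i; exact: H10_gradient_L2 hG.
split; first by exists G.
by move=> w /gradP hw; rewrite (dirichletE hv hw) (dirichletE hG hw).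
Qed.

Lemma H10_lim (phi : nat -> 'rV[R]_N -> R) : (forall n, test (phi n)) ->
  (forall e, 0 < e -> exists n0, forall m n, (n0 <= m)%N -> (n0 <= n)%N ->
    ip (phi m - phi n) (phi m - phi n) + dir (phi m - phi n) (phi m - phi n) <= e) ->
  exists u, [/\ H10 Omega u, ip (phi n - u) (phi n - u) @[n --> \oo] --> 0 &
      dir (phi n - u) (phi n - u) @[n --> \oo] --> 0].
Proof.
move=> tphi cphi; have Lphi n := tL2 (tphi n).
have Ldphi n i := tL2 (test_partial i (tphi n)).
have td m n : test (phi m - phi n) by exact: testB.
have dE m n : dir (phi m - phi n) (phi m - phi n) =
    \sum_i ip (partial i (phi m) - partial i (phi n)) (partial i (phi m) - partial i (phi n)).
  rewrite (dirichletE (test_H10_gradient (td m n)) (test_H10_gradient (td m n))).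
  apply: eq_bigr => i _.
  have -> : partial i (phi m - phi n) = partial i (phi m) - partial i (phi n); last by [].
  have sm n' := test_smooth (tphi n').
  rewrite -[in LHS]scaleN1r partialD ?partialZ ?scaleN1r//.
  by rewrite -scaleN1r; exact: smoothZ.
have [u [Lu cu]] : exists u, L2 Omega u /\ L2_cvg Omega phi u.
  apply: (L2_complete mO) => // e e0; have [n0 hn0] := cphi e e0.
  exists n0 => m n mn nn; apply: le_trans (hn0 m n mn nn).
  by rewrite lerDl (sip_ge0 sD)//; exact: test_H10.
have /choice[G hG] : forall i, exists g, L2 Omega g /\ L2_cvg Omega (fun n => partial i (phi n)) g.
  move=> i; apply: (L2_complete mO) => // e e0; have [n0 hn0] := cphi e e0.
  exists n0 => m n mn nn; apply: le_trans (hn0 m n mn nn).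
  apply: (@le_trans _ _ (dir (phi m - phi n) (phi m - phi n))); last first.
    by rewrite lerDr (sip_ge0 sI)//; exact: tL2.
  rewrite dE (bigD1 i)//= lerDl sumr_ge0// => j _.
  by apply: (sip_ge0 sI); exact: (sipB sI).
have hu : H10_gradient Omega u G.
  split => //; last by exists phi; split => // i; have [] := hG i.
  by apply: (weak_gradient_lim tphi) => // i; have [] := hG i.
exists u; split; first by exists G.
  exact/(L2_cvgP mO Lphi Lu).
have E n : dir (phi n - u) (phi n - u) =
    \sum_i ip (partial i (phi n) - G i) (partial i (phi n) - G i).
  have h := H10_gradientD (test_H10_gradient (tphi n)) (H10_gradientZ (-1) hu).
  by rewrite !scaleN1r in h; rewrite (dirichletE h h).
apply: (cvg_ext E).
by apply: cvg0_sum => i; apply/L2_cvgP => //; have [] := hG i.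
Qed.

End sobolev_space.

(** * The first eigenvalue *)

Section bump_support.
Context {R : realType} {N : nat}.
Implicit Types (x y : 'rV[R]_N).

Lemma sqdist_lt_ball x y (r : R) : 0 < r -> sqdist x y < r ^+ 2 -> ball x r y.
Proof.
move=> r0 h; apply/rV_ballP => // i.
rewrite -(@ltr_pXn2r _ 2)// ?nnegrE ?(ltW r0)// real_normK ?num_real//.
by apply: le_lt_trans h; rewrite -sqrrN opprB; exact: coord_le_sqdist.
Qed.

Lemma open_sqdist_ball (U : set 'rV[R]_N) x : open U -> U x ->
  exists2 r, 0 < r & forall y, sqdist x y <= r ^+ 2 -> U y.
Proof.
move=> oU Ux; have /nbhs_ballP[e /= e0 eU] := open_nbhs_nbhs (conj oU Ux).
exists (e / 2); first by rewrite divr_gt0.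
move=> y xy; apply: eU; apply: sqdist_lt_ball => //; apply: le_lt_trans xy _.
by rewrite ltr_pXn2r ?nnegrE ?divr_ge0 ?(ltW e0)// ltr_pdivrMr// ltr_pMr// ltr1n.
Qed.

Lemma test_bump (U : set 'rV[R]_N) m x (r : R) : 0 < r ->
  (forall y, sqdist x y <= r ^+ 2 -> U y) -> test_function U (bump m x r).
Proof.
move=> r0 hU; split; first exact: smooth_bump.
exists [set y | sqdist x y <= r ^+ 2]; split => //; last first.
  by move=> y /negP; rewrite -ltNge => /ltW; exact: bump_out.
apply: bounded_closed_compact.
  exists (`|x| + r); split; first exact: num_real.
  move=> t ht y /= xy; apply: ltW; apply: le_lt_trans ht.
  rewrite -[y](subrK x) addrC (le_trans (ler_normD _ _))// lerD2l.
  apply: norm_le_coord => [|i]; first exact: ltW.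
  rewrite !mxE -(@ler_pXn2r _ 2)// ?nnegrE ?(ltW r0)// real_normK ?num_real//.
  by apply: le_trans xy; exact: coord_le_sqdist.
have -> : [set y | sqdist x y <= r ^+ 2] = sqdist x @^-1` [set t | t <= r ^+ 2] by [].
apply: closed_comp; last exact: closed_le.
by move=> y _; exact/smooth_continuous/smooth_sqdist.
Qed.

Lemma lebesgue_rV_ball_gt0 n (x : 'rV[R]_n) (r : R) : 0 < r ->
  (0 < lebesgue_rV R n [set y | forall i, (`|x ord0 i - y ord0 i| < r)%R])%E.
Proof.
move=> r0; elim: n x => [|n IH] x.
  rewrite /= diracE mem_set ?lte_fin//= => i; by case: i.
rewrite /= /lebesgue_rVS /pushforward.
pose x' : 'rV[R]_n := \row_j x ord0 (lift ord0 j).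
have -> : @rV_cons R n @^-1` [set y : 'rV[R]_n.+1 | forall i, `|x ord0 i - y ord0 i| < r] =
    `]x ord0 ord0 - r, x ord0 ord0 + r[%classic `*`
    [set y : 'rV[R]_n | forall i, `|x' ord0 i - y ord0 i| < r].
  apply/seteqP; split => [[t y] /= h|[t y] /= [h1 h2] i].
    split; first by have := h ord0; rewrite mxE unlift_none in_itv/= distrC ltr_distl.
    by move=> i; have := h (lift ord0 i); rewrite !mxE liftK.
  rewrite mxE; case: unliftP => [j ->|->] /=; first by have := h2 j; rewrite mxE.
  by move: h1; rewrite in_itv/= distrC ltr_distl.
rewrite product_measure1E//; last exact: measurable_coor_ball.
apply: mule_gt0; last exact: IH.
have -> : lebesgue_measure_lebesgue_measure__canonical__measure_function_Measure R
  `](x ord0 ord0 - r), (x ord0 ord0 + r)[%classic =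
  lebesgue_measure (`]x ord0 ord0 - r, x ord0 ord0 + r[%classic : set R) by [].
rewrite lebesgue_measure_itv/= lte_fin.
have h : x ord0 ord0 - r < x ord0 ord0 + r by rewrite ltrBlDr -addrA ltrDl addr_gt0.
by rewrite h -EFinD lte_fin subr_gt0.
Qed.

Lemma continuous_integral_gt0 (U : set 'rV[R]_N) (f : 'rV[R]_N -> R) x :
  open U -> U x -> {for x, continuous f} -> (lebesgue_rV R N).-integrable U (EFin \o f) ->
  (forall y, U y -> 0 <= f y) -> 0 < f x ->
  0 < \int[lebesgue_rV R N]_(y in U) f y.
Proof.
move=> oU Ux cf intf f0 fx; have mU := open_measurable_rV oU.
have fx2 : f x / 2 < f x by rewrite ltr_pdivrMr// ltr_pMr// ltr1n.
have : nbhs x (U `&` [set y | f x / 2 < f y]).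
  apply: filterI; first exact: open_nbhs_nbhs.
  exact: cf _ (lt_nbhsr fx2).
move=> /nbhs_ballP[e /= e0 he].
pose B := [set y : 'rV[R]_N | forall i, (`|x ord0 i - y ord0 i| < e)%R].
have mB : measurable B by exact: measurable_coor_ball.
have BU : B `<=` U `&` [set y | f x / 2 < f y] by move=> y yB; apply: he; exact/rV_ballP.
rewrite lt_neqAle Rintegral_ge0// andbT; apply/eqP => i0.
have iE : (\int[lebesgue_rV R N]_(y in U) (f y)%:E = 0)%E.
  rewrite -[LHS]fineK; last exact: (integrable_fin_num mU intf).
  by rewrite -/(Rintegral _ _ _) -i0.
have : (\int[lebesgue_rV R N]_(y in B) (f x / 2)%:E <= 0)%E.
  rewrite -iE; apply: (@le_trans _ _ (\int[lebesgue_rV R N]_(y in B) (f y)%:E)%E).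
    apply: ge0_le_integral => //.
    - by move=> y _; rewrite lee_fin divr_ge0// ltW.
    - have /integrableP[mf _] := intf; apply: measurable_funS mf => //.
      by move=> y /BU[].
    - by move=> y /BU[_ /ltW].
  apply: ge0_subset_integral => //; last by move=> y /BU[].
  by have /integrableP[] := intf.
rewrite integral_cst// leNgt => /negP; apply; apply: mule_gt0.
  by rewrite lte_fin divr_gt0.
exact: lebesgue_rV_ball_gt0.
Qed.

End bump_support.

(** * The Poincaré inequality and the Rayleigh quotient *)

Section first_eigenvalue.
Context {R : realType} {N : nat}.
Variable Omega : set 'rV[R]_N.
Hypotheses (oO : open Omega) (bO : bounded_set Omega) (nO : Omega !=set0) (hN : (1 <= N)%N).
Let mO : measurable Omega := measurable_Omega oO.
Let sI := @L2_inner_semi_inner R N Omega mO.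
Let sD := dirichlet_semi_inner oO bO.
Implicit Types (f g u w : 'rV[R]_N -> R) (i : 'I_N).
Local Notation ip := (L2_inner Omega).
Local Notation dir := (dirichlet Omega).
Local Notation test := (test_function Omega).

Let tL2 f : test f -> L2 Omega f. Proof. exact: test_L2. Qed.
Let tH f : test f -> H10 Omega f. Proof. exact: test_H10. Qed.

Lemma dirichlet_tests f g : test f -> test g ->
  dir f g = \sum_i ip (partial i f) (partial i g).
Proof.
by move=> tf tg; apply: (dirichletE oO bO);
  [exact: (test_H10_gradient oO bO tf)|exact: (test_H10_gradient oO bO tg)].
Qed.

Lemma partial_le_dirichlet f i : test f -> ip (partial i f) (partial i f) <= dir f f.
Proof.
move=> tf; rewrite dirichlet_tests// (bigD1 i)//= lerDl sumr_ge0// => j _.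
by apply: (sip_ge0 sI); apply: tL2; exact: test_partial.
Qed.

Lemma L2_inner_gt0 f x : L2 Omega f -> Omega x -> {for x, continuous f} ->
  f x != 0 -> 0 < ip f f.
Proof.
move=> Lf Ox cf fx; apply: (@continuous_integral_gt0 _ _ _ _ x) => //.
- exact: continuousM.
- exact: (L2M_integrable mO).
- by move=> y _; rewrite -expr2 sqr_ge0.
- by rewrite -expr2 exprn_even_gt0.
Qed.

(* Integrating [f^2 = f^2 * d_i x_i] by parts. *)
Lemma poincare : exists2 C, 0 < C & forall f, test f -> ip f f <= C * dir f f.
Proof.
pose i := Ordinal hN.
have [M [_ hM]] := bO; pose L := Num.max 1 (M + 1).
have L1 : 1 <= L by rewrite le_max lexx.
have hL x : Omega x -> `|x ord0 i| <= L.
  move=> Ox; apply: le_trans (coord_le_norm _ _) _.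
  by rewrite le_max (hM (M + 1)) ?orbT// ltrDl.
exists (4 * L ^+ 2); first by rewrite mulr_gt0// exprn_gt0// (lt_le_trans ltr01).
move=> f tf; have sf := test_smooth tf.
pose c : 'rV[R]_N -> R := fun y => y ord0 i.
have sc : smooth c by exact: smooth_coor.
pose w : 'rV[R]_N -> R := partial i f * c.
have tw : test w by apply: testMr => //; exact: test_partial.
have Lf := tL2 tf; have Lw := tL2 tw; have Ld := tL2 (test_partial i tf).
have E : ip f f = - 2 * ip f w.
  have := L2_inner_partial oO bO i (testMr tf sf) sc.
  rewrite partialM// /c partial_coor eqxx.
  have -> : ip (f * f) (cst 1%:R) = ip f f.
    by apply: eq_Rintegral => x _; rewrite mulr1.
  have -> : ip (f * partial i f + f * partial i f) (fun y => y ord0 i) = 2 * ip f w.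
    rewrite -(sipZr sI)//; apply: eq_Rintegral => x _.
    rewrite -[LHS]/((f x * partial i f x + f x * partial i f x) * x ord0 i).
    by rewrite -[RHS]/(f x * (2 * (partial i f x * x ord0 i))); ring.
  by move=> h; rewrite mulNr h opprK.
have wd : ip w w <= L ^+ 2 * dir f f.
  apply: (@le_trans _ _ (L ^+ 2 * ip (partial i f) (partial i f))); last first.
    by rewrite ler_wpM2l ?sqr_ge0// partial_le_dirichlet.
  rewrite /L2_inner -RintegralZl//; last exact: (L2M_integrable mO).
  apply: le_Rintegral => //; first exact: (L2M_integrable mO).
    apply: (eq_integrable mO _ _ _ (integrableZl mO (L ^+ 2) (L2M_integrable mO Ld Ld))).
    by move=> x _ /=; rewrite EFinM.
  move=> x Ox; rewrite /w -[leLHS]/((partial i f x * x ord0 i) * (partial i f x * x ord0 i)).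
  rewrite mulrACA mulrC ler_wpM2r -?expr2 ?sqr_ge0//.
  by rewrite -real_normK ?num_real// ler_pXn2r ?nnegrE ?hL// (le_trans ler01).
have cs := sip_CS sI Lf Lw; have I0 := sip_ge0 sI Lf.
have [I1|I1] := leP (ip f f) 0.
  by rewrite (le_trans I1)// mulr_ge0 ?(sip_ge0 sD (tH tf))// mulr_ge0// sqr_ge0.
have : ip f f * ip f f <= ip f f * (4 * (L ^+ 2 * dir f f)).
  have -> : ip f f * ip f f = 4 * ip f w ^+ 2 by rewrite {1 2}E; ring.
  rewrite (@le_trans _ _ (4 * (ip f f * ip w w))) ?ler_pM2l//.
  by rewrite mulrCA ler_pM2l// ler_pM2l.
by rewrite ler_pM2l// mulrA.
Qed.

Definition rayleigh : set R := [set dir f f | f in [set f | test f /\ ip f f = 1]].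

Definition lam1 : R := inf rayleigh.

Lemma exists_bump : exists2 f, test f & 0 < ip f f.
Proof.
have [x Ox] := nO; have [r r0 hr] := open_sqdist_ball oO Ox.
have tb := test_bump 0 r0 hr; exists (bump 0 x r) => //.
apply: (@L2_inner_gt0 _ x) => //; first exact: tL2.
  exact: test_continuous tb x.
by rewrite gt_eqF// /bump sqdistxx mul0r subr0; exact: profile0_gt0.
Qed.

Lemma test_normalize f : test f -> 0 < ip f f ->
  test ((Num.sqrt (ip f f))^-1 *: f) /\
  ip ((Num.sqrt (ip f f))^-1 *: f) ((Num.sqrt (ip f f))^-1 *: f) = 1 /\
  dir ((Num.sqrt (ip f f))^-1 *: f) ((Num.sqrt (ip f f))^-1 *: f) = dir f f / ip f f.
Proof.
move=> tf f0; set a := _^-1; have a2 : a * a = (ip f f)^-1.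
  by rewrite /a -invfM -expr2 sqr_sqrtr// ltW.
have Lf := tL2 tf; split; first exact: testZ.
rewrite (sipZl sI) ?(sipZr sI)//; try exact: (sipZ sI).
rewrite (sipZl sD) ?(sipZr sD)//; try by [apply: (sipZ sD); exact: tH|exact: tH].
by rewrite !mulrA a2 mulVf ?gt_eqF// mulrC.
Qed.

Lemma rayleigh_has_inf : has_inf rayleigh.
Proof.
split.
  have [f tf f0] := exists_bump; have [t1 [t2 t3]] := test_normalize tf f0.
  by eexists; eexists; [split; [exact: t1|exact: t2]|reflexivity].
by exists 0 => _ [f [tf _] <-]; apply: (sip_ge0 sD); exact: tH.
Qed.

Lemma lam1_le f : test f -> lam1 * ip f f <= dir f f.
Proof.
move=> tf; have [f0|f0] := leP (ip f f) 0.
  have -> : ip f f = 0 by apply/le_anti; rewrite f0 (sip_ge0 sI)//; exact: tL2.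
  by rewrite mulr0 (sip_ge0 sD)//; exact: tH.
have [t1 [t2 t3]] := test_normalize tf f0.
rewrite -ler_pdivlMr// -t3; apply: inf_lbound; first by case: rayleigh_has_inf.
by eexists; [split; [exact: t1|exact: t2]|reflexivity].
Qed.

Lemma lam1_gt0 : 0 < lam1.
Proof.
have [C C0 hC] := poincare; apply: (@lt_le_trans _ _ C^-1); first by rewrite invr_gt0.
apply: lb_le_inf; first by case: rayleigh_has_inf.
by move=> _ [f [tf f1] <-]; rewrite -(ler_pM2l C0) mulfV ?gt_eqF// -f1 hC.
Qed.

Lemma lam1_adherent e : 0 < e -> exists f, [/\ test f, ip f f = 1 & dir f f < lam1 + e].
Proof.
by move=> e0; have [_ [f [tf f1] <-] h] := inf_adherent e0 rayleigh_has_inf; exists f.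
Qed.

Lemma lam1_le_H10 u : H10 Omega u -> lam1 * ip u u <= dir u u.
Proof.
move=> Hu; have [phi [tphi c1 c2]] := H10_approx oO bO Hu.
have Lu := H10_L2 Hu.
have d1 := sip_cvg_sq sI (fun n => tL2 (tphi n)) Lu c1.
have d2 := sip_cvg_sq sD (fun n => tH (tphi n)) Hu c2.
have d1' : lam1 * ip (phi n) (phi n) @[n --> \oo] --> lam1 * ip u u.
  by apply: cvgM => //; exact: cvg_cst.
rewrite -(cvg_lim _ d1')// -(cvg_lim _ d2)//; apply: ler_lim.
- by apply/cvg_ex; eexists; exact: d1'.
- by apply/cvg_ex; eexists; exact: d2.
- by apply: nearW => n; exact: lam1_le.
Qed.

(** Take [g = sabs e f - e]: subtracting [e] restores the compact support, and each partial
    derivative is multiplied by [f / sabs e f], of modulus at most 1. *)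
Lemma test_sabs f (e : R) : 0 < e -> test f -> exists g : 'rV[R]_N -> R,
  [/\ test g, forall x, 0 <= g x, forall x, `|g x - `|f x| | <= e &
      dir g g <= dir f f].
Proof.
move=> e0 tf.
have h (a b : R) : b <= a -> a <= b + e -> `|a - e - b| <= e.
  by rewrite ler_norml => ? ?; apply/andP; split; move: e0; lra.
pose s t := sabs e t - e.
have s0 : s 0 = 0 by rewrite /s /sabs expr0n add0r sqrtr_sqr (gtr0_norm e0) subrr.
have ss : smooth1 s.
  have [G [G0 hG]] := smooth1_sabs e0.
  exists (fun n => if n is 0%N then s else G n); split => // -[|n] x; last exact: hG.
  have -> : s = G 0%N - cst e by rewrite G0.
  by have := is_deriveB (hG 0%N x) (is_derive_cst e x 1); rewrite subr0.
have tg := test_comp tf ss s0; exists (s \o f); split; [exact: tg| | |].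
- by move=> x /=; rewrite subr_ge0 -[leLHS](gtr0_norm e0) -sqrtr_sqr ler_wsqrtr// lerDr sqr_ge0.
- move=> x /=; have [h1 h2] := sabs_bounds e0 (f x).
  exact: h h1 h2.
rewrite (dirichlet_tests tg tg) (dirichlet_tests tf tf); apply: ler_sum => i _.
have dsf x : partial i (s \o f) x = f x / sabs e (f x) * partial i f x.
  have d1 := smooth_is_derive i x (test_smooth tf).
  have d2 : is_derive (f x) (1 : R) s (f x / sabs e (f x)).
    have := is_deriveB (is_derive_sabs e0 (f x)) (is_derive_cst e (f x) 1).
    by rewrite subr0.
  by have [_ dE] := is_derive_comp1 d1 d2.
apply: le_Rintegral => //.
- by apply: (L2M_integrable mO); apply: tL2; exact: test_partial.
- by apply: (L2M_integrable mO); apply: tL2; exact: test_partial.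
move=> x _; rewrite dsf mulrACA ler_piMl// -expr2 ?sqr_ge0//.
rewrite expr_div_n ler_pdivrMr ?exprn_gt0 ?sabs_gt0// mul1r sqr_sabs//.
by rewrite lerDl sqr_ge0.
Qed.

End first_eigenvalue.

(** * Averages and compactness *)

Section bump_estimates.
Context {R : realType} {N : nat}.
Implicit Types (x y z : 'rV[R]_N) (m : nat) (r : R).

Lemma sqdist_shift x z : sqdist x (x + z) = sqdist 0 z.
Proof. by apply: eq_bigr => j _; rewrite !mxE addrAC subrr add0r subr0. Qed.

Lemma bump_shift m x r z : bump m x r (x + z) = bump m 0 r z.
Proof. by rewrite /bump sqdist_shift. Qed.

Let U x r : set 'rV[R]_N := [set y | `|y| < `|x| + r + 1].

Let oU x r : open (U x r).
Proof.
have -> : U x r = (fun y => `|y|) @^-1` [set t | t < `|x| + r + 1] by [].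
by apply: open_comp; [move=> y _; exact: norm_continuous|exact: open_lt].
Qed.

Let bU x r : bounded_set (U x r).
Proof.
exists (`|x| + r + 1); split; first exact: num_real.
by move=> t ht y /= /ltW/le_trans; apply; exact: ltW.
Qed.

Lemma test_bump_ball m x r : 0 < r -> test_function (U x r) (bump m x r).
Proof.
move=> r0; apply: test_bump => // y xy /=.
rewrite /U/= -[y](subrK x) [_ - _ + x]addrC (le_lt_trans (ler_normD _ _))// -addrA ltrD2l.
apply: (@le_lt_trans _ _ r); last by rewrite ltrDl.
apply: norm_le_coord => [|i]; first exact: ltW.
rewrite !mxE -(@ler_pXn2r _ 2)// ?nnegrE ?(ltW r0)// real_normK ?num_real//.
by apply: le_trans xy; exact: coord_le_sqdist.
Qed.

Lemma bump_integrableT m x r : 0 < r ->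
  (lebesgue_rV R N).-integrable setT (EFin \o bump m x r).
Proof. by move=> /(test_bump_ball m x)/(test_integrableT (@oU x r) (@bU x r)). Qed.

Lemma bump_bounded m x r : 0 < r -> exists2 C : R, 0 < C & forall y, `|bump m x r y| <= C.
Proof. by move=> /(test_bump_ball m x)/test_bounded. Qed.

Lemma bump_L2T m x r : 0 < r -> L2 setT (bump m x r).
Proof. by move=> /(test_bump_ball m x)/(test_L2T (@oU x r) (@bU x r)). Qed.

Lemma bump_continuous m x r : continuous (bump m x r).
Proof. exact/smooth_continuous/smooth_bump. Qed.

Lemma bump_measurable m x r : measurable_fun setT (bump m x r).
Proof. by apply: continuous_measurable_rV; exact: bump_continuous. Qed.

Lemma profile_continuous m : continuous (@profile R m).
Proof.
case: m => [|m] p; first exact: is_derive_continuous (is_derive_flat _ _).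
exact: is_derive_continuous (is_derive_profile m p).
Qed.

Lemma profile_bounded m : exists2 C : R, 0 < C & forall p, p <= 1 -> `|profile m p| <= C.
Proof.
have : compact (@profile R m @` [set` `[0, 1]]).
  apply: continuous_compact; last exact: segment_compact.
  exact: continuous_subspaceT (@profile_continuous m).
move=> /compact_bounded[M [_ hM]]; exists (Num.max 1 (M + 1)).
  by rewrite lt_max ltr01.
move=> p p1; have [p0|p0] := leP p 0.
  by rewrite profile_le0// normr0 le_max ler01.
rewrite le_max (hM (M + 1)) ?orbT ?ltrDl//.
by exists p => //=; rewrite in_itv/= (ltW p0).
Qed.

Lemma profile_lip m : exists2 C : R, 0 < C & forall p q, p <= 1 -> q <= 1 ->
  `|profile m.+1 p - profile m.+1 q| <= C * `|p - q|.
Proof.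
have [C C0 hC] := profile_bounded m; exists C => // p q.
wlog pq : p q / q <= p => [hwlog|p1 q1].
  by have [/hwlog|/ltW/hwlog h p1 q1] := leP q p; [exact|rewrite distrC [in leRHS]distrC h].
have [|c] := MVT_segment pq (fun h _ => is_derive_profile m h).
  by apply: continuous_subspaceT; exact: profile_continuous.
rewrite in_itv/= => /andP[_ cp] ->; rewrite normrM ler_wpM2r//.
rewrite normrM (le_trans _ (hC c (le_trans cp p1)))// ler_piMl//.
by rewrite ger0_norm// invf_le1// ler1n.
Qed.

(** The profile is Lipschitz on the half-line up to 1, where its argument stays, and [sqdist x y] is
    Lipschitz in [x] on bounded sets. *)
Lemma bump_lip (D : set 'rV[R]_N) m r : bounded_set D -> 0 < r ->
  exists2 C : R, 0 < C & forall x x' y, D x -> D x' -> D y ->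
    `|bump m.+1 x r y - bump m.+1 x' r y| <= C * `|x - x'|.
Proof.
move=> [M [_ hM]] r0; have [L L0 hL] := profile_lip m.
pose M' := Num.max 1 (M + 1).
have M1 : 1 <= M' by rewrite le_max lexx.
have hD x i : D x -> `|x ord0 i| <= M'.
  move=> Dx; apply: le_trans (coord_le_norm _ _) _.
  by rewrite le_max (hM (M + 1)) ?orbT// ltrDl.
have r2 : 0 < r ^+ 2 by rewrite exprn_gt0.
exists (L * (N.+1%:R * (4 * M')) / r ^+ 2).
  by rewrite divr_gt0// !mulr_gt0// (lt_le_trans ltr01).
move=> x x' y Dx Dx' Dy.
have le1 x0 : 1 - sqdist x0 y / r ^+ 2 <= 1 by rewrite gerBl divr_ge0// ?sqdist_ge0// ltW.
apply: le_trans (hL _ _ (le1 x) (le1 x')) _.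
pose K : R := N.+1%:R * (4 * M').
have -> : 1 - sqdist x y / r ^+ 2 - (1 - sqdist x' y / r ^+ 2) =
    (sqdist x' y - sqdist x y) / r ^+ 2 by ring.
rewrite normrM [`|_^-1|]ger0_norm ?invr_ge0 ?(ltW r2)//.
have -> : L * K / r ^+ 2 * `|x - x'| = L * (K * `|x - x'| / r ^+ 2) by ring.
apply: ler_wpM2l; first exact: ltW.
apply: ler_wpM2r; first by rewrite invr_ge0 ltW.
rewrite /sqdist -sumrB (le_trans (ler_norm_sum _ _ _))//.
apply: (@le_trans _ _ (\sum_(j < N) 4 * M' * `|x - x'|)).
  apply: ler_sum => j _.
  have -> : (y ord0 j - x' ord0 j) ^+ 2 - (y ord0 j - x ord0 j) ^+ 2 =
    (2 * y ord0 j - x' ord0 j - x ord0 j) * (x ord0 j - x' ord0 j) by ring.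
  rewrite normrM; apply: ler_pM => //.
    apply: (le_trans (ler_normB _ _)); apply: (le_trans (lerD (ler_normB _ _) (lexx _))).
    rewrite normrM ger0_norm//.
    by have := hD _ j Dx; have := hD _ j Dx'; have := hD _ j Dy; lra.
  by have := coord_le_norm (x - x') j; rewrite !mxE.
rewrite sumr_const card_ord -[leLHS]mulr_natl [leLHS]mulrA /K.
by rewrite ler_wpM2r// ler_wpM2r ?mulr_ge0 ?ler_nat// (le_trans ler01).
Qed.

Definition mass m r : R := \int[lebesgue_rV R N]_z bump m 0 r z.

Lemma profile_gt0 m (p : R) : 0 < p -> 0 < profile m p.
Proof.
elim: m p => [|m IH] p p0; first exact: profile0_gt0.
have [c] := MVT p0 (fun h _ => is_derive_profile m h)
  (continuous_subspaceT (@profile_continuous m.+1)).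
move=> + E; rewrite in_itv => /andP[c0 _].
move: E; rewrite (profile_le0 m.+1 (lexx 0)) !subr0 => ->.
by rewrite !mulr_gt0// IH.
Qed.

Lemma mass_gt0 m r : 0 < r -> 0 < mass m r.
Proof.
move=> r0; apply: (@continuous_integral_gt0 _ _ _ _ 0) => //.
- exact: openT.
- exact: bump_continuous.
- exact: bump_integrableT.
- by move=> y _; exact: bump_ge0.
- by rewrite /bump sqdistxx mul0r subr0; exact: profile_gt0.
Qed.

End bump_estimates.

(** * Averages against bumps *)

Section averaging.
Context {R : realType} {N : nat}.
Variable Omega : set 'rV[R]_N.
Hypotheses (oO : open Omega) (bO : bounded_set Omega).
Let mu := lebesgue_rV R N.
Let mO : measurable Omega := measurable_Omega oO.
Let sI := @L2_inner_semi_inner R N Omega mO.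
Let sT := @L2_inner_semi_inner R N setT measurableT.
Implicit Types (f g u : 'rV[R]_N -> R) (i : 'I_N).
Local Notation ip := (L2_inner Omega).
Local Notation nrm := (snorm (L2_inner Omega)).
Local Notation nrmT := (snorm (L2_inner setT)).
Local Notation test := (test_function Omega).

Lemma bump_L2 m x (r : R) : 0 < r -> L2 Omega (bump m x r).
Proof.
move=> r0; have [C C0 hC] := bump_bounded m x r0.
apply: (@L2_bounded _ _ _ mO _ C) => //; first exact: Omega_fin.
by apply: measurable_funTS; exact: bump_measurable.
Qed.

Lemma L2_inner_le_sup u (c : R) : L2 Omega u -> (forall x, Omega x -> `|u x| <= c) ->
  ip u u <= c ^+ 2 * fine (mu Omega).
Proof.
move=> Lu uc; rewrite -Rintegral_cst//; apply: le_Rintegral => //.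
- exact: (L2M_integrable mO).
- exact: (integrable_cst mO _ (Omega_fin oO bO)).
move=> x Ox; rewrite -expr2 -[u x ^+ 2]real_normK ?num_real//.
by rewrite ler_pXn2r ?nnegrE ?uc// (le_trans _ (uc _ Ox)).
Qed.

Lemma L2_inner_bump_lip (D : set 'rV[R]_N) m (r : R) : bounded_set D ->
  Omega `<=` D -> 0 < r -> exists2 C : R, 0 <= C & forall u, L2 Omega u ->
  forall x x', D x -> D x' ->
    `|ip u (bump m.+1 x r) - ip u (bump m.+1 x' r)| <= C * nrm u * `|x - x'|.
Proof.
move=> bD OD r0; have [C C0 hC] := bump_lip m bD r0.
exists (C * Num.sqrt (fine (mu Omega))); first by rewrite mulr_ge0 ?sqrtr_ge0// ltW.
move=> u Lu x x' Dx Dx'.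
have Lx := bump_L2 m.+1 x r0; have Lx' := bump_L2 m.+1 x' r0.
have Ld : L2 Omega (bump m.+1 x r - bump m.+1 x' r) by exact: (sipB sI).
rewrite -(sipBr sI)//; apply: le_trans (sip_le_snorm sI Lu Ld) _.
have h : ip (bump m.+1 x r - bump m.+1 x' r) (bump m.+1 x r - bump m.+1 x' r) <=
    (C * `|x - x'|) ^+ 2 * fine (mu Omega).
  by apply: L2_inner_le_sup => // y Oy; apply: hC => //; exact: OD.
have n0 : 0 <= nrm u by exact: sqrtr_ge0.
apply: (@le_trans _ _ (nrm u * (C * `|x - x'| * Num.sqrt (fine (mu Omega))))); last first.
  by rewrite le_eqVlt; apply/orP; left; apply/eqP; ring.
apply: ler_wpM2l => //; rewrite /snorm.
have C1 : 0 <= C * `|x - x'| by rewrite mulr_ge0// ltW.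
by rewrite -[C * _](ger0_norm C1) -sqrtr_sqr -sqrtrM ?sqr_ge0// ler_wsqrtr.
Qed.

Lemma L2_inner_bump_continuous u m (r : R) : L2 Omega u -> 0 < r ->
  continuous (fun x => ip u (bump m.+1 x r)).
Proof.
move=> Lu r0 x; pose D := Omega `|` ball x 1.
have bD : bounded_set D.
  have [M [_ hM]] := bO; exists (Num.max (M + 1) (`|x| + 1)); split; first exact: num_real.
  move=> t; rewrite gt_max => /andP[t1 t2] y [Oy|].
    by apply: le_trans (ltW t1); apply: hM => //; rewrite ltrDl.
  rewrite -ball_normE /= => xy; apply: le_trans (ltW t2).
  by rewrite -[y](subrK x) addrC (le_trans (ler_normD _ _))// lerD2l distrC ltW.
have [C C0 hC] := L2_inner_bump_lip m bD (@subsetUl _ _ _) r0.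
have K0 : 0 <= C * nrm u by rewrite mulr_ge0// sqrtr_ge0.
have Fx : ProperFilter (nbhs x) := @nbhs_pfilter 'rV[R]_N x.
apply/cvgrPdist_le => e e0.
have d0 : 0 < Num.min 1 (e / (C * nrm u + 1)).
  by rewrite lt_min ltr01 divr_gt0// ltr_wpDl.
apply/(@nbhs_ballP R 'rV[R]_N x); exists (Num.min 1 (e / (C * nrm u + 1))) => //= y xy.
have xy1 : ball x 1 y by apply: le_ball xy; rewrite ge_min lexx.
apply: le_trans (hC u Lu _ _ (or_intror (ballxx _ ltr01)) (or_intror xy1)) _.
move: xy; rewrite -ball_normE /= lt_min => /andP[_ xy2].
apply: (@le_trans _ _ ((C * nrm u + 1) * `|x - y|)).
  by rewrite ler_wpM2r// lerDl.
by rewrite -ler_pdivlMl ?ltr_wpDl// mulrC ltW.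
Qed.

Section averaging_estimate.
Variables (f : 'rV[R]_N -> R) (m : nat) (r : R).
Hypotheses (tf : test f) (r0 : 0 < r).
Let k : 'rV[R]_N -> R := bump m.+1 0 r.
Let c : R := @mass R N m.+1 r.
Let F x := ip f (bump m.+1 x r).

Lemma averageE x : F x = \int[mu]_z (f (x + z) * k z).
Proof.
rewrite /F (L2_innerT _ tf).
have iL := L2M_integrable measurableT (test_L2T oO bO tf) (bump_L2T m.+1 x r0).
rewrite /L2_inner -(Rintegral_shift x iL); apply: eq_Rintegral => z _.
by rewrite addrC bump_shift.
Qed.

Let g x (z : 'rV[R]_N) := f x - f (x + z).

Let mfx x : measurable_fun setT (fun z : 'rV[R]_N => f (x + z)).
Proof.
rewrite (_ : (fun z => _) = f \o (fun z => z + x)).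
  exact: measurableT_comp (test_measurable tf) (measurable_shift x).
by apply/funext => z /=; rewrite addrC.
Qed.

Let mg x : measurable_fun setT (g x).
Proof. by apply: measurable_funB; [exact: measurable_cst|exact: mfx]. Qed.

Let gC : exists2 C : R, 0 < C & forall x z, `|g x z| <= C.
Proof.
have [C C0 hC] := test_bounded tf; exists (C + C); first by rewrite addr_gt0.
by move=> x z; apply: le_trans (ler_normB _ _) _; apply: lerD.
Qed.

(** Half of the weight goes to each factor in the Cauchy-Schwarz inequality, which leaves [c] times
    the [k]-weighted mean of [g x z ^+ 2]. *)
Let a (z : 'rV[R]_N) : R := Num.sqrt (k z).

Let aa z : a z * a z = k z.
Proof. by rewrite -expr2 sqr_sqrtr// bump_ge0. Qed.

Let ma : measurable_fun setT a.
Proof.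
apply: continuous_measurable_rV => z.
by apply: continuous_comp; [exact: bump_continuous|exact: sqrt_continuous].
Qed.

Let La : L2 setT a.
Proof.
apply: (L2_dom measurableT ma (bump_integrableT m.+1 0 r0)) => z _.
by rewrite expr2 aa.
Qed.

Let Lga x : L2 setT (g x * a).
Proof.
have [C C0 hC] := gC.
apply: (L2_dom measurableT (g := fun z => C ^+ 2 * k z)).
- by apply: measurable_funM => //; exact: mg.
- apply: (eq_integrable measurableT _ _ _
    (integrableZl measurableT (C ^+ 2) (bump_integrableT m.+1 0 r0))).
  by move=> z _ /=; rewrite EFinM.
move=> z _; rewrite -[(g x * a) z]/(g x z * a z) exprMn [a z ^+ 2]expr2 aa.
rewrite ler_wpM2r ?bump_ge0// -[g x z ^+ 2]real_normK ?num_real//.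
by rewrite ler_pXn2r ?nnegrE// ltW.
Qed.

Let g2k x z : (g x * a) z * (g x * a) z = g x z ^+ 2 * k z.
Proof. by rewrite -[(g x * a) z]/(g x z * a z) mulrACA aa expr2. Qed.

Lemma average_diffE x : c * f x - F x = L2_inner setT (g x * a) a.
Proof.
rewrite averageE /c /mass.
have ik := bump_integrableT m.+1 (0 : 'rV[R]_N) r0.
have [C C0 hC] := test_bounded tf.
have i1 : mu.-integrable setT (EFin \o (fun z => f (x + z) * k z)).
  apply: (le_integrable measurableT _ _ (integrableZl measurableT C ik)).
    by apply/measurable_EFinP; apply: measurable_funM => //; exact: bump_measurable.
  move=> z _ /=; rewrite lee_fin !normrM ler_wpM2r//.
  by rewrite [`|C|]ger0_norm ?hC// ltW.
rewrite mulrC -RintegralZl// -RintegralB//.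
  by apply: eq_Rintegral => z _; rewrite -[(g x * a) z]/(g x z * a z) -mulrA aa -mulrBl.
apply: (eq_integrable measurableT _ _ _ (integrableZl measurableT (f x) ik)).
by move=> z _ /=; rewrite EFinM.
Qed.

Lemma average_CS x : (c * f x - F x) ^+ 2 <= c * \int[mu]_z (g x z ^+ 2 * k z).
Proof.
rewrite average_diffE; apply: le_trans (sip_CS sT (Lga x) La) _.
rewrite mulrC le_eqVlt; apply/orP; left; apply/eqP; congr (_ * _).
  by apply: eq_Rintegral => z _; rewrite aa.
by apply: eq_Rintegral => z _; rewrite g2k.
Qed.

Let B : R := (r * \sum_i nrmT (partial i f)) ^+ 2.

Let k_shift z : k z * L2_inner setT ((fun x => f (x + z)) - f) ((fun x => f (x + z)) - f)
  <= k z * B.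
Proof.
have [h|h] := leP (r ^+ 2) (sqdist 0 z).
  by rewrite /k bump_out// !mul0r.
have Lf := test_L2T oO bO tf.
have Ld : L2 setT ((fun x => f (x + z)) - f) by apply: (sipB sT) => //; exact: L2_shift.
have S0 : 0 <= \sum_i nrmT (partial i f) by apply: sumr_ge0 => i _; exact: sqrtr_ge0.
apply: ler_wpM2l; first exact: bump_ge0.
rewrite -(snorm_sq sT Ld) /B ler_pXn2r ?nnegrE ?mulr_ge0 ?sqrtr_ge0 ?(ltW r0)//.
apply: le_trans (test_shift oO bO z tf) _; rewrite mulr_sumr; apply: ler_sum => i _.
apply: ler_wpM2r; first exact: sqrtr_ge0.
rewrite -(@ler_pXn2r _ 2)// ?nnegrE ?(ltW r0)// real_normK ?num_real//.
apply: ltW; apply: le_lt_trans h; have := coord_le_sqdist 0 z i.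
by rewrite mxE subr0.
Qed.

Let H (p : 'rV[R]_N * 'rV[R]_N) : \bar R := (g p.1 p.2 ^+ 2 * k p.2)%:E.

Let H0 p : (0 <= H p)%E.
Proof. by rewrite lee_fin mulr_ge0 ?sqr_ge0 ?bump_ge0. Qed.

Let mH : measurable_fun setT H.
Proof.
have mf := test_measurable tf.
apply/measurable_EFinP; apply: measurable_funM; last first.
  exact: (measurableT_comp (bump_measurable m.+1 0 r) measurable_snd).
apply: measurable_funX; apply: measurable_funB.
  exact: (measurableT_comp mf measurable_fst).
exact: (measurableT_comp mf (@measurable_addrV R N)).
Qed.

Let mH1 z : measurable_fun setT (fun x => H (x, z)).
Proof. exact: measurableT_comp mH (measurable_pair2 z). Qed.

Let mH2 x : measurable_fun setT (fun z => H (x, z)).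
Proof. exact: measurableT_comp mH (measurable_pair1 x). Qed.

Let F_measurable : measurable_fun setT F.
Proof.
apply: continuous_measurable_rV; apply: L2_inner_bump_continuous => //.
exact: (test_L2 oO bO tf).
Qed.

(** Cauchy-Schwarz in [z], then Tonelli: for fixed [z] the inner integral is the squared norm of a
    translation difference, bounded by [B] since [k] vanishes for [z] of Euclidean length at least
    [r]. *)
Lemma average_L2 : L2 Omega (c *: f - F) /\ ip (c *: f - F) (c *: f - F) <= c ^+ 2 * B.
Proof.
have c0 : 0 <= c by apply: ltW; exact: mass_gt0.
have md : measurable_fun setT (c *: f - F).
  apply: measurable_funB; last exact: F_measurable.
  exact: (measurable_funM (measurable_cst c) (test_measurable tf)).
have ik := bump_integrableT m.+1 (0 : 'rV[R]_N) r0.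
have mk := bump_measurable m.+1 (0 : 'rV[R]_N) r.
have h : (\int[mu]_(x in Omega) ((c *: f - F) x ^+ 2)%:E <= (c ^+ 2 * B)%:E)%E.
  have B0 : 0 <= B by exact: sqr_ge0.
  apply: (@le_trans _ _ (\int[mu]_x ((c *: f - F) x ^+ 2)%:E)%E).
    apply: ge0_subset_integral => //; last by move=> x _; rewrite lee_fin sqr_ge0.
    by apply/measurable_EFinP; exact: measurable_funX.
  apply: (@le_trans _ _ (\int[mu]_x (c%:E * \int[mu]_z H (x, z)))%E).
    apply: ge0_le_integral => //.
    - by move=> x _; rewrite lee_fin sqr_ge0.
    - by apply/measurable_EFinP; exact: measurable_funX.
    - apply: emeasurable_funM => //; exact: measurable_fun_fubini_tonelli_F.
    move=> x _; have iE : (\int[mu]_z H (x, z) = (\int[mu]_z (g x z ^+ 2 * k z))%:E)%E.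
      rewrite [in RHS]/Rintegral fineK//; apply: integrable_fin_num => //.
      apply: (eq_integrable measurableT _ _ _ (L2M_integrable measurableT (Lga x) (Lga x))).
      by move=> z _ /=; rewrite g2k.
    by rewrite iE -EFinM lee_fin; exact: average_CS.
  rewrite ge0_integralZl//; [|exact: measurable_fun_fubini_tonelli_F|by move=> x _; exact: integral_ge0].
  rewrite expr2 -mulrA EFinM lee_wpmul2l// (fubini_tonelli H mH H0).
  apply: (@le_trans _ _ (\int[mu]_z (B * k z)%:E)%E); last first.
    have iE : (\int[mu]_z (k z)%:E = c%:E)%E.
      by rewrite /c /mass /Rintegral fineK//; exact: integrable_fin_num.
    under eq_integral do rewrite EFinM.
    rewrite ge0_integralZl ?lee_fin//; last 2 first.
    - exact/measurable_EFinP.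
    - by move=> z _; rewrite lee_fin bump_ge0.
    by rewrite iE -EFinM mulrC.
  apply: ge0_le_integral => //.
  - by move=> z _; exact: integral_ge0.
  - exact: measurable_fun_fubini_tonelli_G.
  - by apply/measurable_EFinP; apply: measurable_funM.
  move=> z _; have Lf := test_L2T oO bO tf.
  have Ld : L2 setT ((fun x => f (x + z)) - f) by apply: (sipB sT) => //; exact: L2_shift.
  have -> : (\int[mu]_x H (x, z) = (k z)%:E * \int[mu]_x (((fun x => f (x + z)) - f) x ^+ 2)%:E)%E.
    rewrite -ge0_integralZl//; last 3 first.
    - by have /integrableP[] := L2_sq_integrable measurableT Ld.
    - by move=> x _; rewrite lee_fin sqr_ge0.
    - by rewrite lee_fin bump_ge0.
    apply: eq_integral => x _; rewrite -EFinM /H /= /g; congr (_%:E).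
    by rewrite -[((fun x => f (x + z)) - f) x]/(f (x + z) - f x); ring.
  by rewrite (L2_innerE measurableT Ld) -EFinM lee_fin [leRHS]mulrC; exact: k_shift.
have Ld : L2 Omega (c *: f - F).
  by split; [exact: measurable_funTS|exact: le_lt_trans h (ltry _)].
by split => //; rewrite -lee_fin -L2_innerE.
Qed.

End averaging_estimate.

End averaging.

(** * Compactness through finitely many averages *)

Section defect.
Context {R : realType} {N : nat}.
Variable Omega : set 'rV[R]_N.
Hypotheses (oO : open Omega) (bO : bounded_set Omega).
Let mu := lebesgue_rV R N.
Let mO : measurable Omega := measurable_Omega oO.
Let sI := @L2_inner_semi_inner R N Omega mO.
Let sD := dirichlet_semi_inner oO bO.
Implicit Types (f : 'rV[R]_N -> R) (i : 'I_N).
Local Notation ip := (L2_inner Omega).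
Local Notation nrm := (snorm (L2_inner Omega)).
Local Notation dir := (dirichlet Omega).
Local Notation test := (test_function Omega).
Local Notation mass := (@mass R N).

Let tL2 f : test f -> L2 Omega f. Proof. exact: test_L2. Qed.
Let tH f : test f -> H10 Omega f. Proof. exact: test_H10. Qed.

Lemma average_dirichlet m f (r : R) : test f -> 0 < r ->
  let F x := ip f (bump m.+1 x r) in
  L2 Omega (mass m.+1 r *: f - F) /\
  ip (mass m.+1 r *: f - F) (mass m.+1 r *: f - F) <= (mass m.+1 r * r * N%:R) ^+ 2 * dir f f.
Proof.
move=> tf r0 F; have [h1 h2] := average_L2 oO bO m tf r0; split => //.
apply: le_trans h2 _; set c := mass m.+1 r.
have -> : (c * r * N%:R) ^+ 2 * dir f f = c ^+ 2 * (r ^+ 2 * (N%:R ^+ 2 * dir f f)) by ring.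
apply: ler_wpM2l; first exact: sqr_ge0.
rewrite exprMn; apply: ler_wpM2l; first exact: sqr_ge0.
have D0 : 0 <= dir f f by apply: (sip_ge0 sD); exact: tH.
rewrite -[dir f f]sqr_sqrtr// -exprMn ler_pXn2r ?nnegrE ?mulr_ge0 ?sqrtr_ge0//; last first.
  by apply: sumr_ge0 => i _; exact: sqrtr_ge0.
rewrite mulr_natl -[X in _ *+ X](card_ord N) -sumr_const; apply: ler_sum => i _.
rewrite /snorm -(L2_innerT _ (test_partial i tf)) ler_wsqrtr//.
exact: partial_le_dirichlet.
Qed.

(** The net comes from the compactness of a closed ball [D] around [Omega], so its points may lie
    outside [Omega]; the Lipschitz bounds are stated on [D] for this reason. *)
Lemma finite_net : exists2 D : set 'rV[R]_N, bounded_set D /\ Omega `<=` D &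
  forall d, 0 < d -> exists2 s : seq 'rV[R]_N, (forall y, y \in s -> D y) &
    forall x, Omega x -> exists2 y, y \in s & `|x - y| <= d.
Proof.
have [M [_ hM]] := bO; pose D := [set x : 'rV[R]_N | `|x| <= M + 1].
have bD : bounded_set D.
  exists (M + 1); split; first exact: num_real.
  by move=> t ht x /= /le_trans; apply; exact: ltW.
exists D.
  by split => // x Ox; apply: hM => //; rewrite ltrDl.
move=> d d0; have : compact D.
  apply: bounded_closed_compact => //.
  have -> : D = (fun x => `|x|) @^-1` [set t | t <= M + 1] by [].
  by apply: closed_comp; [move=> y _; exact: norm_continuous|exact: closed_le].
rewrite compact_cover => /(_ _ D (fun y => ball y d)).
case=> [y _|x Dx|s sDs hs]; first exact: ball_open.
  by exists x => //; exact: ballxx.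
exists (finmap.enum_fset s) => [y ys|x Ox]; first by have := sDs y ys; rewrite inE.
have [|y ys] := hs x; first by apply: hM => //; rewrite ltrDl.
by rewrite -ball_normE /= => /ltW; rewrite distrC => h; exists y.
Qed.

(* A quantitative form of the compactness of the embedding of [H10] in [L2]:
   [L2_inner] is controlled by [dir - L * L2_inner] up to finitely many
   functionals. *)
Lemma defect (L : R) : 0 <= L -> exists C C' r (s : seq 'rV[R]_N),
  [/\ 0 <= C, 0 <= C', 0 < r & forall f, test f ->
    ip f f <= C * (dir f f - L * ip f f) + C' * \sum_(y <- s) ip f (bump 1 y r) ^+ 2].
Proof.
move=> L0; have [D [bD OD] net] := finite_net.
have n0 : 0 < (N%:R : R) ^+ 2 + 1 by rewrite ltr_wpDl// sqr_ge0.
(* The radius is small enough for [a * L <= 1 / 4], where [a] is the factor of [dir f f] in the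
   estimate [h3]. *)
pose r : R := (Num.sqrt (8 * (L + 1) * (N%:R ^+ 2 + 1)))^-1.
have r0 : 0 < r by rewrite invr_gt0 sqrtr_gt0 !mulr_gt0// ltr_wpDl.
pose a : R := 2 * (r * N%:R) ^+ 2.
have a0 : 0 <= a by rewrite mulr_ge0// sqr_ge0.
have aL : a * L <= 1 / 4.
  rewrite /a exprMn exprVn sqr_sqrtr; last by rewrite !mulr_ge0// ?ltW// ltr_wpDl.
  have L1 : 0 < L + 1 by rewrite ltr_wpDl.
  have -> : 2 * ((8 * (L + 1) * (N%:R ^+ 2 + 1))^-1 * N%:R ^+ 2) * L =
     1 / 4 * ((L / (L + 1)) * (N%:R ^+ 2 / (N%:R ^+ 2 + 1))).
    by field; rewrite !gt_eqF.
  rewrite ger_pMr// mulr_ile1 ?divr_ge0 ?sqr_ge0 ?(ltW n0) ?(ltW L1)//.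
    by rewrite ler_pdivrMr// mul1r lerDl.
  by rewrite ler_pdivrMr// mul1r lerDl.
pose c := mass 1 r; have c0 : 0 < c by exact: mass_gt0.
have [K K0 hK] := L2_inner_bump_lip oO bO 0 bD OD r0.
pose V := fine (mu Omega); have V0 : 0 <= V by exact: fine_ge0.
(* The mesh [d] with [d ^+ 2 = q^-1] makes the error of replacing a point by a net point at most a
   quarter of [I]. Together with [a * L * I] this is at most half of [I], which is absorbed and
   doubles the constants. *)
pose q : R := 16 * c ^- 2 * V * K ^+ 2 + 1.
have q0 : 0 < q by rewrite ltr_wpDl// !mulr_ge0 ?invr_ge0 ?sqr_ge0.
have d0 : 0 < (Num.sqrt q)^-1 by rewrite invr_gt0 sqrtr_gt0.
have [s sD_ hs] := net _ d0; set d := (Num.sqrt q)^-1 in d0 hs.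
have dq : d ^+ 2 = q^-1 by rewrite exprVn sqr_sqrtr// ltW.
have b0 : 0 <= 8 * c ^- 2 * V by rewrite !mulr_ge0 ?invr_ge0 ?sqr_ge0.
exists (2 * a), (8 * c ^- 2 * V), r, s; split => //; first by rewrite mulr_ge0.
move=> f tf; pose F x := ip f (bump 1 x r).
have Lf := tL2 tf; set I := ip f f; have I0 : 0 <= I by exact: (sip_ge0 sI).
have [LcF h1] := average_dirichlet 0 tf r0; rewrite -/F -/c in LcF h1.
set S := \sum_(y <- s) _.
have S0 : 0 <= S by apply: sumr_ge0 => y _; exact: sqr_ge0.
have Lcf : L2 Omega (c *: f) by exact: (sipZ sI).
have FE : F = c *: f - (c *: f - F) by rewrite opprB addrC subrK.
have LF : L2 Omega F by rewrite FE; exact: (sipB sI).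
have F2 x : Omega x -> F x ^+ 2 <= 2 * S + 2 * K ^+ 2 * d ^+ 2 * I.
  move=> Ox; have [y ys xy] := hs x Ox.
  have h : `|F x - F y| <= K * nrm f * d.
    apply: le_trans (hK f Lf x y (OD x Ox) (sD_ y ys)) _.
    by apply: ler_wpM2l => //; rewrite mulr_ge0// sqrtr_ge0.
  have {}h : (F x - F y) ^+ 2 <= K ^+ 2 * d ^+ 2 * I.
    have -> : K ^+ 2 * d ^+ 2 * I = (K * nrm f * d) ^+ 2.
      by rewrite /I -(snorm_sq sI Lf); ring.
    rewrite -real_normK ?num_real// ler_pXn2r ?nnegrE//.
    by rewrite !mulr_ge0 ?sqrtr_ge0 ?(ltW d0).
  have h' : F y ^+ 2 <= S.
    rewrite /S (big_rem y ys)/= lerDl; apply: sumr_ge0 => z _; exact: sqr_ge0.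
  (* This is the inequality [F x ^+ 2 <= 2 * F y ^+ 2 + 2 * (F x - F y) ^+ 2]. *)
  have := sqr_ge0 (F x - 2 * F y).
  by move: h h'; generalize (F x) (F y) => p1 p2; nra.
have FF : ip F F <= V * (2 * S + 2 * K ^+ 2 * d ^+ 2 * I).
  have B0 : 0 <= 2 * S + 2 * K ^+ 2 * d ^+ 2 * I.
      have -> : 2 * K ^+ 2 * d ^+ 2 * I = 2 * ((K * d) ^+ 2 * I) by ring.
    by apply: addr_ge0; apply: mulr_ge0; rewrite // mulr_ge0// sqr_ge0.
  rewrite mulrC -[X in X * V](sqr_sqrtr B0); apply: L2_inner_le_sup => // x Ox.
  by rewrite -sqrtr_sqr ler_wsqrtr// F2.
have h2 : c ^+ 2 * I <= 2 * ip (c *: f - F) (c *: f - F) + 2 * ip F F.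
  have -> : c ^+ 2 * I = ip (c *: f - F + F) (c *: f - F + F).
    by rewrite subrK (sipZl sI)// (sipZr sI)// mulrA.
  exact: (sip_sqD_le sI).
have D0 : 0 <= dir f f by apply: (sip_ge0 sD); exact: tH.
have h3 : I <= a * dir f f + 4 * c ^- 2 * V * S + 4 * c ^- 2 * V * K ^+ 2 * d ^+ 2 * I.
  rewrite -(ler_pM2l (exprn_gt0 2 c0)).
  apply: le_trans h2 _.
  have -> : c ^+ 2 * (a * dir f f + 4 * c ^- 2 * V * S + 4 * c ^- 2 * V * K ^+ 2 * d ^+ 2 * I)
    = 2 * ((c * r * N%:R) ^+ 2 * dir f f) + 2 * (V * (2 * S + 2 * K ^+ 2 * d ^+ 2 * I)).
    by rewrite /a; field; rewrite gt_eqF.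
  by apply: lerD; rewrite ler_pM2l.
have h4 : 4 * c ^- 2 * V * K ^+ 2 * d ^+ 2 * I <= 1 / 4 * I.
  apply: ler_wpM2r => //; rewrite dq ler_pdivrMr// /q; nra.
have h5 : a * L * I <= 1 / 4 * I by rewrite ler_wpM2r.
by move: h3 h4 h5; lra.
Qed.
End defect.

(** * Existence by minimisation *)

Section row_sequences.
Context {R : realType}.

Lemma bounded_subseq n (v : nat -> 'rV[R]_n) (M : R) : (forall k, `|v k| <= M) ->
  exists p (s : nat -> nat), forall k, (k <= s k)%N /\ `|v (s k) - p| <= k.+1%:R^-1.
Proof.
move=> vM; pose D := [set x : 'rV[R]_n | `|x| <= M].
have : compact D.
  apply: bounded_closed_compact.
    exists M; split; first exact: num_real.
    by move=> t ht x /= /le_trans; apply; exact: ltW.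
  have -> : D = (fun x => `|x|) @^-1` [set t | t <= M] by [].
  by apply: closed_comp; [move=> y _; exact: norm_continuous|exact: closed_le].
move=> /(_ (v @ \oo) _)[|p [_ clp]].
  by exists 0%N => // k _; exact: vM.
suff /choice[s hs] : forall k : nat, exists m : nat, (k <= m)%N /\ `|v m - (p : 'rV[R]_n)| <= k.+1%:R^-1.
  by exists p, s.
move=> k.
have h1 : (v @ \oo) (v @` [set m | (k <= m)%N]).
  by exists k => // m /= km; exists m.
have h2 : nbhs (p : 'rV[R]_n) (ball (p : 'rV[R]_n) k.+1%:R^-1).
  by apply: nbhsx_ballx; rewrite invr_gt0.
have [y [[m km <-]]] := clp _ _ h1 h2.
rewrite -ball_normE /= distrC => /ltW pm; by exists m.
Qed.

(** The first-order condition at the minimum [t = 0]. *)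
Lemma linear_part_eq0 (a c : R) : (forall t, 0 <= t ^+ 2 * a + 2 * t * c) -> c = 0.
Proof.
move=> h; have a0 : 0 <= a by have := h 1; have := h (-1); lra.
have a1 : 0 < a + 1 by rewrite ltr_wpDl.
(* The denominator [a + 1] replaces [a], which may be 0. *)
have := h (- c / (a + 1)).
have -> : (- c / (a + 1)) ^+ 2 * a + 2 * (- c / (a + 1)) * c =
  - (c ^+ 2 * ((a + 2) / (a + 1) ^+ 2)) by field; rewrite gt_eqF.
rewrite oppr_ge0 pmulr_lle0; last by rewrite divr_gt0 ?exprn_gt0// ltr_wpDl.
by move=> c0; apply/eqP; rewrite -sqrf_eq0 eq_le c0 sqr_ge0.
Qed.

Lemma harmonic_le (e : R) : 0 < e -> exists n0, forall n, (n0 <= n)%N -> n.+1%:R^-1 <= e.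
Proof.
move=> e0; have /cvgr0_norm_le/(_ e e0)[n0 _ h] := @cvg_harmonic R.
exists n0 => n nn0; by have := h n nn0; rewrite /harmonic /= ger0_norm ?invr_ge0.
Qed.

Lemma cvg_harmonic_le (u : nat -> R) (C : R) : (forall n, 0 <= u n <= C * n.+1%:R^-1) ->
  u @ \oo --> 0.
Proof.
move=> h; apply: (@cvg0_le _ _ (fun n => C * n.+1%:R^-1)) => //.
by apply: cvg0Zl; exact: (@cvg_harmonic R).
Qed.

End row_sequences.

(** * The first eigenfunction *)

Section variational.
Context {R : realType} {N : nat}.
Variable Omega : set 'rV[R]_N.
Hypotheses (oO : open Omega) (bO : bounded_set Omega).
Let mu := lebesgue_rV R N.
Let mO : measurable Omega := measurable_Omega oO.
Let sI := @L2_inner_semi_inner R N Omega mO.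
Let sD := dirichlet_semi_inner oO bO.
Implicit Types (f g u v w : 'rV[R]_N -> R).
Local Notation ip := (L2_inner Omega).
Local Notation nrm := (snorm (L2_inner Omega)).
Local Notation dir := (dirichlet Omega).
Local Notation test := (test_function Omega).

Let tL2 f : test f -> L2 Omega f. Proof. exact: test_L2. Qed.
Let tH f : test f -> H10 Omega f. Proof. exact: test_H10. Qed.

Definition energy (b : R) u v : R := dir u v - b * ip u v.

Lemma L2_norm f : L2 Omega f -> L2 Omega (fun x => `|f x|) /\
  ip (fun x => `|f x|) (fun x => `|f x|) = ip f f.
Proof.
move=> Lf; split; last first.
  by apply: eq_Rintegral => x _; rewrite -expr2 real_normK ?num_real// expr2.
apply: (L2_dom mO _ (L2_sq_integrable mO Lf)).
  by apply: measurableT_comp => //; case: Lf.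
by move=> x _; rewrite real_normK ?num_real.
Qed.

Lemma test_norm f (e : R) : 0 < e -> test f -> exists g : 'rV[R]_N -> R,
  [/\ test g, forall x, 0 <= g x, nrm (g - (fun x => `|f x|)) <= e & dir g g <= dir f f].
Proof.
move=> e0 tf; pose V := fine (mu Omega); have V0 : 0 <= V by exact: fine_ge0.
have q0 : 0 < Num.sqrt V + 1 by rewrite ltr_wpDl// sqrtr_ge0.
have d0 : 0 < e / (Num.sqrt V + 1) by rewrite divr_gt0.
have [g [tg g0 gf dg]] := test_sabs oO bO d0 tf; exists g; split => //.
have Lgf : L2 Omega (g - (fun x => `|f x|)).
  by apply: (sipB sI); [exact: tL2|exact: (L2_norm (tL2 tf)).1].
rewrite -(@ler_pXn2r _ 2)// ?nnegrE ?sqrtr_ge0 ?(ltW e0)// (snorm_sq sI Lgf).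
apply: le_trans (L2_inner_le_sup oO bO Lgf (fun x _ => gf x)) _.
rewrite -/V exprMn -mulrA ler_piMr ?sqr_ge0// exprVn mulrC ler_pdivrMr ?exprn_gt0// mul1r.
by rewrite -{1}[V]sqr_sqrtr// ler_pXn2r ?nnegrE ?sqrtr_ge0 ?(ltW q0)// lerDl.
Qed.

(** Pairing with the negative part [w] of [u]: the limit of [ip (g n) w] is nonnegative, yet it
    equals [- ip w w]. *)
Lemma L2_lim_ge0 (g : nat -> 'rV[R]_N -> R) u : (forall n, L2 Omega (g n)) ->
  L2 Omega u -> (forall n x, 0 <= g n x) -> ip (g n - u) (g n - u) @[n --> \oo] --> 0 ->
  ae_le Omega (cst 0) u.
Proof.
move=> Lg Lu g0 cu; pose w : 'rV[R]_N -> R := fun x => Num.max 0 (- u x).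
have w0 x : 0 <= w x by rewrite /w le_max lexx.
have uw x : u x * w x = - (w x * w x).
  rewrite /w; case: (leP 0 (- u x)) => h; first by rewrite mulrNN; ring.
  by rewrite !mulr0 oppr0.
have Lw : L2 Omega w.
  apply: (L2_dom mO _ (L2_sq_integrable mO Lu)).
    apply: measurable_maxr; first exact: measurable_cst.
    by case: (sipN sI Lu).
  move=> x _; rewrite /w; case: (leP 0 (- u x)) => h; first by rewrite sqrrN.
  by rewrite expr0n sqr_ge0.
have c := sip_cvg sI Lg Lu Lw cu.
have h : 0 <= ip u w.
  rewrite -(cvg_lim _ c)//; apply: limr_ge; first by apply/cvg_ex; eexists; exact: c.
  by apply: nearW => n; apply: Rintegral_ge0 => x _; rewrite mulr_ge0.
have Lw0 : L2 Omega (0 : 'rV[R]_N -> R) by apply: tL2; exact: test0.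
have ww : ip w w = 0.
  have E : ip u w = - ip w w.
    rewrite -mulN1r -(sipZl sI)//; apply: eq_Rintegral => x _.
    by rewrite uw -[RHS]/(-1 * w x * w x) mulN1r mulNr.
  by apply/eqP; rewrite eq_le (sip_ge0 sI)// andbT -oppr_ge0 -E.
have := L2_inner_eq0 mO Lw Lw0; rewrite subr0 => /(_ ww).
apply: filterS => x hx Ox; have := hx Ox; rewrite /w -[(0 : _ -> R) x]/(0 : R) => {}hx.
by rewrite -[cst 0 x]/(0 : R) -oppr_le0 -hx le_max lexx orbT.
Qed.

Hypotheses (nO : Omega !=set0) (hN : (1 <= N)%N).
Local Notation lam1 := (lam1 Omega).

(** The endpoint [b = lam1] matters: there, Cauchy-Schwarz turns vanishing energy directly into the
    eigenvalue equation. *)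
Lemma energy_semi_inner b : 0 <= b <= lam1 -> semi_inner (H10 Omega) (energy b).
Proof.
move=> /andP[b0 bl]; have HL u : H10 Omega u -> L2 Omega u by exact: H10_L2.
split.
- exact: (sipD sD).
- exact: (sipZ sD).
- by move=> u v Hu Hv; rewrite /energy (sipC sD)// (sipC sI)//; exact: HL.
- move=> u v w Hu Hv Hw; rewrite /energy (sipDl sD)// (sipDl sI)//; try exact: HL.
  by rewrite mulrDr opprD addrACA.
- move=> a u w Hu Hw; rewrite /energy (sipZl sD)// (sipZl sI)//; try exact: HL.
  by rewrite mulrBr mulrCA.
- move=> u Hu; rewrite subr_ge0; apply: le_trans (lam1_le_H10 oO bO nO Hu).
  by rewrite ler_wpM2r// (sip_ge0 sI)//; exact: HL.
Qed.

(** Normalised almost-minimisers are replaced by smoothed absolute values. This does not raise the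
    Dirichlet energy and moves the L2 norm by at most [n.+1%:R^-1], whence norms only close to 1. *)
Lemma minimizing_sequence : exists f : nat -> 'rV[R]_N -> R,
  [/\ forall n, test (f n), forall n x, 0 <= f n x,
      forall n, energy lam1 (f n) (f n) <= (1 + 2 * lam1) * n.+1%:R^-1 &
      forall n, `|nrm (f n) - 1| <= n.+1%:R^-1].
Proof.
suff h n : exists f : 'rV[R]_N -> R,
    [/\ test f, forall x, 0 <= f x, energy lam1 f f <= (1 + 2 * lam1) * n.+1%:R^-1 &
      `|nrm f - 1| <= n.+1%:R^-1].
  by have /choice[f hf] := h; exists f; split=> n; have [] := hf n.
have e0 : 0 < (n.+1%:R : R)^-1 by rewrite invr_gt0.
have e1 : (n.+1%:R : R)^-1 <= 1 by rewrite invf_le1// ler1n.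
set e := _^-1 in e0 e1 *.
have [g [tg g1 dg]] := lam1_adherent oO bO nO e0.
have [f [tf f0 fg df]] := test_norm e0 tg; exists f.
have [La aE] := L2_norm (tL2 tg); set a := (fun x => `|g x|) in La aE fg.
have Lf := tL2 tf; have Lfa : L2 Omega (f - a) by exact: (sipB sI).
have na : nrm a = 1 by rewrite /snorm aE g1 sqrtr1.
have h1 : nrm f <= 1 + e.
  have -> : f = a + (f - a) by rewrite addrC subrK.
  by apply: le_trans (snormD sI La Lfa) _; rewrite na lerD2l.
have h2 : 1 - e <= nrm f.
  rewrite lerBlDr -na; have {1}-> : a = f + (- 1) *: (f - a).
    by rewrite scaleN1r opprB addrC subrK.
  apply: le_trans (snormD sI Lf (sipZ sI _ Lfa)) _.
  by rewrite (snormZ sI)// normrN1 mul1r lerD2l.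
split; [exact: tf|exact: f0| |]; last first.
  by rewrite ler_distl h2.
have l0 := lam1_gt0 oO bO nO hN.
have h3 : (1 - e) ^+ 2 <= ip f f.
  by rewrite -(snorm_sq sI Lf) ler_pXn2r ?nnegrE ?sqrtr_ge0 ?subr_ge0.
have h4 : lam1 * (1 - e) ^+ 2 <= lam1 * ip f f by rewrite ler_pM2l.
have h5 : 0 <= lam1 * e ^+ 2 by rewrite mulr_ge0 ?sqr_ge0 ?ltW.
rewrite /energy lerBlDr; apply: (le_trans df); apply: (le_trans (ltW dg)).
apply: (@le_trans _ _ ((1 + 2 * lam1) * e + lam1 * (1 - e) ^+ 2)); last first.
  by rewrite lerD2l.
rewrite -subr_ge0; suff -> : (1 + 2 * lam1) * e + lam1 * (1 - e) ^+ 2 - (lam1 + e) = lam1 * e ^+ 2 by [].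
by move: lam1 => l; ring.
Qed.

(** Differences of almost-minimisers have small [energy lam1], because this form is nonnegative. By
    [defect] they are small in L2 as soon as finitely many averages converge, which holds along a
    subsequence. *)
Lemma first_eigenfunction_weak : exists u, [/\ H10 Omega u, ae_le Omega (cst 0) u,
  ip u u = 1 & forall v, H10 Omega v -> dir u v = lam1 * ip u v].
Proof.
have l0 := lam1_gt0 oO bO nO hN.
have sE : semi_inner (H10 Omega) (energy lam1) by apply: energy_semi_inner; rewrite lexx ltW.
have [f [tf f0 Ef nf]] := minimizing_sequence.
have [C [C' [r [s [C0 C'0 r0 hdef]]]]] := defect oO bO (ltW l0).
pose psi (k : 'I_(size s)) : 'rV[R]_N -> R := bump 1 (tnth (in_tuple s) k) r.
have Lpsi k : L2 Omega (psi k) by exact: bump_L2.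
pose v n : 'rV[R]_(size s) := \row_k ip (f n) (psi k).
have nf2 n : nrm (f n) <= 2.
  have := nf n; rewrite ler_norml => /andP[_].
  have e1 : (n.+1%:R : R)^-1 <= 1 by rewrite invf_le1// ler1n.
  by rewrite lerBlDr => /le_trans; apply; exact: lerD.
have [|p [t ht]] := @bounded_subseq _ _ v (\sum_k 2 * nrm (psi k)).
  have P0 k : 0 <= 2 * nrm (psi k) by rewrite mulr_ge0// sqrtr_ge0.
  move=> n; apply: norm_le_coord => [|k]; first by apply: sumr_ge0 => k _.
  rewrite mxE (bigD1 k)//=; apply: (@le_trans _ _ (2 * nrm (psi k))).
    apply: le_trans (sip_le_snorm sI (tL2 (tf n)) (Lpsi k)) _.
    by apply: ler_wpM2r; [exact: sqrtr_ge0|exact: nf2].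
  by rewrite lerDl; apply: sumr_ge0 => j _.
pose g j := f (t j); have tg j : test (g j) by exact: tf.
have Hg j := tH (tg j); have Lg j := tL2 (tg j).
have te j : ((t j).+1%:R : R)^-1 <= j.+1%:R^-1.
  by rewrite lef_pV2 ?posrE// ler_nat ltnS; have [] := ht j.
pose K := 1 + 2 * lam1; have K0 : 0 <= K by rewrite addr_ge0// mulr_ge0// ltW.
have Eg j : energy lam1 (g j) (g j) <= K * j.+1%:R^-1.
  by apply: le_trans (Ef _) _; rewrite ler_wpM2l.
have psig m n k : `|ip (g m - g n) (psi k)| <= m.+1%:R^-1 + n.+1%:R^-1.
  have -> : ip (g m - g n) (psi k) = (v (t m) - p) 0 k - (v (t n) - p) 0 k.
    by rewrite (sipBl sI)// !mxE opprB addrA subrK.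
  apply: le_trans (ler_normB _ _) _; apply: lerD; apply: le_trans (coord_le_norm _ _) _.
    by have [] := ht m.
  by have [] := ht n.
have [|u [Hu cI cD]] := H10_lim oO bO tg.
  (* The squared H^1 norm of a difference is [(1 + lam1) * I + (D - lam1 * I)]; if harmonic errors
     are at most [a <= 1], then [defect] and the energy bound give at most [Q * a]. *)
  move=> e e0; pose Q := (1 + lam1) * (4 * C * K + 4 * C' * (size s)%:R) + 4 * K.
  have Q0 : 0 <= Q.
    apply: addr_ge0; last exact: mulr_ge0.
    by apply: mulr_ge0; [rewrite addr_ge0// ltW|rewrite addr_ge0// !mulr_ge0].
  have Q1 : 0 < Q + 1 by rewrite ltr_wpDl.
  have eta0 : 0 < Num.min 1 (e / (Q + 1)) by rewrite lt_min ltr01 divr_gt0.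
  set a := Num.min _ _ in eta0.
  have a1 : a <= 1 by rewrite ge_min lexx.
  have Qa : Q * a <= e.
    have : a <= e / (Q + 1) by rewrite ge_min lexx orbT.
    rewrite ler_pdivlMr// mulrC => /(le_trans _); apply.
    by rewrite ler_wpM2r ?lerDl// ltW.
  have [n0 hn0] := harmonic_le eta0; exists n0 => m n /hn0 ma /hn0 na.
  clearbody a; have tmn : test (g m - g n) by exact: testB.
  have h1 : energy lam1 (g m - g n) (g m - g n) <= 4 * K * a.
    have := sip_sqD_le sE (Hg m) (sipN sE (Hg n)).
    rewrite (sipNr sE) ?(sipNl sE)//; last exact: (sipN sE).
    rewrite opprK => /le_trans; apply.
    have -> : 4 * K * a = 2 * (K * a) + 2 * (K * a) by ring.
    apply: lerD; rewrite ler_pM2l//; apply: le_trans (Eg _) _; exact: ler_wpM2l.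
  have h2 : \sum_(y <- s) ip (g m - g n) (bump 1 y r) ^+ 2 <= 4 * (size s)%:R * a.
    rewrite big_tnth; apply: (@le_trans _ _ (\sum_(k < size s) 4 * a)).
      apply: ler_sum => k _; rewrite -real_normK ?num_real//.
      apply: (@le_trans _ _ ((2 * a) ^+ 2)).
        rewrite ler_pXn2r ?nnegrE ?mulr_ge0 ?(ltW eta0)//.
        by apply: le_trans (psig m n k) _; rewrite mulr_natl mulr2n lerD.
      rewrite exprMn expr2 -natrM ler_pM2l// expr2.
      by rewrite ler_piMr// ltW.
    by rewrite sumr_const card_ord -[leLHS]mulr_natr mulrAC.
  have h3 := hdef _ tmn.
  apply: le_trans Qa; set I := ip _ _ in h3 *; set D := dir _ _ in h3 *.
  have {}h1 : D - lam1 * I <= 4 * K * a by [].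
  have h4 : I <= C * (4 * K * a) + C' * (4 * (size s)%:R * a).
    by apply: le_trans h3 _; apply: lerD; exact: ler_wpM2l.
  have h5 : (1 + lam1) * I <= (1 + lam1) * (C * (4 * K * a) + C' * (4 * (size s)%:R * a)).
    by apply: ler_wpM2l h4; rewrite addr_ge0// ltW.
  have -> : Q * a = (1 + lam1) * (C * (4 * K * a) + C' * (4 * (size s)%:R * a)) + 4 * K * a.
    by rewrite /Q; ring.
  apply: le_trans (lerD h5 h1).
  by rewrite mulrDl mul1r addrACA subrr addr0.
have Lu := H10_L2 Hu.
have cII := sip_cvg_sq sI Lg Lu cI; have cDD := sip_cvg_sq sD Hg Hu cD.
have g1 : ip (g n) (g n) @[n --> \oo] --> (1 : R).
  apply: (@cvg_ext _ _ (fun n => nrm (g n) * nrm (g n))).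
    by move=> n; rewrite -expr2 (snorm_sq sI).
  rewrite -[X in _ --> X]mulr1.
  have c : nrm (g n) @[n --> \oo] --> (1 : R).
    apply/subr_cvg0; apply/cvgrPdist_le => e /harmonic_le[n0 hn0]; exists n0 => // n /hn0 ne.
    by rewrite sub0r normrN (le_trans (nf _))// (le_trans (te n)).
  exact: (cvgM c c).
have u1 : ip u u = 1 by exact: cvgR_unique cII g1.
have Eu : energy lam1 u u = 0.
  have c : energy lam1 (g n) (g n) @[n --> \oo] --> energy lam1 u u.
    by apply: cvgB => //; apply: cvgM => //; exact: cvg_cst.
  apply: (cvgR_unique c); apply: (@cvg_harmonic_le _ _ K) => n.
  by rewrite Eg (sip_ge0 sE).
exists u; split => //; first by apply: (L2_lim_ge0 Lg Lu _ cI) => n x; exact: f0.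
(* Since [u] has zero energy, Cauchy-Schwarz makes it orthogonal to all of [H10] for this form. *)
move=> w Hw; apply/eqP; rewrite -subr_eq0 -/(energy lam1 u w).
by rewrite -sqrf_eq0 eq_le sqr_ge0 andbT (le_trans (sip_CS sE Hu Hw))// Eu mul0r.
Qed.

End variational.

(** * The equation with a coefficient below the first eigenvalue *)

Section resolvent.
Context {R : realType} {N : nat}.
Variable Omega : set 'rV[R]_N.
Hypotheses (oO : open Omega) (bO : bounded_set Omega).
Let mO : measurable Omega := measurable_Omega oO.
Let sI := @L2_inner_semi_inner R N Omega mO.
Let sD := dirichlet_semi_inner oO bO.
Implicit Types (f u v w : 'rV[R]_N -> R).
Local Notation ip := (L2_inner Omega).
Local Notation nrm := (snorm (L2_inner Omega)).
Local Notation dir := (dirichlet Omega).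
Local Notation test := (test_function Omega).

Let tL2 f : test f -> L2 Omega f. Proof. exact: test_L2. Qed.
Let tH f : test f -> H10 Omega f. Proof. exact: test_H10. Qed.

Hypotheses (nO : Omega !=set0) (hN : (1 <= N)%N).
Local Notation lam1 := (lam1 Omega).
Local Notation energy := (energy Omega).

Section minimization.
Variables (b : R) (h : 'rV[R]_N -> R).
Hypotheses (b0 : 0 <= b) (bl : b < lam1) (Lh : L2 Omega h) (h0 : forall x, 0 <= h x).

Let gam := lam1 - b.
Let gam0 : 0 < gam. Proof. by rewrite subr_gt0. Qed.

Let sE : semi_inner (H10 Omega) (energy b).
Proof. by apply: (energy_semi_inner oO bO) => //; rewrite b0 ltW. Qed.

Let coercive v : test v -> gam * ip v v <= energy b v v.
Proof.
by move=> tv; rewrite mulrBl lerD2r; exact: (lam1_le oO bO).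
Qed.

Let E v := energy b v v - 2 * ip h v.

Let values : set R := [set E v | v in test].

Let values_has_inf : has_inf values.
Proof.
split; first by exists (E 0), 0 => //; exact: test0.
exists (- (ip h h / gam)) => _ [v tv <-].
have Lv := tL2 tv; have := coercive tv.
(* Completing the square, with [|gam v - h|^2 >= 0], bounds the functional [E] from below by
   [- ip h h / gam]. *)
have := sip_ge0 sI (sipB sI (sipZ sI gam Lv) Lh).
rewrite (sip_sqB sI)//; last exact: (sipZ sI).
rewrite !(sipZl sI) ?(sipZr sI)//; last exact: (sipZ sI).
rewrite (sipC sI Lv Lh) /E; move: (ip v v) (ip h v) (ip h h) (energy b v v) => p q s t h1 h2.
have : 0 <= (gam * (gam * p) - 2 * (gam * q) + s) / gam by rewrite divr_ge0// ltW.
have -> : (gam * (gam * p) - 2 * (gam * q) + s) / gam = gam * p - 2 * q + s / gam.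
  by field; rewrite gt_eqF.
by move: h2; set A := gam * p; set B := s / gam; lra.
Qed.

Let m := inf values.

Let m_le v : test v -> m <= E v.
Proof.
by move=> tv; apply: inf_lbound; [case: values_has_inf|exists v].
Qed.

(** As [h] is nonnegative, replacing [v] by its absolute value does not raise [E]; the smoothing
    costs at most [Q * d], and [d] is taken so that this is at most [e]. *)
Let minimizer n : exists v, [/\ test v, forall x, 0 <= v x & E v <= m + 2 * n.+1%:R^-1].
Proof.
have e0 : 0 < (n.+1%:R : R)^-1 by rewrite invr_gt0.
set e := _^-1 in e0 *; have [_ [v tv <-] Ev] := inf_adherent e0 values_has_inf.
have Lv := tL2 tv.
have n0 f : 0 <= nrm f by exact: sqrtr_ge0.
have Q0 : 0 <= 2 * b * nrm v + 2 * nrm h by rewrite addr_ge0// !mulr_ge0.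
set Q := 2 * b * _ + _ in Q0; have Q1 : 0 < Q + 1 by rewrite ltr_wpDl.
have d0 : 0 < e / (Q + 1) by rewrite divr_gt0.
have [w [tw w0 wv dw]] := test_norm oO bO d0 tv; exists w; split => //.
set d := e / _ in d0 wv; have Qd : Q * d <= e.
  by rewrite mulrCA ler_piMr ?(ltW e0)// ler_pdivrMr// mul1r lerDl.
have Lw := tL2 tw; have [La aE] := L2_norm oO Lv.
set a : 'rV[R]_N -> R := (fun x => _) in La aE wv.
have na : nrm a = nrm v by rewrite /snorm aE.
have Ld : L2 Omega (w - a) by exact: (sipB sI).
have h1 : ip v v - 2 * (nrm v * d) <= ip w w.
  have -> : ip w w = ip a a + 2 * ip a (w - a) + ip (w - a) (w - a).
    by rewrite -(sip_sqD sI)// addrC subrK.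
  rewrite aE -addrA lerD2l; apply: (@le_trans _ _ (2 * ip a (w - a))); last first.
    by rewrite lerDl (sip_ge0 sI).
  rewrite -mulrN ler_pM2l//.
  have := sip_le_snorm sI La Ld; rewrite ler_norml => /andP[+ _]; apply: le_trans.
  by rewrite lerN2 na ler_wpM2l.
have h2 : ip h v - nrm h * d <= ip h w.
  have -> : ip h w = ip h a + ip h (w - a).
    by rewrite -(sipDr sI)// addrC subrK.
  apply: lerD.
    apply: le_Rintegral => //; [exact: (L2M_integrable mO)|exact: (L2M_integrable mO)|].
    by move=> x _; rewrite ler_wpM2l// ler_norm.
  have := sip_le_snorm sI Lh Ld; rewrite ler_norml => /andP[+ _]; apply: le_trans.
  by rewrite lerN2 ler_wpM2l.
have h3 : b * (ip v v - 2 * (nrm v * d)) <= b * ip w w by rewrite ler_wpM2l.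
have h4 : E w <= E v + Q * d.
  move: dw h2 h3; rewrite /E /energy /Q.
  move: (ip v v) (ip w w) (ip h v) (ip h w) (nrm v) (nrm h) (dir v v) (dir w w).
  move=> vv ww hv hw nv nh dv dw H1 H2 H3.
  by move: H1 H2 H3; lra.
apply: le_trans h4 _.
have := lerD (ltW Ev) Qd; rewrite -/m => /le_trans; apply.
by rewrite -addrA lerD2l -mulr2n mulr_natl.
Qed.

Lemma resolvent_weak : exists u, [/\ H10 Omega u, ae_le Omega (cst 0) u &
  forall v, H10 Omega v -> energy b u v = ip h v].
Proof.
have /choice[v hv] := minimizer.
have tv n : test (v n) by case: (hv n).
have Ev n : E (v n) <= m + 2 * n.+1%:R^-1 by case: (hv n).
have Hv n := tH (tv n); have Lv n := tL2 (tv n).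
have diffE k l : energy b (v k - v l) (v k - v l) <= 4 * k.+1%:R^-1 + 4 * l.+1%:R^-1.
  (* Comparing with the midpoint, the parallelogram identity bounds the energy of [v k - v l] by the
     defects from the infimum. *)
  have tw : test (2^-1 *: (v k + v l)) by apply: testZ; exact: testD.
  have := m_le tw; rewrite /E.
  have Hs : H10 Omega (v k + v l) by exact: (sipD sD).
  have Ls : L2 Omega (v k + v l) by exact: (sipD sI).
  rewrite (sipZl sE) ?(sipZr sE) ?(sipZr sI)//; last exact: (sipZ sE).
  rewrite (sip_parallelogram sE)// (sipDr sI)//.
  have := Ev k; have := Ev l; rewrite /E.
  move: (energy b (v k) (v k)) (energy b (v l) (v l)) (energy b (v k + v l) (v k + v l)).
  move: (ip h (v k)) (ip h (v l)) (k.+1%:R^-1) (l.+1%:R^-1) m => p q ek el mm s t w.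
  by lra.
have [|u [Hu cI cD]] := H10_lim oO bO tv.
  move=> e e0; pose Q := (1 + b) * (8 / gam) + 8.
  have Q0 : 0 < Q by rewrite ltr_wpDl// mulr_ge0 ?addr_ge0// divr_ge0// ltW.
  have [n0 hn0] := harmonic_le (divr_gt0 e0 Q0); exists n0 => k l /hn0 ke /hn0 le.
  have tkl : test (v k - v l) by exact: testB.
  have h1 : energy b (v k - v l) (v k - v l) <= 8 * (e / Q).
    apply: le_trans (diffE k l) _; move: ke le; set a := e / Q.
    by move: (k.+1%:R^-1) (l.+1%:R^-1) => ek el; lra.
  have h2 := le_trans (coercive tkl) h1; move: h1; rewrite /energy => h1.
  have {}h2 : ip (v k - v l) (v k - v l) <= 8 * (e / Q) / gam.
    by rewrite ler_pdivlMr// mulrC.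
  have h3 : (1 + b) * ip (v k - v l) (v k - v l) <= (1 + b) * (8 * (e / Q) / gam).
    by apply: ler_wpM2l h2; rewrite addr_ge0.
  have -> : e = (1 + b) * (8 * (e / Q) / gam) + 8 * (e / Q).
    have -> : (1 + b) * (8 * (e / Q) / gam) + 8 * (e / Q) = e / Q * Q by rewrite /Q; ring.
    by rewrite divfK// gt_eqF.
  apply: le_trans (lerD h3 h1).
  by rewrite mulrDl mul1r addrACA subrr addr0.
have Lu := H10_L2 Hu.
exists u; split => //.
  by apply: (L2_lim_ge0 oO bO Lv Lu _ cI) => n x; case: (hv n).
have tests w : test w -> energy b u w = ip h w.
  move=> tw; apply/eqP; rewrite -subr_eq0; apply/eqP.
  have Hw := tH tw; have Lw := tL2 tw.
  have cE : energy b (v n) w @[n --> \oo] --> energy b u w.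
    apply: cvgB; first exact: (sip_cvg sD Hv Hu Hw cD).
    by apply: cvgM; [exact: cvg_cst|exact: (sip_cvg sI Lv Lu Lw cI)].
  (* The first variation: comparing [E (v n)] with [E (v n + t *: w)] and letting [n] grow leaves a
     nonnegative quadratic in [t] with the desired equation as linear part. *)
  apply: (@linear_part_eq0 _ (energy b w w)) => t.
  have c : 2 * n.+1%:R^-1 + (t ^+ 2 * energy b w w + 2 * t * (energy b (v n) w - ip h w))
      @[n --> \oo] --> t ^+ 2 * energy b w w + 2 * t * (energy b u w - ip h w).
    rewrite -[X in _ --> X]add0r; apply: cvgD.
      by apply: cvg0Zl; exact: (@cvg_harmonic R).
    apply: cvgD; first exact: cvg_cst.
    apply: cvgM; first exact: cvg_cst.
    by apply: cvgB => //; exact: cvg_cst.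
  rewrite -(cvg_lim _ c)//; apply: limr_ge; first by apply/cvg_ex; eexists; exact: c.
  apply: nearW => n.
  have ts : test (v n + t *: w) by apply: testD => //; exact: testZ.
  have Htw : H10 Omega (t *: w) by exact: (sipZ sD).
  have Ltw : L2 Omega (t *: w) by exact: (sipZ sI).
  have := m_le ts; have := Ev n; rewrite /E.
  rewrite (sip_sqD sE)// (sipDr sI)// !(sipZr sE) ?(sipZl sE) ?(sipZr sI)//.
  move: (energy b (v n) (v n)) (energy b (v n) w) (energy b w w) (ip h (v n)) (ip h w).
  move: (n.+1%:R^-1) m => e mm p q s x y.
  by rewrite expr2 -!mulrA; lra.
move=> w Hw; have [phi [tphi p1 p2]] := H10_approx oO bO Hw.
have Hp n := tH (tphi n); have Lp n := tL2 (tphi n); have Lw := H10_L2 Hw.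
have c1 : ip (phi n) h @[n --> \oo] --> ip w h := sip_cvg sI Lp Lw Lh p1.
have c2 : energy b (phi n) u @[n --> \oo] --> energy b w u.
  apply: cvgB; first exact: (sip_cvg sD Hp Hw Hu p2).
  by apply: cvgM; [exact: cvg_cst|exact: (sip_cvg sI Lp Lw Lu p1)].
rewrite (sipC sE)// (sipC sI)//; apply: (cvgR_unique c2); apply: cvg_ext c1 => n.
by rewrite (sipC sE)// tests// (sipC sI).
Qed.

End minimization.
End resolvent.

(** * Interior regularity *)

Section kernel.
Context {R : realType} {N : nat}.
Implicit Types (x y : 'rV[R]_N) (m : nat) (r : R).

Lemma is_derive_expV n (r : R) : r != 0 ->
  is_derive r (1 : R) (fun r => r ^- n) (- (n%:R * r ^- n.+1)).
Proof.
move=> r0; have rn0 : (id ^+ n : R -> R) r != 0 by rewrite fctE expf_neq0.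
have := is_deriveV rn0 (is_deriveX n (is_derive_id r 1)).
rewrite fctE; move=> h; apply: is_derive_eq h _.
rewrite /= -[LHS]/(- (r ^+ n) ^- 2 * ((n%:R * r ^+ n.-1) * 1)) mulr1 mulNr; congr (- _).
case: n rn0 => [|n] _; first by rewrite !mul0r mulr0.
by rewrite /= !exprS; field; rewrite r0 expf_neq0.
Qed.

(** The factor [r ^- N] is the normalisation that keeps the total mass independent of [r]; see
    [mass_scale]. *)
Definition kernel m x r y : R := r ^- N * bump m x r y.

(* The derivative of [kernel m.+1 x r y] with respect to [r] is [r] times a
   Laplacian in [y]. *)
Definition dkernel m x r y : R := r * (r ^- N * laplacian (bump m.+2 x r) y).

Lemma is_derive_kernel m x y r : 0 < r ->
  is_derive r (1 : R) (fun r => kernel m.+1 x r y) (dkernel m x r y).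
Proof.
move=> r0; have rn0 : r != 0 by rewrite gt_eqF.
have d2 := is_derive_expV 2 rn0.
have d3 : is_derive r (1 : R) (fun r => 1 - sqdist x y / r ^+ 2) (2 * sqdist x y * r ^- 3).
  have := is_deriveB (is_derive_cst (1 : R) r 1) (is_deriveZ (sqdist x y) d2).
  move=> h; apply: is_derive_eq h _.
  by rewrite -[LHS]/(0 - sqdist x y * (- (2 * r ^- 3))) sub0r mulrN opprK mulrA [_ * 2]mulrC.
have d4 := @is_derive1_comp R (profile m.+1) (fun r => 1 - sqdist x y / r ^+ 2) r _ _
  (is_derive_profile m (1 - sqdist x y / r ^+ 2)) d3.
have := is_deriveM (is_derive_expV N rn0) d4.
move=> h; apply: is_derive_eq h _.
rewrite /dkernel laplacian_bump /bump -/(profile _ _).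
set P := profile m.+1 _; set p := profile m _.
rewrite -[LHS]/(r ^- N * (2^-1 * p * (2 * sqdist x y * r ^- 3)) + P * (- (N%:R * r ^- N.+1))).
rewrite [r ^+ N.+1]exprS; have : r ^+ N != 0 by rewrite expf_neq0.
move: (r ^+ N) (N%:R : R) (sqdist x y) => W n s W0; field; by rewrite rn0.
Qed.

Lemma kernel_bounded m : exists2 C : R, 0 < C & forall x r y, 0 < r ->
  `|kernel m x r y| <= C * r ^- N.
Proof.
have [C C0 hC] := @profile_bounded R m; exists C => // x r y r0.
have rN : 0 < r ^- N by rewrite invr_gt0 exprn_gt0.
rewrite /kernel normrM (gtr0_norm rN) mulrC ler_pM2r//; apply: hC.
by rewrite gerBl divr_ge0 ?sqdist_ge0// sqr_ge0.
Qed.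

Lemma dkernel_bounded m : exists2 C : R, 0 < C & forall x r y, 0 < r ->
  `|dkernel m x r y| <= C * r ^- N.+1.
Proof.
have [C C0 hC] := @profile_bounded R m; have [D D0 hD] := @profile_bounded R m.+1.
exists (N%:R * D + C); first by rewrite ltr_wpDl// mulr_ge0// ltW.
move=> x r y r0; have rN : 0 < r ^- N by rewrite invr_gt0 exprn_gt0.
have arg1 : 1 - sqdist x y / r ^+ 2 <= 1 by rewrite gerBl divr_ge0 ?sqdist_ge0// sqr_ge0.
have -> : dkernel m x r y = r ^- N.+1 *
    (- (N%:R * bump m.+1 x r y) + sqdist x y / r ^+ 2 * bump m x r y).
  rewrite /dkernel laplacian_bump [r ^+ N.+1]exprS.
  have rn0 : r != 0 by rewrite gt_eqF.
  have : r ^+ N != 0 by rewrite expf_neq0.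
  move: (r ^+ N) (N%:R : R) (sqdist x y) (bump m.+1 x r y) (bump m x r y).
  by move=> W n s P p W0; field; rewrite rn0.
have rN1 : 0 < r ^- N.+1 by rewrite invr_gt0 exprn_gt0.
rewrite normrM (gtr0_norm rN1) mulrC ler_pM2r//.
apply: le_trans (ler_normD _ _) _; apply: lerD.
  by rewrite normrN normrM ger0_norm// ler_wpM2l//; exact: hD.
have s0 : 0 <= sqdist x y / r ^+ 2 by rewrite divr_ge0 ?sqdist_ge0// sqr_ge0.
rewrite normrM (ger0_norm s0).
have [h|h] := leP (r ^+ 2) (sqdist x y).
  by rewrite bump_out// normr0 mulr0 ltW.
rewrite -[C]mul1r; apply: ler_pM => //; last exact: hC.
by rewrite ler_pdivrMr ?exprn_gt0// mul1r ltW.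
Qed.

Lemma kernel_measurable m x r : measurable_fun setT (kernel m x r).
Proof. by apply: measurable_funM => //; exact: bump_measurable. Qed.

Lemma is_derive_integral_kernel (U : set 'rV[R]_N) v m x r : measurable U ->
  (lebesgue_rV R N).-integrable U (EFin \o v) -> 0 < r ->
  is_derive r (1 : R) (fun r => \int[lebesgue_rV R N]_(y in U) (v y * kernel m.+1 x r y))
    (\int[lebesgue_rV R N]_(y in U) (v y * dkernel m x r y)).
Proof.
move=> mU iv r0; pose f r y := v y * kernel m.+1 x r y.
have dker (s : R) y : 0 < s -> is_derive s (1 : R) (f ^~ y) (v y * dkernel m x s y).
  by move=> s0; have := is_deriveZ (v y) (is_derive_kernel m x y s0).
have pos (s : R) : `]r / 2, r * 2[%classic s -> 0 < s.
  by rewrite /= in_itv/= => /andP[h _]; apply: lt_trans h; rewrite divr_gt0.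
have Ir : `]r / 2, r * 2[%classic r.
  by rewrite /= in_itv/= ltr_pdivrMr// !ltr_pMr// ltr1n.
have intf (s : R) : `]r / 2, r * 2[%classic s -> (lebesgue_rV R N).-integrable U (EFin \o f s).
  move=> /pos s0; have [C C0 hC] := kernel_bounded m.+1.
  have : (lebesgue_rV R N).-integrable U (EFin \o (fun y => C * s ^- N * `|v y|)).
    exact: (integrableZl mU (C * s ^- N) (integrable_abse iv)).
  apply: le_integrable => //.
    apply/measurable_EFinP; apply: measurable_funM.
      by apply/measurable_EFinP; case/integrableP: iv.
    by apply: measurable_funTS; exact: kernel_measurable.
  move=> y _; have h := hC x s y s0.
  have CN : 0 <= C * s ^- N by apply: le_trans h.
  rewrite /= lee_fin /f [in leLHS]normrM [in leRHS]normrM normr_id (ger0_norm CN).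
  by rewrite mulrC ler_wpM2r.
have derf (s : R) y : `]r / 2, r * 2[%classic s -> U y -> derivable (f ^~ y) s 1.
  by move=> /pos s0 _; have [] := dker s y s0.
have dE (s : R) y : 0 < s -> partial1of2 f s y = v y * dkernel m x s y.
  by move=> s0; rewrite partial1of2E; have [_ ->] := dker s y s0.
have [D D0 hD] := dkernel_bounded m.
pose G y := D * (r / 2) ^- N.+1 * `|v y|.
have r20 : 0 < r / 2 by rewrite divr_gt0.
have G0 y : 0 <= G y by rewrite !mulr_ge0 ?invr_ge0 ?exprn_ge0 ?(ltW D0) ?(ltW r20).
have iG : (lebesgue_rV R N).-integrable U (EFin \o G).
  exact: (integrableZl mU (D * (r / 2) ^- N.+1) (integrable_abse iv)).
have Gub (s : R) y : `]r / 2, r * 2[%classic s -> U y -> `|partial1of2 f s y| <= G y.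
  move=> /[dup] /pos s0 Is _; rewrite dE// normrM mulrC /G ler_wpM2r//.
  apply: le_trans (hD x s y s0) _; rewrite ler_pM2l//.
  rewrite lef_pV2 ?posrE ?exprn_gt0// ler_pXn2r ?nnegrE ?(ltW r20) ?(ltW s0)//.
  by move: Is; rewrite /= in_itv/= => /andP[/ltW].
have h1 := derivable_under_integral mU Ir intf derf G0 iG Gub.
have h2 := differentiation_under_integral mU Ir intf derf G0 iG Gub.
apply: DeriveDef; first exact: h1.
rewrite -derive1E; rewrite h2.
by apply: eq_Rintegral => y _; rewrite dE.
Qed.

End kernel.

Section real_estimates.
Context {R : realType}.

Lemma derive_bound (f df : R -> R) (a b C : R) : a <= b ->
  (forall s, a <= s <= b -> is_derive s (1 : R) f (df s)) ->
  (forall s, a <= s <= b -> `|df s| <= C) -> `|f b - f a| <= C * (b - a).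
Proof.
move=> ab fd dC; have inn s : s \in `]a, b[ -> a <= s <= b.
  by rewrite in_itv/= => /andP[/ltW -> /ltW].
have [||c] := @MVT_segment _ f df a b ab.
- by move=> s /inn; exact: fd.
- apply: derivable_within_continuous => s; rewrite in_itv/= => /fd[] //.
rewrite in_itv/= => cab ->; rewrite normrM [`|b - a|]ger0_norm ?subr_ge0//.
by rewrite ler_wpM2r ?subr_ge0// dC.
Qed.

Lemma cvg_of_dist (a t : nat -> R) n0 : t @ \oo --> 0 ->
  (forall k l, (n0 <= k)%N -> (k <= l)%N -> `|a k - a l| <= t k) ->
  exists2 L, a @ \oo --> L & forall k, (n0 <= k)%N -> `|a k - L| <= t k.
Proof.
move=> ct h; have /cvg_ex[L aL] : cvgn a.
  apply/cauchy_cvgP/cauchy_exP => e e0.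
  have /cvgrPdist_lt/(_ e e0)[m _ hm] := ct; pose k := maxn m n0.
  exists (a k); exists k => // l /= kl; rewrite /ball/=.
  apply: le_lt_trans (h k l (leq_maxr _ _) kl) _.
  have := hm k (leq_maxl _ _); rewrite sub0r normrN; apply: le_lt_trans.
  exact: ler_norm.
exists L => // k nk; have c : `|a k - a l| @[l --> \oo] --> `|a k - L|.
  by apply: cvg_norm; apply: cvgB => //; exact: cvg_cst.
rewrite -(cvg_lim _ c)//; apply: limr_le; first by apply/cvg_ex; eexists; exact: c.
by exists k => // l /= kl; exact: h.
Qed.

End real_estimates.

Section kernel_mass.
Context {R : realType} {N : nat}.
Implicit Types (x y : 'rV[R]_N) (m : nat).
Let mu := lebesgue_rV R N.

Lemma integral_laplacian (U : set 'rV[R]_N) f : open U -> bounded_set U ->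
  test_function U f -> \int[mu]_(y in U) laplacian f y = 0.
Proof.
move=> oU bU tf; have mU := measurable_Omega oU.
have -> : laplacian f = \sum_i partial i (partial i f).
  by apply/funext => x; rewrite fct_sumE.
have tpp i : test_function U (partial i (partial i f)) by do 2!apply: test_partial.
have int g : test_function U g -> mu.-integrable U (EFin \o g).
  by move=> /(test_integrableT oU bU); exact: integrableS.
suff E (s : seq 'I_N) : test_function U (\sum_(i <- s) partial i (partial i f)) /\
    \int[mu]_(y in U) (\sum_(i <- s) partial i (partial i f)) y = 0 by exact: (E _).2.
elim: s => [|i s [IH1 IH2]].
  rewrite big_nil; split; first exact: test0.
  by rewrite (_ : (fun y => _) = cst 0)// Rintegral_cst// mul0r.
rewrite big_cons; split; first exact: testD.
rewrite RintegralD//; [|exact: int|exact: int].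
by rewrite IH2 addr0; apply: integral_partial => //; exact: test_partial.
Qed.

(** In place of a change of variables: the [r]-derivative of the integral of [kernel] is a multiple
    of the integral of the Laplacian of a test function, which is 0. *)
Lemma mass_scale m (r : R) : 0 < r <= 1 -> r ^- N * @mass R N m.+1 r = @mass R N m.+1 1.
Proof.
move=> /andP[r0 r1]; pose U := [set y : 'rV[R]_N | `|y| < 2].
have oU : open U.
  have -> : U = (fun y => `|y|) @^-1` [set t | t < 2] by [].
  by apply: open_comp; [move=> y _; exact: norm_continuous|exact: open_lt].
have bU : bounded_set U.
  exists 2; split; first exact: num_real.
  by move=> t ht y /= /ltW/le_trans; apply; exact: ltW.
have mU := measurable_Omega oU.
have tU n s : 0 < s -> s <= 1 -> test_function U (bump n 0 s).
  move=> s0 s1; apply: test_bump => // y ys; rewrite /U/=.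
  apply: (@le_lt_trans _ _ 1); last by rewrite ltr1n.
  apply: norm_le_coord => // i; rewrite -(@ler_pXn2r _ 2)// ?nnegrE// real_normK ?num_real//.
  have := coord_le_sqdist 0 y i; rewrite mxE subr0 => /le_trans; apply.
  apply: le_trans ys _; rewrite ler_pXn2r ?nnegrE// ltW//.
have i1 : mu.-integrable U (EFin \o (cst 1)) := integrable_cst mU 1 (Omega_fin oU bU).
pose F (s : R) := \int[mu]_(y in U) (cst 1 y * kernel m.+1 0 s y).
have FE s : 0 < s -> s <= 1 -> F s = s ^- N * @mass R N m.+1 s.
  move=> s0 s1; have ts := tU m.+1 s s0 s1.
  rewrite /F /mass -(integral_Omega (Omega := U)); last by move=> y; exact: test_out.
  rewrite -RintegralZl//; last exact: (integrableS _ _ _ (test_integrableT oU bU ts)).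
  by apply: eq_Rintegral => y _; rewrite mul1r.
have dF s : r <= s <= 1 -> is_derive s (1 : R) F ((fun=> 0) s).
  move=> /andP[rs s1]; have s0 := lt_le_trans r0 rs.
  apply: is_derive_eq (is_derive_integral_kernel m 0 mU i1 s0) _.
  have tL := test_laplacian (tU m.+2 s s0 s1).
  have -> : \int[mu]_(y in U) (cst 1 y * dkernel m 0 s y) =
      \int[mu]_(y in U) (s * s ^- N * laplacian (bump m.+2 0 s) y).
    by apply: eq_Rintegral => y _; rewrite mul1r /dkernel mulrA.
  rewrite RintegralZl//; last exact: (integrableS _ _ _ (test_integrableT oU bU tL)).
  by rewrite integral_laplacian ?mulr0//; exact: tU.
have dC s : r <= s <= 1 -> `|(fun=> 0 : R) s| <= 0 by rewrite normr0.
have := derive_bound r1 dF dC; rewrite mul0r normr_le0 subr_eq0 => /eqP; rewrite (FE 1 ltr01 (lexx 1)) (FE r r0 r1) => <-.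
by rewrite expr1n invr1 mul1r.
Qed.

Lemma integral_kernel_le (U : set 'rV[R]_N) m x (r : R) : measurable U -> 0 < r <= 1 ->
  \int[mu]_(y in U) kernel m.+1 x r y <= @mass R N m.+1 1.
Proof.
move=> mU /[dup] r01 /andP[r0 _].
have ib := bump_integrableT m.+1 x r0.
have ik : mu.-integrable setT (EFin \o kernel m.+1 x r).
  exact: (integrableZl measurableT (r ^- N) ib).
have k0 y : 0 <= kernel m.+1 x r y by rewrite mulr_ge0 ?invr_ge0 ?exprn_ge0 ?bump_ge0 ?(ltW r0).
apply: (@le_trans _ _ (\int[mu]_y kernel m.+1 x r y)).
  rewrite fine_le//.
  - by apply: integrable_fin_num => //; exact: (integrableS measurableT).
  - exact: integrable_fin_num.
  apply: ge0_subset_integral => //; first by case/integrableP: ik.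
  by move=> y _; rewrite lee_fin.
rewrite -(mass_scale m r01).
have E1 : \int[mu]_y kernel m.+1 x r y = r ^- N * \int[mu]_y bump m.+1 x r y.
  by apply: RintegralZl; [exact: measurableT|exact: ib].
have E2 : \int[mu]_y bump m.+1 x r y = @mass R N m.+1 r.
  rewrite -(Rintegral_shift x ib); apply: eq_Rintegral => y _.
  by rewrite addrC bump_shift.
rewrite E1 E2; exact: lexx.
Qed.

End kernel_mass.

(** * Averages of weak solutions as functions of the radius *)

Section regularity.
Context {R : realType} {N : nat}.
Variable Omega : set 'rV[R]_N.
Hypotheses (oO : open Omega) (bO : bounded_set Omega).
Let mu := lebesgue_rV R N.
Let mO : measurable Omega := measurable_Omega oO.
Let sI := @L2_inner_semi_inner R N Omega mO.
Let sD := dirichlet_semi_inner oO bO.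
Implicit Types (f u v w : 'rV[R]_N -> R).
Local Notation ip := (L2_inner Omega).
Local Notation dir := (dirichlet Omega).
Local Notation test := (test_function Omega).
Local Notation mass := (@mass R N).

Let tL2 f : test f -> L2 Omega f. Proof. exact: test_L2. Qed.
Let tH f : test f -> H10 Omega f. Proof. exact: test_H10. Qed.

Lemma L2_integrable f : L2 Omega f -> mu.-integrable Omega (EFin \o f).
Proof.
move=> Lf; have L1 : L2 Omega (cst 1 : 'rV[R]_N -> R).
  apply: (@L2_bounded _ _ _ mO _ 1) => //; first exact: Omega_fin.
  by move=> x _; rewrite normr1.
apply: (eq_integrable mO _ _ _ (L2M_integrable mO Lf L1)).
by move=> x _ /=; rewrite mulr1.
Qed.

Lemma kernelE m x (r : R) : kernel m x r = r ^- N *: bump m x r :> ('rV[R]_N -> R).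
Proof. by []. Qed.

Lemma kernel_L2 m x (r : R) : 0 < r -> L2 Omega (kernel m x r).
Proof. by move=> r0; rewrite kernelE; apply: (sipZ sI); exact: bump_L2. Qed.

Lemma L2_inner_kernel m v x (r : R) : 0 < r -> L2 Omega v ->
  ip v (kernel m x r) = r ^- N * ip v (bump m x r).
Proof. by move=> r0 Lv; exact: (sipZr sI _ (bump_L2 oO bO m x r0) Lv). Qed.

(** Extends [average_dirichlet] from test functions by density, the averaging operator [T] being
    bounded on L2. *)
Lemma average_H10 m u (r : R) : H10 Omega u -> 0 < r ->
  let F x := ip u (bump m.+1 x r) in
  L2 Omega (mass m.+1 r *: u - F) /\
  ip (mass m.+1 r *: u - F) (mass m.+1 r *: u - F) <= (mass m.+1 r * r * N%:R) ^+ 2 * dir u u.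
Proof.
move=> Hu r0 F; have Lu := H10_L2 Hu.
pose T (w : 'rV[R]_N -> R) : 'rV[R]_N -> R := fun x => ip w (bump m.+1 x r).
have [b b0 hb] := bump_bounded m.+1 (0 : 'rV[R]_N) r0.
pose V := fine (mu Omega); have V0 : 0 <= V by exact: fine_ge0.
have mT w : L2 Omega w -> measurable_fun Omega (T w).
  move=> Lw; apply: measurable_funTS; apply: continuous_measurable_rV.
  by move=> x; exact: (L2_inner_bump_continuous oO bO Lw r0).
have Tb w x : L2 Omega w -> T w x ^+ 2 <= ip w w * (b ^+ 2 * V).
  move=> Lw; apply: le_trans (sip_CS sI Lw (bump_L2 oO bO m.+1 x r0)) _.
  apply: ler_wpM2l; first exact: (sip_ge0 sI).
  apply: (L2_inner_le_sup oO bO (bump_L2 oO bO m.+1 x r0)) => y _.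
  by rewrite -[y](subrK x) addrC bump_shift.
have LT w : L2 Omega w -> L2 Omega (T w).
  move=> Lw; apply: (@L2_bounded _ _ _ mO _ (Num.sqrt (ip w w * (b ^+ 2 * V)))).
  - exact: Omega_fin.
  - exact: mT.
  by move=> x _; rewrite -sqrtr_sqr ler_wsqrtr// Tb.
have TT w : L2 Omega w -> ip (T w) (T w) <= ip w w * (b ^+ 2 * V) * V.
  move=> Lw; have q0 : 0 <= ip w w * (b ^+ 2 * V).
    by apply: mulr_ge0; [exact: (sip_ge0 sI)|rewrite mulr_ge0// sqr_ge0].
  rewrite -[X in X * V](sqr_sqrtr q0); apply: (L2_inner_le_sup oO bO (LT w Lw)) => x _.
  by rewrite -sqrtr_sqr ler_wsqrtr// Tb.
have TB w w' : L2 Omega w -> L2 Omega w' -> T (w - w') = T w - T w'.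
  by move=> Lw Lw'; apply/funext => x; rewrite /T (sipBl sI)//; exact: bump_L2.
have LF := LT u Lu; rewrite -/(T u) in LF *; have -> : F = T u by [].
set c := mass m.+1 r; have Lcu : L2 Omega (c *: u - T u) by apply: (sipB sI) => //; exact: (sipZ sI).
split => //.
have [phi [tphi p1 p2]] := H10_approx oO bO Hu.
have Lp n := tL2 (tphi n); have Hp n := tH (tphi n).
have Lcp n : L2 Omega (c *: phi n - T (phi n)).
  by apply: (sipB sI); [exact: (sipZ sI)|exact: LT].
have c1 : ip (c *: phi n - T (phi n) - (c *: u - T u)) (c *: phi n - T (phi n) - (c *: u - T u))
    @[n --> \oo] --> 0.
  apply: (@cvg0_le _ _ (fun n => (2 * c ^+ 2 + 2 * (b ^+ 2 * V * V)) * ip (phi n - u) (phi n - u))).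
    move=> n; have Lpu : L2 Omega (phi n - u) by exact: (sipB sI).
    have -> : c *: phi n - T (phi n) - (c *: u - T u) = c *: (phi n - u) + (- 1) *: T (phi n - u).
      by rewrite TB// scalerBr scaleN1r !opprD addrACA.
    have L1 : L2 Omega (c *: (phi n - u)) by exact: (sipZ sI).
    have L2' : L2 Omega (T (phi n - u)) by exact: LT.
    have L2'' : L2 Omega (- 1 *: T (phi n - u)) by exact: (sipZ sI).
    rewrite (sip_ge0 sI) ?(le_trans (sip_sqD_le sI L1 L2''))//; last exact: (sipD sI).
    rewrite !(sipZl sI)// !(sipZr sI)// [leRHS]mulrDl.
    have := TT _ Lpu; set P := ip (phi n - u) _; set Q := ip (T _) _ => h.
    have -> : 2 * (c * (c * P)) = 2 * c ^+ 2 * P by ring.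
    rewrite lerD2l; have -> : 2 * (-1 * (-1 * Q)) = 2 * Q by ring.
    have -> : 2 * (b ^+ 2 * V * V) * P = 2 * (P * (b ^+ 2 * V) * V) by ring.
    by rewrite ler_pM2l.
  exact: cvg0Zl.
have c2 := sip_cvg_sq sI Lcp Lcu c1.
have c3 : (c * r * N%:R) ^+ 2 * dir (phi n) (phi n) @[n --> \oo] --> (c * r * N%:R) ^+ 2 * dir u u.
  by apply: cvgM; [exact: cvg_cst|exact: (sip_cvg_sq sD Hp Hu p2)].
rewrite -(cvg_lim _ c2)// -(cvg_lim _ c3)//; apply: ler_lim.
- by apply/cvg_ex; eexists; exact: c2.
- by apply/cvg_ex; eexists; exact: c3.
apply: nearW => n; exact: (average_dirichlet oO bO m (tphi n) r0).2.
Qed.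

Section equation.
Variables (u h : 'rV[R]_N -> R) (lam H : R).
Hypotheses (Hu : H10 Omega u) (Lh : L2 Omega h) (hH : forall x, `|h x| <= H).
Hypothesis eqn : forall phi, test phi -> dir u phi = lam * ip u phi + ip h phi.

Let Lu : L2 Omega u. Proof. exact: H10_L2. Qed.

Let H0 : 0 <= H. Proof. exact: le_trans (hH 0). Qed.

Let A m x (r : R) := ip u (kernel m.+1 x r).

(** This is the [r]-derivative of [A m]: [dkernel] is [r] times a Laplacian, which the equation
    trades for [lam * u + h]. The index goes up by one, which is why [bounded] quantifies over all
    [m]. *)
Let dA m x (r : R) := - (r * (lam * A m.+1 x r + ip h (kernel m.+2 x r))).

Variable rho : R.
Hypotheses (rho0 : 0 < rho) (rho1 : rho <= 1).

Let inside x := forall y, sqdist x y <= rho ^+ 2 -> Omega y.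

Let is_derive_A m x (r : R) : inside x -> 0 < r <= rho ->
  is_derive r (1 : R) (A m x) (dA m x r).
Proof.
move=> xrho /andP[r0 rrho].
have tb : test (bump m.+2 x r).
  apply: test_bump => // y yr; apply: xrho; apply: le_trans yr _.
  by rewrite ler_pXn2r ?nnegrE ?(ltW r0)// (le_trans (ltW r0)).
apply: is_derive_eq (is_derive_integral_kernel m x mO (L2_integrable Lu) r0) _.
have tL := test_laplacian tb.
have -> : \int[mu]_(y in Omega) (u y * dkernel m x r y) =
    ip u ((r * r ^- N) *: laplacian (bump m.+2 x r)).
  by apply: eq_Rintegral => y _; congr (_ * _); rewrite /dkernel mulrA.
have LL := tL2 tL; rewrite (sipZr sI _ LL Lu).
have -> : ip u (laplacian (bump m.+2 x r)) = - dir u (bump m.+2 x r).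
  by rewrite (dirichlet_test oO bO Hu tb) opprK.
rewrite (eqn tb) /dA /A (L2_inner_kernel m.+2 x r0 Lu) (L2_inner_kernel m.+2 x r0 Lh).
move: (ip u (bump m.+2 x r)) (ip h (bump m.+2 x r)) => p q; ring.
Qed.

Let h_bound m x (r : R) : 0 < r <= 1 -> `|ip h (kernel m.+1 x r)| <= H * mass m.+1 1.
Proof.
move=> /[dup] r01 /andP[r0 _].
have k0 y : 0 <= kernel m.+1 x r y by rewrite mulr_ge0 ?invr_ge0 ?exprn_ge0 ?bump_ge0 ?(ltW r0).
have Lk := kernel_L2 m.+1 x r0; have ihk := L2M_integrable mO Lh Lk.
apply: le_trans (le_normr_Rintegral mO ihk) _.
apply: le_trans (ler_wpM2l H0 (integral_kernel_le m x mO r01)).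
rewrite -RintegralZl//; last exact: L2_integrable.
apply: le_Rintegral => //.
- exact: (integrable_abse ihk).
- exact: (integrableZl mO H (L2_integrable Lk)).
by move=> y _; rewrite normrM (ger0_norm (k0 y)) ler_wpM2r.
Qed.

Let bounded n := forall m, exists2 C : R, 0 <= C &
  forall x r, inside x -> 0 < r <= rho -> `|A m x r| <= C * r ^- n.

Let bounded_N : bounded N.
Proof.
move=> m; have [C C0 hC] := @kernel_bounded R N m.+1.
have ia := integrable_abse (L2_integrable Lu).
have I0 : 0 <= \int[mu]_(y in Omega) `|u y| by apply: Rintegral_ge0.
exists (C * \int[mu]_(y in Omega) `|u y|); first by rewrite mulr_ge0// ltW.
move=> x r _ /andP[r0 rrho].
have Lk := kernel_L2 m.+1 x r0; have iuk := L2M_integrable mO Lu Lk.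
apply: le_trans (le_normr_Rintegral mO iuk) _.
rewrite mulrAC -RintegralZl//; apply: le_Rintegral => //.
- exact: (integrable_abse iuk).
- exact: (integrableZl mO (C * r ^- N) ia).
by move=> y _; rewrite normrM mulrC ler_wpM2r// hC.
Qed.

Let dA_bound n m : bounded n -> exists2 C : R, 0 <= C &
  forall x r, inside x -> 0 < r <= rho -> `|dA m x r| <= C * (r * r ^- n).
Proof.
move=> /(_ m.+1)[C C0 hC]; exists (`|lam| * C + H * mass m.+2 1).
  by rewrite addr_ge0 ?mulr_ge0// ltW// mass_gt0.
move=> x r xr /[dup] rr /andP[r0 rrho].
rewrite /dA normrN normrM (gtr0_norm r0) mulrCA ler_pM2l// mulrDl.
apply: le_trans (ler_normD _ _) _; apply: lerD.
  by rewrite normrM -mulrA ler_wpM2l// hC.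
have r1 : r <= 1 := le_trans rrho rho1.
apply: le_trans (h_bound m.+1 x _) _; first by rewrite r0.
rewrite ler_peMr ?mulr_ge0//; first by rewrite ltW// mass_gt0.
by rewrite invf_ge1 ?exprn_gt0// exprn_ile1// ltW.
Qed.

Let dist_A n m : bounded n -> exists2 C : R, 0 <= C &
  forall x r s, inside x -> 0 < r -> r <= s <= rho ->
    `|A m x s - A m x r| <= C * r ^- n.-1 * (s - r).
Proof.
move=> /(dA_bound m)[C C0 hC]; exists C => // x r s xi r0 /andP[rs srho].
apply: (@derive_bound _ _ (dA m x)) => // t /andP[rt ts].
  by apply: is_derive_A => //; rewrite (lt_le_trans r0 rt) (le_trans ts).
have t0 := lt_le_trans r0 rt.
apply: le_trans (hC x t xi _) _; first by rewrite t0 (le_trans ts).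
(* For [n = 0] the exponent [n.-1] is also 0, and the factor [t] is bounded by 1. *)
apply: ler_wpM2l => //; case: n hC => [|n] hC.
  by rewrite /= !expr0 !invr1 mulr1 (le_trans ts)// (le_trans srho).
rewrite exprS invfM mulrA divff ?gt_eqF// mul1r lef_pV2 ?posrE ?exprn_gt0//.
by apply: lerXn2r; rewrite ?nnegrE ?(ltW r0) ?(ltW t0).
Qed.

(* The derivative of [A m] is [r] times averages of the same kind, hence
   integrating it gains one power of [r]. *)
Let bounded_pred n : bounded n.+1 -> bounded n.
Proof.
move=> /[dup] bn + m => /(_ m)[C C0 hC]; have [D D0 hD] := dist_A m bn.
exists (C * rho ^- n.+1 + D); first by rewrite addr_ge0// mulr_ge0// invr_ge0 exprn_ge0// ltW.
move=> x r xi /[dup] rr /andP[r0 rrho].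
have rn : 1 <= r ^- n by rewrite invf_ge1 ?exprn_gt0// exprn_ile1 ?(ltW r0)// (le_trans rrho).
have -> : A m x r = A m x rho - (A m x rho - A m x r) by rewrite subKr.
apply: le_trans (ler_normB _ _) _; rewrite mulrDl; apply: lerD.
  apply: le_trans (hC x rho xi _) _; first by rewrite rho0 lexx.
  by rewrite ler_peMr// mulr_ge0// invr_ge0 exprn_ge0// ltW.
apply: le_trans (hD x r rho xi r0 _) _; first by rewrite rrho lexx.
rewrite ler_piMr//; first by rewrite mulr_ge0// (le_trans ler01).
by rewrite lerBlDr (le_trans rho1)// lerDl ltW.
Qed.

(** The size of the kernel gives a bound of order [r ^- N]; [N] steps of [bounded_pred] bring the
    order down to 0, and then the derivative in [r] is bounded. *)
Lemma average_lipschitz : exists2 C : R, 0 <= C &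
  forall x r s, (forall y, sqdist x y <= rho ^+ 2 -> Omega y) -> 0 < r -> r <= s <= rho ->
    `|ip u (kernel 1 x s) - ip u (kernel 1 x r)| <= C * (s - r).
Proof.
have b0 : bounded 0.
  suff E n : bounded (N - n)%N by have := E N; rewrite subnn.
  elim: n => [|n IH]; first by rewrite subn0; exact: bounded_N.
  have [nN|Nn] := ltnP n N; last first.
    by move: IH; rewrite (eqP (Nn : (N - n == 0)%N)) subnS (eqP (Nn : (N - n == 0)%N)).
  by apply: bounded_pred; rewrite -subSn// subSS.
have [C C0 hC] := dist_A 0 b0; exists C => // x r s xi r0 rs.
by have := hC x r s xi r0 rs; rewrite /= expr0 invr1 mulr1.
Qed.

End equation.
End regularity.

(** * The continuous representative *)

Section representative.
Context {R : realType} {N : nat}.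
Variable Omega : set 'rV[R]_N.
Hypotheses (oO : open Omega) (bO : bounded_set Omega).
Let mu := lebesgue_rV R N.
Let mO : measurable Omega := measurable_Omega oO.
Let sI := @L2_inner_semi_inner R N Omega mO.
Let sD := dirichlet_semi_inner oO bO.
Implicit Types (g u v w : 'rV[R]_N -> R).
Local Notation ip := (L2_inner Omega).
Local Notation dir := (dirichlet Omega).
Local Notation test := (test_function Omega).
Local Notation mass := (@mass R N).

Let le_thirds (p q : R) : p <= q / 3 -> p + q / 3 + p <= q.
Proof. by lra. Qed.

(** One radius serves all points near [x0], which makes the convergence of the averages locally
    uniform. *)
Lemma sqdist_near x0 (r : R) : open Omega -> Omega x0 ->
  exists2 rho : R, 0 < rho <= 1 &
    \forall x \near x0, forall y, sqdist x y <= rho ^+ 2 -> Omega y.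
Proof.
move=> _ Ox0; have [d d0 hd] := open_sqdist_ball oO Ox0.
have E (p q s w : R) : p <= q / 4 -> s <= p -> w < q / 4 -> 2 * w + 2 * s <= q by lra.
pose rho := Num.min 1 (d / 2).
have rho0 : 0 < rho by rewrite lt_min ltr01 divr_gt0.
exists rho; first by rewrite rho0 ge_min lexx.
have h : sqdist x0 x @[x --> (x0 : 'rV[R]_N)] --> 0.
  by rewrite -(sqdistxx x0); apply: (smooth_continuous (smooth_sqdist x0)).
have rd : rho ^+ 2 <= d ^+ 2 / 4.
  have -> : d ^+ 2 / 4 = (d / 2) ^+ 2 by field.
  by rewrite ler_pXn2r ?nnegrE ?(ltW rho0) ?divr_ge0 ?(ltW d0)// ge_min lexx orbT.
have d4 : 0 < d ^+ 2 / 4 by rewrite divr_gt0// exprn_gt0.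
have := h _ (lt_nbhsl d4); apply: (@filterS _ (nbhs (x0 : 'rV[R]_N)) _) => x /= x0x y xy; apply: hd.
apply: (@le_trans _ _ (2 * sqdist x0 x + 2 * sqdist x y)).
  rewrite /sqdist !mulr_sumr -big_split/=; apply: ler_sum => j _.
  have := sqr_ge0 ((x ord0 j - x0 ord0 j) - (y ord0 j - x ord0 j)).
  by move: (x ord0 j) (x0 ord0 j) (y ord0 j) => p q s; nra.
exact: E rd xy x0x.
Qed.

Variables (u h : 'rV[R]_N -> R) (lam H : R).
Hypotheses (Hu : H10 Omega u) (Lh : L2 Omega h) (hH : forall x, `|h x| <= H).
Hypothesis eqn : forall phi, test phi -> dir u phi = lam * ip u phi + ip h phi.

Let Lu : L2 Omega u. Proof. exact: H10_L2. Qed.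

(** Averages at radius [t k] are within a multiple of [t k] of [c *: u] in L2, so a weight [2 ^+ k]
    still leaves geometric bounds. *)
Let t (k : nat) : R := 4 ^- k.

Let t0 k : 0 < t k. Proof. by rewrite invr_gt0 exprn_gt0. Qed.

Let t1 k : t k <= 1. Proof. by rewrite invf_le1 ?exprn_gt0// exprn_ege1// ler1n. Qed.

Let t_anti k l : (k <= l)%N -> t l <= t k.
Proof. by move=> kl; rewrite lef_pV2 ?posrE ?exprn_gt0// ler_weXn2l// ler1n. Qed.

Let t_cvg : t @ \oo --> 0.
Proof.
have -> : t = (fun k => 4^-1 ^+ k) by apply/funext => k; rewrite /t exprVn.
by apply: cvg_expr; rewrite ger0_norm// invf_lt1// ltr1n.
Qed.

Let a x k := ip u (kernel 1 x (t k)).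
Let c := mass 1 1.
Let c0 : 0 < c. Proof. exact: mass_gt0. Qed.
(** Defined as a limit of averages at each point of [Omega], so that the sign of [u] passes to [v]
    everywhere and not only a.e. *)
Let v x := lim (a x @ \oo) / c.

Let aE x k : a x k = t k ^- N * ip u (bump 1 x (t k)).
Proof. exact: L2_inner_kernel. Qed.

Let a_continuous k : continuous (a ^~ k).
Proof.
move=> x; have -> : a ^~ k = (fun x => t k ^- N * ip u (bump 1 x (t k))).
  by apply/funext => y; exact: aE.
apply: (@cvgM _ _ (nbhs (x : 'rV[R]_N))); first exact: cvg_cst.
exact: (L2_inner_bump_continuous oO bO Lu (t0 k)).
Qed.

Let a_cvg (rho : R) : 0 < rho <= 1 -> exists2 C, 0 <= C & exists n0, forall x,
  (forall y, sqdist x y <= rho ^+ 2 -> Omega y) ->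
  a x @ \oo --> c * v x /\ forall k, (n0 <= k)%N -> `|a x k - c * v x| <= C * t k.
Proof.
move=> /andP[rho0 rho1].
have [C C0 hC] := average_lipschitz oO bO Hu Lh hH eqn rho0 rho1.
have /cvgrPdist_le/(_ rho rho0)[n0 _ hn0] := t_cvg.
exists C => //; exists n0 => x xi.
have tC : C * t k @[k --> \oo] --> 0 by exact: cvg0Zl.
have [k l nk kl|L aL hL] := @cvg_of_dist _ (a x) (fun k => C * t k) n0 tC.
  have trho : t k <= rho.
    by have := hn0 k nk; rewrite sub0r normrN gtr0_norm.
  apply: le_trans (hC x (t l) (t k) xi (t0 l) _) _.
    by rewrite t_anti.
  by rewrite ler_wpM2l// gerBl ltW.
have -> : c * v x = L.
  by rewrite /v mulrCA divff ?gt_eqF// mulr1; exact/cvg_lim.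
by split.
Qed.

(** A locally uniform limit of the functions [a ^~ k], which are continuous because bumps are
    Lipschitz in their centre. *)
Let v_continuous x0 : Omega x0 -> {for x0, continuous v}.
Proof.
move=> Ox0; have [rho rho01 near_rho] := sqdist_near 0 oO Ox0.
have [C C0 [n0 hC]] := a_cvg rho01.
suff cv : c * v x @[x --> (x0 : 'rV[R]_N)] --> c * v x0.
  have vE : v = (fun x => c^-1 * (c * v x)).
    by apply/funext => x; rewrite mulrA mulVf ?gt_eqF// mul1r.
  rewrite /prop_for /continuous_at vE.
  apply: (@cvgM _ _ (nbhs (x0 : 'rV[R]_N))); first exact: cvg_cst.
  exact: cv.
apply/(@cvgrPdist_le _ _ _ (nbhs (x0 : 'rV[R]_N))) => e e0.
have e3 : 0 < e / 3 by rewrite divr_gt0.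
have tC : C * t k @[k --> \oo] --> 0 by exact: cvg0Zl.
have /cvgrPdist_le/(_ _ e3)[n1 _ hn1] := tC.
pose k := maxn n0 n1.
have tk : C * t k <= e / 3.
  have := hn1 k (leq_maxr _ _); rewrite sub0r normrN; apply: le_trans.
  exact: ler_norm.
have ak : \forall x \near (x0 : 'rV[R]_N), `|a x0 k - a x k| <= e / 3.
  have := @a_continuous k x0.
  by move/(@cvgrPdist_le _ _ _ (nbhs (x0 : 'rV[R]_N))) => /(_ _ e3).
have h0 : `|a x0 k - c * v x0| <= C * t k.
  by apply: (hC x0 (nbhs_singleton near_rho)).2; exact: leq_maxl.
apply: filterS2 near_rho ak => x xi axk.
have h1 : `|a x k - c * v x| <= C * t k.
  by apply: (hC x xi).2; exact: leq_maxl.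
have -> : c * v x0 - c * v x = - (a x0 k - c * v x0) + (a x0 k - a x k) + (a x k - c * v x).
  by rewrite opprB !addrA !subrK.
apply: le_trans (ler_normD _ _) _; apply: le_trans (lerD (ler_normD _ _) (lexx _)) _.
rewrite normrN; apply: le_trans (lerD (lerD h0 axk) h1) _.
exact: le_thirds tk.
Qed.

Let a_measurable k : measurable_fun setT (a ^~ k).
Proof. by apply: continuous_measurable_rV => x; exact: a_continuous. Qed.

Let cvg_a x : Omega x -> a x @ \oo --> c * v x.
Proof.
move=> Ox; have [rho rho01 near_rho] := sqdist_near 0 oO Ox.
have [C C0 [n0 hC]] := a_cvg rho01.
exact: (hC x (nbhs_singleton near_rho)).1.
Qed.

Let v_measurable : measurable_fun Omega v.
Proof.
have -> : v = (fun x => c^-1 * (c * v x)).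
  by apply/funext => x; rewrite mulrA mulVf ?gt_eqF// mul1r.
apply: measurable_funM; first exact: measurable_cst.
apply: (measurable_fun_cvg (h := fun k => a ^~ k)) => [k|x Ox].
  exact: measurable_funTS.
exact: cvg_a.
Qed.

(** The L2 rate of the averages, through [ae_bounded_of_geometric], gives convergence to [c * u x]
    at almost every [x]; the limit is [c * v x] by construction. *)
Let uv : ae_eq Omega u v.
Proof.
pose g k : 'rV[R]_N -> R := 2 ^+ k *: (c *: u - a ^~ k).
pose D := dir u u; have D0 : 0 <= D by exact: (sip_ge0 sD).
have bound k : L2 Omega (c *: u - a ^~ k) /\
    ip (c *: u - a ^~ k) (c *: u - a ^~ k) <= (c * t k * N%:R) ^+ 2 * D.
  have := average_H10 oO bO 0 Hu (t0 k); set F := (fun x => _) => -[LF hF].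
  have tN : t k ^+ N != 0 by rewrite expf_neq0// gt_eqF.
  have mE : t k ^- N * mass 1 (t k) = c by apply: mass_scale; rewrite t0 t1.
  have E : c *: u - a ^~ k = t k ^- N *: (mass 1 (t k) *: u - F).
    by rewrite scalerBr scalerA mE; congr (_ - _); apply/funext => x; exact: aE.
  rewrite E; split; first exact: (sipZ sI).
  rewrite (sipZl sI _ LF (sipZ sI _ LF)) (sipZr sI _ LF LF).
  have tN0 : 0 <= t k ^- N by rewrite invr_ge0 exprn_ge0// ltW.
  apply: le_trans (ler_wpM2l tN0 (ler_wpM2l tN0 hF)) _.
  by rewrite -mE le_eqVlt; apply/orP; left; apply/eqP; rewrite /D; move: (dir u u) => dd; ring.
have aeb := @ae_bounded_of_geometric R N Omega mO g ((c * N%:R) ^+ 2 * D).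
have {}aeb : {ae mu, forall x, Omega x -> exists C, forall k, g k x ^+ 2 <= C}.
  apply: aeb => k; have [L1 h1] := bound k.
    by have [] := sipZ sI (2 ^+ k) L1.
  rewrite (L2_innerE mO (sipZ sI (2 ^+ k) L1)) lee_fin.
  rewrite (sipZl sI _ L1 (sipZ sI _ L1)) (sipZr sI _ L1 L1).
  have p0 : 0 <= (2 : R) ^+ k by rewrite exprn_ge0.
  apply: le_trans (ler_wpM2l p0 (ler_wpM2l p0 h1)) _.
  have tE : t k = 2 ^- k * 2 ^- k.
    by rewrite /t -invfM -exprMn; congr ((_ ^+ _)^-1); rewrite -natrM.
  have p2 : (2 : R) ^+ k != 0 by rewrite expf_neq0.
  have -> : 2 ^+ k * (2 ^+ k * ((c * t k * N%:R) ^+ 2 * D)) =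
      (c * N%:R) ^+ 2 * D * (2 ^- k * 2 ^- k).
    by rewrite tE; move: (2 ^+ k) p2 => q q0; field.
  apply: ler_wpM2l; first by rewrite mulr_ge0// sqr_ge0.
  by rewrite ler_piMr ?invr_ge0// invf_le1 ?exprn_gt0// exprn_ege1// ler1n.
apply: filterS aeb => x hx Ox; have [C hC] := hx Ox.
have ca := cvg_a Ox.
have cau : a x @ \oo --> c * u x.
  apply/subr_cvg0; apply: norm_cvg0.
  apply: (@cvg0_le _ _ (fun k => Num.sqrt C * (2^-1) ^+ k)) => [k|].
    rewrite normr_ge0/= exprVn ler_pdivlMr ?exprn_gt0//.
    rewrite distrC -[2 ^+ k]ger0_norm ?exprn_ge0// -normrM -sqrtr_sqr mulrC.
    by apply: ler_wsqrtr; exact: hC.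
  apply: cvg0Zl; apply: cvg_expr.
  by rewrite ger0_norm// invf_lt1// ltr1n.
have := cvgR_unique cau ca => /mulfI; apply; by rewrite gt_eqF.
Qed.

Lemma continuous_representative : exists v, [/\ H10 Omega v,
  {in Omega, continuous v}, ae_eq Omega u v,
  forall w, H10 Omega w -> dir v w = dir u w &
  ae_le Omega (cst 0) u -> forall x, Omega x -> 0 <= v x].
Proof.
have [Hv dv] := H10_ae oO bO Hu v_measurable uv.
exists v; split => //; first by move=> x /set_mem; exact: v_continuous.
move=> u0 x Ox; rewrite -(pmulr_rge0 _ c0) -(cvg_lim _ (cvg_a Ox))//.
apply: limr_ge; first by apply/cvg_ex; eexists; exact: cvg_a.
apply: nearW => k; have [La _] := L2_norm oO Lu.
have Lk := kernel_L2 oO bO 1 x (t0 k).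
rewrite /a (L2_inner_ae mO Lu Lk La Lk); last 2 first.
- by apply: filterS u0 => y hy Oy; rewrite ger0_norm//; exact: hy.
- exact: aeW.
apply: Rintegral_ge0 => y _; rewrite mulr_ge0// mulr_ge0 ?bump_ge0//.
by rewrite invr_ge0 exprn_ge0// ltW.
Qed.

End representative.

(** * Failure of the comparison principles *)

Section comparison_tools.
Context {R : realType} {N : nat}.
Variable Omega : set 'rV[R]_N.
Hypotheses (oO : open Omega) (bO : bounded_set Omega).
Let mu := lebesgue_rV R N.
Let mO : measurable Omega := measurable_Omega oO.
Let sI := @L2_inner_semi_inner R N Omega mO.
Implicit Types (f u v w : 'rV[R]_N -> R) (i : 'I_N).
Local Notation ip := (L2_inner Omega).
Local Notation dir := (dirichlet Omega).
Local Notation test := (test_function Omega).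

Let tL2 f : test f -> L2 Omega f. Proof. exact: test_L2. Qed.
Let tH f : test f -> H10 Omega f. Proof. exact: test_H10. Qed.

Hypotheses (nO : Omega !=set0) (hN : (1 <= N)%N).
Local Notation lam1 := (lam1 Omega).

Lemma L2_cst (k : R) : L2 Omega (cst k).
Proof.
apply: (@L2_bounded _ _ _ mO _ `|k|) => //; first exact: Omega_fin.
Qed.

Lemma first_eigenfunction : exists u, [/\ H10 Omega u, {in Omega, continuous u},
  forall x, Omega x -> 0 <= u x, ip u u = 1 &
  forall v, H10 Omega v -> dir u v = lam1 * ip u v].
Proof.
have [u [Hu u0 u1 hu]] := first_eigenfunction_weak oO bO nO hN.
have L0 : L2 Omega (0 : 'rV[R]_N -> R) by apply: tL2; exact: test0.
have [||v [Hv cv uv dv v0]] := @continuous_representative R N Omega oO bO u 0 lam1 0 Hu L0.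
- by move=> x; rewrite normr0.
- move=> phi tphi; rewrite (hu _ (tH tphi)) -(scale0r (0 : 'rV[R]_N -> R)).
  by rewrite (sipZl sI _ L0 (tL2 tphi)) mul0r addr0.
have Lu := H10_L2 Hu; have Lv := H10_L2 Hv; exists v; split => //.
- exact: v0.
- by rewrite -u1; apply/esym; exact: (L2_inner_ae mO).
move=> w Hw; rewrite dv// hu//; congr (_ * _).
by apply: (L2_inner_ae mO) => //; [exact: H10_L2|exact: H10_L2|exact: aeW].
Qed.

Lemma resolvent (b H : R) h : 0 <= b -> b < lam1 -> L2 Omega h ->
  (forall x, 0 <= h x <= H) ->
  exists d, [/\ H10 Omega d, {in Omega, continuous d}, forall x, Omega x -> 0 <= d x &
    forall v, H10 Omega v -> dir d v - b * ip d v = ip h v].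
Proof.
move=> b0 bl Lh hH; have h0 x : 0 <= h x by case/andP: (hH x).
have [u [Hu u0 hu]] := resolvent_weak oO bO nO b0 bl Lh h0.
have [||v [Hv cv uv dv v0]] := @continuous_representative R N Omega oO bO u h b H Hu Lh.
- by move=> x; rewrite ger0_norm//; case/andP: (hH x).
- move=> phi tphi; have := hu phi (tH tphi); rewrite /energy => <-.
  by rewrite addrC subrK.
have Lu := H10_L2 Hu; have Lv := H10_L2 Hv; exists v; split => //; first exact: v0.
move=> w Hw; rewrite dv// -(hu w Hw) /energy; congr (_ - _ * _); apply/esym.
by apply: (L2_inner_ae mO) => //; [exact: H10_L2|exact: H10_L2|exact: aeW].
Qed.

(* A compact set is never open, unless it is empty. *)
Lemma off_support phi : test phi -> exists U : set 'rV[R]_N,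
  [/\ open U, U !=set0, U `<=` Omega & forall x, U x -> phi x = 0].
Proof.
move=> [_ [K [cK KO Kphi]]]; exists (Omega `\` K); split; last 2 first.
- by move=> x [].
- by move=> x [_]; exact: Kphi.
- apply: openI => //; rewrite openC; apply: compact_closed => //; exact: norm_hausdorff.
apply: contrapT => /set0P/negP/negPn/eqP K0.
have OK x : Omega x -> K x.
  by move=> Ox; apply: contrapT => Kx; have : (Omega `\` K) x by []; rewrite K0.
pose i := Ordinal hN; pose f (x : 'rV[R]_N) := x ord0 i.
have cf : {within K, continuous f}.
  by apply: continuous_subspaceT; apply: smooth_continuous; exact: smooth_coor.
have K1 : K !=set0 by have [x Ox] := nO; exists x; exact: OK.
have [c /set_mem Kc hc] := EVT_max_rV K1 cK cf.
have [r r0 hr] := open_sqdist_ball oO (KO _ Kc).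
(* If [K] were all of [Omega], this point, still in [Omega], would have a larger coordinate [i] than
   the maximiser [c]. *)
pose y := c + r *: delta_mx 0 i.
have Ky : K y.
  apply/OK/hr; rewrite /sqdist (bigD1 i)//= big1 ?addr0.
    by rewrite /y !mxE eqxx mulr1 addrAC subrr add0r.
  by move=> j ji; rewrite /y !mxE (negbTE ji) andbF mulr0 addr0 subrr expr0n.
have := hc y (mem_set Ky); rewrite /f /y !mxE eqxx mulr1 gerDl.
by rewrite leNgt r0.
Qed.

(** Both traces are 0, with the zero function as the [U] of [has_trace]. *)
Lemma H10_le_on_boundary u v : H10 Omega u -> H10 Omega v -> le_on_boundary Omega u v.
Proof.
have t0 : test (0 : 'rV[R]_N -> R) by exact: test0.
have H1_0 : H1 Omega (0 : 'rV[R]_N -> R).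
  have [L0 W0 _] := test_H10_gradient oO bO t0.
  by split => //; exists (fun i => partial i 0).
have tr w : H10 Omega w -> has_trace Omega w (cst 0).
  move=> Hw; exists 0; split => //.
  - by apply: continuous_subspaceT; exact: (smooth_continuous (smooth_cst 0)).
  - rewrite (_ : (fun x => _) = w)//; apply/funext => x.
    by rewrite -[RHS]subr0.
by move=> Hu Hv; exists (cst 0), (cst 0); split; [exact: tr|exact: tr|].
Qed.

Lemma L2_inner1_gt0 phi : L2 Omega phi -> ae_le Omega (cst 0) phi ->
  ~ ae_eq Omega phi (cst 0) -> 0 < ip (cst 1) phi.
Proof.
move=> Lphi phi0 nz.
have [La aE] := L2_norm oO Lphi; set a : 'rV[R]_N -> R := (fun x => `|phi x|) in La aE.
have aphi : ae_eq Omega phi a.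
  by apply: filterS phi0 => x hx Ox; rewrite /a ger0_norm//; exact: hx.
have L1 := L2_cst 1.
have -> : ip (cst 1) phi = \int[mu]_(x in Omega) a x.
  rewrite (L2_inner_ae mO L1 Lphi L1 La)//; last exact: aeW.
  by apply: eq_Rintegral => x _; rewrite mul1r.
have ia := L2_integrable oO bO La.
rewrite lt_neqAle Rintegral_ge0 ?andbT; last by move=> x _; exact: normr_ge0.
apply/eqP => i0; apply: nz.
have iE : (\int[mu]_(x in Omega) (a x)%:E = 0)%E.
  rewrite -[LHS]fineK; last exact: (integrable_fin_num mO ia).
  by rewrite -/(Rintegral _ _ _) -i0.
have mphi : measurable_fun Omega (EFin \o phi) by apply/measurable_EFinP; case: Lphi.
have := (ae_eq_integral_abs mu mO mphi).1.
move=> E; have {}E : measure_negligible.ae_eq mu Omega (EFin \o phi) (cst 0%E).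
  by apply: E; rewrite -[RHS]iE.
by apply: filterS E => x hx Ox; have [] := hx Ox.
Qed.

Lemma L2_inner1_test_gt0 phi x : test phi -> (forall y, 0 <= phi y) -> Omega x ->
  0 < phi x -> 0 < ip (cst 1) phi.
Proof.
move=> tphi phi0 Ox phix; rewrite (_ : ip _ _ = \int[mu]_(y in Omega) phi y).
  apply: (@continuous_integral_gt0 _ _ _ _ x) => //.
  - exact: test_continuous tphi x.
  - exact: (L2_integrable oO bO (tL2 tphi)).
by apply: eq_Rintegral => y _; rewrite mul1r.
Qed.

(** Takes the place of the strong maximum principle: if [V] vanished on [U], testing with a bump in
    [U] would give a positive integral equal to that of [- V] times a Laplacian supported in [U],
    which is 0. *)
Lemma torsion_gt0 V (U : set 'rV[R]_N) : H10 Omega V ->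
  (forall x, Omega x -> 0 <= V x) -> (forall v, H10 Omega v -> dir V v = ip (cst 1) v) ->
  open U -> U !=set0 -> U `<=` Omega -> exists2 p, U p & 0 < V p.
Proof.
move=> HV V0 hV oU [x Ux] UO; apply: contrapT => h.
have VU y : U y -> V y = 0.
  move=> Uy; apply: le_anti; rewrite (V0 _ (UO _ Uy)) andbT leNgt.
  by apply/negP => Vy; apply: h; exists y.
have [r r0 hr] := open_sqdist_ball oU Ux.
have tbU := test_bump 2 r0 hr.
have tb : test (bump 2 x r) by apply: test_bump => // y /hr/UO.
have := dirichlet_test oO bO HV tb; rewrite (hV _ (tH tb)).
have -> : ip V (laplacian (bump 2 x r)) = 0.
  transitivity (\int[mu]_(y in Omega) (cst 0 : _ -> R) y); last by rewrite Rintegral_cst// mul0r.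
  apply: eq_Rintegral => y _; have [/VU->|Uy] := pselect (U y); first by rewrite mul0r.
  by rewrite (test_out (test_laplacian tbU) Uy) mulr0.
move=> E; have : 0 < ip (cst 1) (bump 2 x r).
  apply: (@L2_inner1_test_gt0 _ x) => //; [by move=> y; exact: bump_ge0|exact: UO|].
  by rewrite /bump sqdistxx mul0r subr0; exact: profile_gt0.
by rewrite E oppr0 ltxx.
Qed.

End comparison_tools.

Section comparison_principles.
Context {R : realType} {N : nat}.
Variable Omega : set 'rV[R]_N.
Hypotheses (oO : open Omega) (bO : bounded_set Omega).
Let mu := lebesgue_rV R N.
Let mO : measurable Omega := measurable_Omega oO.
Let sD := dirichlet_semi_inner oO bO.
Implicit Types (f u v w : 'rV[R]_N -> R).
Local Notation ip := (L2_inner Omega).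
Local Notation dir := (dirichlet Omega).
Local Notation test := (test_function Omega).

Let tH f : test f -> H10 Omega f. Proof. exact: test_H10. Qed.

Hypotheses (nO : Omega !=set0) (hN : (1 <= N)%N).

Lemma continuous_comb (a b : R) u v : {in Omega, continuous u} ->
  {in Omega, continuous v} -> {in Omega, continuous (a *: u + b *: v)}.
Proof.
move=> cu cv x Ox.
apply: (@cvgD _ _ _ (nbhs (x : 'rV[R]_N)) _ (a *: u) (b *: v)).
  apply: (@cvgM _ _ (nbhs (x : 'rV[R]_N)) _ (cst a) u); first exact: cvg_cst.
  exact: cu.
apply: (@cvgM _ _ (nbhs (x : 'rV[R]_N)) _ (cst b) v); first exact: cvg_cst.
exact: cv.
Qed.

Lemma torsion : exists V, [/\ H10 Omega V, {in Omega, continuous V},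
  forall x, Omega x -> 0 <= V x, forall v, H10 Omega v -> dir V v = ip (cst 1) v &
  0 < dir V V].
Proof.
have l0 := lam1_gt0 oO bO nO hN.
have [|V [HV cV V0 hV]] := @resolvent R N Omega oO bO nO 0 1 (cst 1) (lexx 0) l0 (L2_cst oO bO 1).
  by move=> x; rewrite ler01 lexx.
have {}hV v : H10 Omega v -> dir V v = ip (cst 1) v.
  by move=> Hv; rewrite -(hV v Hv) mul0r subr0.
exists V; split => //.
have [x Ox] := nO; have [r r0 hr] := open_sqdist_ball oO Ox.
have tb : test (bump 0 x r) := test_bump 0 r0 hr.
have b1 : 0 < dir V (bump 0 x r).
  rewrite (hV _ (tH tb)); apply: (L2_inner1_test_gt0 oO bO tb _ Ox).
    by move=> y; exact: bump_ge0.
  by rewrite /bump sqdistxx mul0r subr0; exact: profile_gt0.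
rewrite lt_neqAle (sip_ge0 sD HV) andbT eq_sym; apply/eqP => A0.
have := sip_CS sD HV (tH tb); rewrite A0 mul0r leNgt.
by rewrite exprn_gt0.
Qed.

(** The factor [kappa] makes [V - kappa *: phi] orthogonal to [V]; the last quantity is then exactly
    the energy of this difference. *)
Lemma compact_approximation V e : H10 Omega V -> 0 < dir V V -> 0 < e ->
  exists phi kappa, [/\ test phi, kappa * dir phi V = dir V V &
    kappa ^+ 2 * dir phi phi - dir V V <= e].
Proof.
move=> HV A0 e0; have [phi [tphi _ p2]] := H10_approx oO bO HV.
have Hp n := tH (tphi n).
have cx := sip_cvg sD Hp HV HV p2.
have cy := sip_cvg_sq sD Hp HV p2.
have c : (dir V V / dir (phi n) V) ^+ 2 * dir (phi n) (phi n) - dir V V @[n --> \oo] --> 0.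
  rewrite -[X in _ --> X](subrr (dir V V)); apply: cvgB; last exact: cvg_cst.
  rewrite -[X in _ --> X]mul1r; apply: cvgM => //.
  have An0 : dir V V != 0 by rewrite gt_eqF.
  rewrite -[X in _ --> X](expr1n _ 2) -(divff An0).
  have cq : dir V V / dir (phi n) V @[n --> \oo] --> dir V V / dir V V.
    exact: (cvgM (@cvg_cst _ _ _ _ _) (cvgV An0 cx)).
  exact: (cvgM cq cq).
have /cvgrPdist_le/(_ e e0)[n0 _ h0] := c.
have [n1 _ h1] := cx _ (lt_nbhsr A0).
pose n := maxn n0 n1.
have x0 : 0 < dir (phi n) V by apply: (h1 n); exact: leq_maxr.
exists (phi n), (dir V V / dir (phi n) V); split => //.
  by rewrite divfK// gt_eqF.
have := h0 n (leq_maxl _ _); rewrite sub0r normrN; apply: le_trans.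
exact: ler_norm.
Qed.

Variable M : R -> R.
Hypothesis hM : forall t, 0 <= t -> 0 <= M t.
Variables t1 t2 : R.
Hypotheses (t1_gt0 : 0 < t1) (t12 : t1 < t2) (M12 : M t1 < M t2).

Lemma comparison_fails : connected Omega -> exists l w,
  [/\ (H10 Omega l /\ {in Omega, continuous l}) /\ (H10 Omega w /\ {in Omega, continuous w}),
      weak_lt Omega M l w, le_on_boundary Omega l w,
      exists p, Omega p /\ w p < l p & exists p, Omega p /\ l p = w p].
Proof.
move=> conO; have M1 : 0 <= M t1 by apply: hM; exact: ltW.
have M2 : 0 < M t2 := le_lt_trans M1 M12.
have [V [HV cV V0 hV A0]] := torsion.
set A := dir V V in A0.
have dl2 : 0 < (M t2 ^+ 2 * t2 - M t1 ^+ 2 * t1) / A.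
  rewrite divr_gt0// subr_gt0; apply: (@le_lt_trans _ _ (M t2 ^+ 2 * t1)).
    by rewrite ler_pM2r// ler_pXn2r ?nnegrE// ltW.
  by rewrite ltr_pM2l// exprn_gt0.
(* As [M t2 *: w] is to be [M t1 *: l + dl *: V] with [l] orthogonal to [V], energy [t2] for [w]
   means [M t2 ^+ 2 * t2 = M t1 ^+ 2 * t1 + dl ^+ 2 * A]. *)
pose dl := Num.sqrt ((M t2 ^+ 2 * t2 - M t1 ^+ 2 * t1) / A).
have dl0 : 0 < dl by rewrite sqrtr_gt0.
have dlA : dl ^+ 2 * A = M t2 ^+ 2 * t2 - M t1 ^+ 2 * t1.
  by rewrite sqr_sqrtr ?(ltW dl2)// divfK// gt_eqF.
(* If the energy [e] of [V - kap *: phi] is at most [tol], the factor [s] with [s ^+ 2 * e = t1]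
   satisfies [dl < (M t2 - M t1) * s], which is [w < l] wherever [phi] vanishes and [V] is
   positive. *)
pose tol := (M t2 - M t1) ^+ 2 * t1 / (dl ^+ 2 + 1).
have dl1 : 0 < dl ^+ 2 + 1 by rewrite ltr_wpDl// sqr_ge0.
have tol0 : 0 < tol by rewrite divr_gt0// mulr_gt0// exprn_gt0// subr_gt0.
have [phi [kap [tphi kx etol]]] := compact_approximation HV A0 tol0.
rewrite -/A in kx etol; have Hp := tH tphi.
have [U [oU U0 UO Uphi]] := off_support oO nO hN tphi.
have [p Up Vp] := torsion_gt0 oO bO HV V0 hV oU U0 UO.
have Op := UO _ Up.
have cphi : {in Omega, continuous phi} by move=> x _; exact: (test_continuous tphi).
pose e := kap ^+ 2 * dir phi phi - A.
have l0E (s : R) : dir (s *: V + (- (s * kap)) *: phi) (s *: V + (- (s * kap)) *: phi) = s ^+ 2 * e.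
  rewrite (sip_sq_comb sD _ _ HV Hp) (sipC sD HV Hp) /e -/A.
  have -> : s ^+ 2 * A + 2 * s * - (s * kap) * dir phi V + (- (s * kap)) ^+ 2 * dir phi phi =
    s ^+ 2 * (A - 2 * (kap * dir phi V) + kap ^+ 2 * dir phi phi).
    by move: (dir phi V) (dir phi phi) => x y; ring.
  by rewrite kx; move: (dir phi phi) => y; ring.
have e0 : 0 < e.
  pose l1 := 1 *: V + (- (1 * kap)) *: phi.
  have Hl1 : H10 Omega l1 by exact: (sip_comb sD).
  have -> : e = dir l1 l1 by rewrite /l1 l0E expr1n mul1r.
  apply: lt_le_trans (lam1_le_H10 oO bO nO Hl1).
  rewrite mulr_gt0//; first exact: (lam1_gt0 oO bO nO hN).
  have cl1 : {in Omega, continuous l1} by exact: continuous_comb.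
  apply: (L2_inner_gt0 oO (H10_L2 Hl1) Op (cl1 p (mem_set Op))).
  rewrite -[l1 p]/(1 * V p + (- (1 * kap)) * phi p) Uphi// mulr0 addr0 mul1r.
  by rewrite gt_eqF.
pose s := Num.sqrt (t1 / e).
have s0 : 0 < s by rewrite sqrtr_gt0 divr_gt0.
have se : s ^+ 2 * e = t1 by rewrite sqr_sqrtr ?divr_ge0 ?ltW// divfK// gt_eqF.
have sdl : dl < (M t2 - M t1) * s.
  rewrite -(@ltr_pXn2r _ 2)// ?nnegrE ?(ltW dl0) ?mulr_ge0 ?subr_ge0 ?(ltW M12) ?(ltW s0)//.
  apply: (@lt_le_trans _ _ (dl ^+ 2 + 1)); first by rewrite ltrDl.
  rewrite exprMn -(ler_pM2r e0) -mulrA se.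
  by rewrite -ler_pdivlMl// mulrC.
pose l := s *: V + (- (s * kap)) *: phi.
pose w := (M t1 / M t2) *: l + (dl / M t2) *: V.
have Hl : H10 Omega l by exact: (sip_comb sD).
have Hw : H10 Omega w by exact: (sip_comb sD).
have cl : {in Omega, continuous l} by exact: continuous_comb.
have cw : {in Omega, continuous w} by exact: continuous_comb.
have ll : dir l l = t1 by rewrite /l l0E.
have lV : dir l V = 0.
  rewrite (sip_combl sD _ _ HV Hp HV) -/A mulNr -mulrA kx subrr//.
have ww : dir w w = t2.
  rewrite (sip_sq_comb sD _ _ Hl HV) ll lV -/A mulr0 addr0 !expr_div_n.
  rewrite -[dl ^+ 2 / _ * A]mulrAC dlA; field; by rewrite gt_eqF.
have wE x : w x = M t1 / M t2 * l x + dl / M t2 * V x by [].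
have lp : l p = s * V p.
  by rewrite -[l p]/(s * V p + (- (s * kap)) * phi p) Uphi// mulr0 addr0.
have wlp : w p < l p.
  rewrite wE lp -subr_gt0.
  have -> : s * V p - (M t1 / M t2 * (s * V p) + dl / M t2 * V p) =
    ((M t2 - M t1) * s - dl) * (V p / M t2) by field; rewrite gt_eqF.
  by rewrite mulr_gt0 ?subr_gt0// divr_gt0.
(* The integral of [l] is [dir V l = 0], while [l p] is positive. *)
have [q Oq lq] : exists2 q, Omega q & l q < 0.
  apply: contrapT => h.
  have lge x : Omega x -> 0 <= l x.
    by move=> Ox; rewrite leNgt; apply/negP => lx; apply: h; exists x.
  have Ll := H10_L2 Hl.
  have := L2_inner1_gt0 oO bO Ll (aeW _ lge); rewrite -hV// (sipC sD HV Hl) lV ltxx => F.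
  suff : false by []; apply: F => l_eq0; have : 0 < ip l l.
    apply: (L2_inner_gt0 oO Ll Op (cl p (mem_set Op))).
    by rewrite lp mulf_neq0// gt_eqF.
  have L0 := L2_cst oO bO 0.
  rewrite (L2_inner_ae mO Ll Ll L0 L0 l_eq0 l_eq0).
  rewrite (_ : ip _ _ = 0) ?ltxx// /L2_inner.
  transitivity (\int[mu]_(y in Omega) (cst 0 : _ -> R) y); last by rewrite Rintegral_cst// mul0r.
  by apply: eq_Rintegral => y _; rewrite mul0r.
have lwq : l q < w q.
  rewrite wE -subr_gt0.
  have -> : M t1 / M t2 * l q + dl / M t2 * V q - l q =
    (M t2 - M t1) / M t2 * (- l q) + dl / M t2 * V q by field; rewrite gt_eqF.
  rewrite ltr_pwDl// ?mulr_ge0 ?invr_ge0 ?V0 ?(ltW dl0) ?(ltW M2)//.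
  by rewrite mulr_gt0 ?oppr_gt0// divr_gt0// subr_gt0.
exists l, w; split.
- by split; split; assumption.
- move=> psi Hpsi psi0 psin; rewrite /kirchhoff !normH_sqE ll ww.
  rewrite [dir w psi](sip_combl sD _ _ Hl HV Hpsi) hV//.
  have I0 := L2_inner1_gt0 oO bO (H10_L2 Hpsi) psi0 psin.
  have -> : M t2 * (M t1 / M t2 * dir l psi + dl / M t2 * ip (cst 1) psi) =
    M t1 * dir l psi + dl * ip (cst 1) psi.
    by move: (dir l psi) (ip (cst 1) psi) => x y; field; rewrite gt_eqF.
  by rewrite ltrDl mulr_gt0.
- exact: (H10_le_on_boundary oO bO).
- by exists p.
have : is_interval ((l - w) @` Omega).
  apply/connected_intervalP; apply: connected_continuous_connected => //.
  apply: continuous_in_subspaceT => x Ox.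
  apply: (@cvgB _ _ _ (nbhs (x : 'rV[R]_N)) _ l w); [exact: cl|exact: cw].
move=> /(_ ((l - w) q) ((l - w) p)) h; have [|||x Ox xE] := h _ _ 0.
- by exists q.
- by exists p.
- by rewrite -[(l - w) q]/(l q - w q) -[(l - w) p]/(l p - w p) subr_le0 subr_ge0 !ltW.
by exists x; split => //; apply/eqP; rewrite -subr_eq0; apply/eqP.
Qed.

End comparison_principles.

(** * Failure of the sub and supersolution method *)

Section sub_supersolution.
Context {R : realType} {N : nat}.
Variable Omega : set 'rV[R]_N.
Hypotheses (oO : open Omega) (bO : bounded_set Omega).
Let mu := lebesgue_rV R N.
Let mO : measurable Omega := measurable_Omega oO.
Let sI := @L2_inner_semi_inner R N Omega mO.
Implicit Types (f g u v w : 'rV[R]_N -> R).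
Local Notation ip := (L2_inner Omega).
Local Notation test := (test_function Omega).

Let tL2 f : test f -> L2 Omega f. Proof. exact: test_L2. Qed.

Hypotheses (nO : Omega !=set0) (hN : (1 <= N)%N).
Local Notation lam1 := (lam1 Omega).

Lemma L2_inner_ge0 u v : L2 Omega u -> L2 Omega v ->
  ae_le Omega (cst 0) u -> ae_le Omega (cst 0) v -> 0 <= ip u v.
Proof.
move=> Lu Lv u0 v0.
have [Lau _] := L2_norm oO Lu; have [Lav _] := L2_norm oO Lv.
have abs w : ae_le Omega (cst 0) w -> ae_eq Omega w (fun x => `|w x|).
  by apply: filterS => x hx Ox; rewrite ger0_norm//; exact: hx.
rewrite (L2_inner_ae mO Lu Lv Lau Lav (abs u u0) (abs v v0)).
by apply: Rintegral_ge0 => x _; rewrite mulr_ge0.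
Qed.

Lemma L2_inner_le u v w : L2 Omega u -> L2 Omega v -> L2 Omega w ->
  ae_le Omega u v -> ae_le Omega (cst 0) w -> ip u w <= ip v w.
Proof.
move=> Lu Lv Lw uv w0; rewrite -subr_ge0 -(sipBl sI Lv Lu Lw).
apply: L2_inner_ge0 => //; first exact: (sipB sI).
by apply: filterS uv => x hx Ox; rewrite subr_ge0; exact: hx.
Qed.

Lemma laplacian_bump_out m (x y : 'rV[R]_N) (r : R) : 0 < r -> r ^+ 2 <= sqdist x y ->
  laplacian (bump m.+2 x r) y = 0.
Proof. by move=> r0 h; rewrite laplacian_bump !bump_out// !mulr0 addr0. Qed.

(** Both bumps live where [phi1 > kap]: there a fixed multiple of [phi1] dominates all bounded
    quantities, and elsewhere nothing is perturbed. This avoids any comparison with [phi1] near the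
    boundary. *)
Lemma localized_bumps phi1 : H10 Omega phi1 -> {in Omega, continuous phi1} ->
  (forall x, Omega x -> 0 <= phi1 x) -> ip phi1 phi1 = 1 ->
  exists kap C chi psi, [/\ 0 < kap, 0 < C, test chi, test psi &
    [/\ forall x, 0 <= psi x <= C /\ `|laplacian psi x| <= C,
        forall x, `|laplacian chi x + lam1 * chi x| <= C,
        forall x, Omega x -> phi1 x < kap ->
          [/\ psi x = 0, laplacian psi x = 0 & laplacian chi x + lam1 * chi x = 0] &
        ip psi (laplacian chi + lam1 *: chi) < 0]].
Proof.
move=> Hphi cphi phi0 phi11; have l0 := lam1_gt0 oO bO nO hN.
have [x0 Ox0 px0] : exists2 x, Omega x & 0 < phi1 x.
  apply: contrapT => h; have := oner_neq0 R; rewrite -phi11 => /eqP; apply.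
  transitivity (\int[mu]_(y in Omega) (cst 0 : _ -> R) y); last by rewrite Rintegral_cst// mul0r.
  apply: eq_Rintegral => y /set_mem Oy; suff -> : phi1 y = 0 by rewrite mul0r.
  apply: le_anti; rewrite (phi0 y Oy) andbT leNgt.
  by apply/negP => py; apply: h; exists y.
pose kap := phi1 x0 / 2; have kap0 : 0 < kap by rewrite divr_gt0.
pose W := Omega `&` [set y | kap < phi1 y].
have Wx0 : nbhs (x0 : 'rV[R]_N) W.
  apply: filterI; first exact: open_nbhs_nbhs.
  have kx : kap < phi1 x0 by rewrite /kap ltr_pdivrMr// ltr_pMr// ltr1n.
  exact: (cphi x0 (mem_set Ox0) _ (lt_nbhsr kx)).
have [r0 r0_gt0 hr0] := open_sqdist_ball (@open_interior _ W) Wx0.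
have {}hr0 y : sqdist x0 y <= r0 ^+ 2 -> W y by move=> /hr0; exact: interior_subset.
pose P1 : R := profile 1 1; pose P2 : R := profile 2 1.
have P10 : 0 < P1 by exact: profile_gt0.
have P20 : 0 < P2 by exact: profile_gt0.
have q0 : 0 < lam1 * P2 + 1 by rewrite ltr_wpDl// mulr_ge0// ltW.
have q1 : 0 < P1 / (lam1 * P2 + 1) by rewrite divr_gt0.
(* At its centre the bump [chi] has Laplacian [- N * P1 / r ^+ 2] and value [P2]; for [r <= r1] the
   Laplacian wins over [lam1 * P2], as [N] is at least 1. *)
pose r1 := Num.sqrt (P1 / (lam1 * P2 + 1)).
have r1_gt0 : 0 < r1 by rewrite sqrtr_gt0.
pose r := Num.min r0 r1.
have r_gt0 : 0 < r by rewrite lt_min r0_gt0.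
have sq_le (a b : R) : 0 < a -> a <= b -> a ^+ 2 <= b ^+ 2.
  by move=> a0 ab; rewrite ler_pXn2r ?nnegrE ?(ltW a0)// (le_trans (ltW a0)).
have rr0 : r ^+ 2 <= r0 ^+ 2 by apply: sq_le => //; rewrite ge_min lexx.
have rr1 : r ^+ 2 * (lam1 * P2) < P1.
  apply: (@lt_le_trans _ _ (r ^+ 2 * (lam1 * P2 + 1))).
    by rewrite ltr_pM2l ?exprn_gt0// ltrDl.
  rewrite -ler_pdivlMr// -(sqr_sqrtr (ltW q1)); apply: sq_le => //.
  by rewrite ge_min lexx orbT.
have tchi : test (bump 2 x0 r).
  by apply: test_bump => // y yr; have [] := hr0 y (le_trans yr rr0).
set chi := bump 2 x0 r in tchi.
pose g : 'rV[R]_N -> R := laplacian chi + lam1 *: chi.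
have tg : test g by apply: testD; [exact: test_laplacian|exact: testZ].
have gE y : g y = laplacian chi y + lam1 * chi y by [].
have gx0 : g x0 < 0.
  rewrite gE /chi laplacian_bump /bump sqdistxx !(mul0r, mulr0) addr0 subr0 -/P1 -/P2.
  rewrite -mulrA [- _ * _]mulNr addrC subr_lt0 ltr_pdivlMl ?exprn_gt0//.
  apply: (lt_le_trans rr1).
  by rewrite ler_peMl ?ler1n// ltW.
have [r2 r2_gt0 hr2] : exists2 r2, 0 < r2 & forall y, sqdist x0 y <= r2 ^+ 2 -> g y < 0.
  apply: (@open_sqdist_ball _ _ [set y | g y < 0]) => //.
  have -> : [set y | g y < 0] = g @^-1` [set s | s < 0] by [].
  by apply: open_comp; [move=> y _; exact: (test_continuous tg)|exact: open_lt].
(* The support of [psi] is shrunk to a ball on which [g] is negative, so that [ip psi g < 0]. *)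
pose r' := Num.min r r2.
have r'_gt0 : 0 < r' by rewrite lt_min r_gt0.
have r'r : r' ^+ 2 <= r ^+ 2 by apply: sq_le => //; rewrite ge_min lexx.
have r'r2 : r' ^+ 2 <= r2 ^+ 2 by apply: sq_le => //; rewrite ge_min lexx orbT.
have tpsi : test (bump 2 x0 r').
  by apply: test_bump => // y yr; have [] := hr0 y (le_trans yr (le_trans r'r rr0)).
set psi := bump 2 x0 r' in tpsi.
have [C1 C10 hC1] := test_bounded tpsi.
have [C2 C20 hC2] := test_bounded (test_laplacian tpsi).
have [C3 C30 hC3] := test_bounded tg.
have psi0 y : 0 <= psi y by exact: bump_ge0.
exists kap, (C1 + C2 + C3), chi, psi; split => //; first by rewrite !addr_gt0.
split.
- move=> x; split; first rewrite psi0/= (le_trans (ler_norm _))// (le_trans (hC1 x))//.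
    by rewrite -addrA lerDl addr_ge0// ltW.
  by rewrite (le_trans (hC2 x))// addrAC lerDr addr_ge0// ltW.
- by move=> x; rewrite -gE (le_trans (hC3 x))// lerDr addr_ge0// ltW.
- move=> x Ox xk; have rx : r ^+ 2 <= sqdist x0 x.
    rewrite leNgt; apply/negP => /ltW xr; have [_] := hr0 x (le_trans xr rr0).
    by rewrite /= ltNge (ltW xk).
  split; first exact: bump_out (le_trans r'r rx).
    exact: laplacian_bump_out (le_trans r'r rx).
  by rewrite /chi laplacian_bump_out// bump_out// mulr0 addr0.
have Lpsi := tL2 tpsi; have Lg := tL2 tg.
rewrite -/g -oppr_gt0 -(sipNr sI Lg Lpsi).
have Lgn : L2 Omega (- g) by exact: (sipN sI).
have pg y : sqdist x0 y <= r' ^+ 2 -> 0 < (- g) y.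
  by move=> yr; rewrite oppr_gt0; apply: hr2; exact: le_trans r'r2.
apply: (@continuous_integral_gt0 _ _ _ _ x0 oO Ox0).
- apply: (@cvgM _ _ (nbhs (x0 : 'rV[R]_N)) _ psi (- g)).
    exact: (test_continuous tpsi).
  apply: (@cvgN _ _ _ (nbhs (x0 : 'rV[R]_N)) _ g); exact: (test_continuous tg).
- exact: (L2M_integrable mO Lpsi Lgn).
- move=> y _; have [yr|yr] := leP (sqdist x0 y) (r' ^+ 2).
    by apply: mulr_ge0; [exact: psi0|exact/ltW/pg].
  by rewrite /psi (bump_out _ r'_gt0 (ltW yr)) mul0r.
apply: mulr_gt0; last by apply: pg; rewrite sqdistxx sqr_ge0.
by rewrite /psi /bump sqdistxx mul0r subr0; exact: profile_gt0.
Qed.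

End sub_supersolution.

Section sub_supersolution_method.
Context {R : realType} {N : nat}.
Variable Omega : set 'rV[R]_N.
Hypotheses (oO : open Omega) (bO : bounded_set Omega).
Let mu := lebesgue_rV R N.
Let mO : measurable Omega := measurable_Omega oO.
Let sI := @L2_inner_semi_inner R N Omega mO.
Let sD := dirichlet_semi_inner oO bO.
Implicit Types (f g u v : 'rV[R]_N -> R).
Local Notation ip := (L2_inner Omega).
Local Notation dir := (dirichlet Omega).
Local Notation test := (test_function Omega).

Let tL2 f : test f -> L2 Omega f. Proof. exact: test_L2. Qed.
Let tH f : test f -> H10 Omega f. Proof. exact: test_H10. Qed.

Hypotheses (nO : Omega !=set0) (hN : (1 <= N)%N).
Local Notation lam1 := (lam1 Omega).
Local Notation nrmD := (snorm (dirichlet Omega)).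

(* The source of [d] lies off the support of a test function close to [phi1],
   so that [d] is almost orthogonal to [phi1] relative to its own energy. *)
Lemma small_resolvent phi1 b e : H10 Omega phi1 ->
  (forall v, H10 Omega v -> dir phi1 v = lam1 * ip phi1 v) ->
  0 <= b -> b < lam1 -> 0 < e ->
  exists d, [/\ H10 Omega d, {in Omega, continuous d}, forall x, Omega x -> 0 <= d x,
    forall v, H10 Omega v -> ae_le Omega (cst 0) v -> 0 <= dir d v - b * ip d v &
    0 < dir d d /\ (lam1 - b) * ip d phi1 <= nrmD d * e].
Proof.
move=> Hphi phiE b0 bl e0.
have [psi [tpsi _ p2]] := H10_approx oO bO Hphi.
have /cvgrPdist_le/(_ (e ^+ 2) (exprn_gt0 2 e0))[n _ hn] := p2.
pose phi := psi n; have tphi : test phi by exact: tpsi.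
have {}hn : dir (phi - phi1) (phi - phi1) <= e ^+ 2.
  have := hn n (leqnn n); rewrite sub0r normrN; apply: le_trans; exact: ler_norm.
have Hp := tH tphi; have Lp := tL2 tphi; have Lphi := H10_L2 Hphi.
have [U [oU [x Ux] UO Uphi]] := off_support oO nO hN tphi.
have [r r0 hr] := open_sqdist_ball oU Ux.
have tU := test_bump 2 r0 hr.
have th : test (bump 2 x r) by apply: test_bump => // y /hr/UO.
set h := bump 2 x r in tU th.
have [Hb Hb0 hHb] := test_bounded th.
have h0 y : 0 <= h y by exact: bump_ge0.
have Lh := tL2 th.
have [|d [Hd cd d0 hd]] := resolvent oO bO nO b0 bl Lh (H := Hb).
  by move=> y; rewrite h0/= (le_trans (ler_norm _)).
have Ld := H10_L2 Hd.
have hphi : ip h phi = 0.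
  transitivity (\int[mu]_(y in Omega) (cst 0 : _ -> R) y); last by rewrite Rintegral_cst// mul0r.
  apply: eq_Rintegral => y _; have [Uy|Uy] := pselect (U y).
    by rewrite Uphi// mulr0.
  by rewrite (test_out tU Uy) mul0r.
have hh : 0 < ip h h.
  apply: (L2_inner_gt0 oO Lh (UO _ Ux) (test_continuous th (x := x))).
  by rewrite gt_eqF// /h /bump sqdistxx mul0r subr0; exact: profile_gt0.
have sE : semi_inner (H10 Omega) (energy Omega b).
  by apply: (energy_semi_inner oO bO nO); rewrite b0 ltW.
have Ele v : H10 Omega v -> energy Omega b v v <= dir v v.
  move=> Hv; rewrite /energy gerBl mulr_ge0// (sip_ge0 sI)//; exact: H10_L2.
have Hh := tH th.
exists d; split => //.
  move=> v Hv v0; rewrite hd//; apply: L2_inner_ge0 => //; first exact: H10_L2.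
  by apply: aeW => y _; exact: h0.
have dd0 : 0 <= dir d d by exact: (sip_ge0 sD).
split.
  rewrite lt_neqAle dd0 andbT eq_sym; apply/eqP => dd.
  have Ed : energy Omega b d d = 0.
    by apply: le_anti; rewrite (sip_ge0 sE Hd) andbT -dd Ele.
  have := sip_CS sE Hd Hh; rewrite Ed mul0r {1}/energy hd// leNgt.
  by rewrite exprn_gt0.
have Hpp : H10 Omega (phi1 - phi) by exact: (sipB sD).
(* By the eigenvalue equation the left side is [energy b d phi1], and
   [energy b d phi = ip h phi = 0] since the source [h] lives off the support of [phi]. *)
have -> : (lam1 - b) * ip d phi1 = energy Omega b d (phi1 - phi).
  rewrite {1}/energy hd// (sipBr sI Lphi Lp Lh) hphi subr0 -hd//.
  by rewrite (sipC sD Hd Hphi) phiE// (sipC sI Lphi Ld) mulrBl.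
apply: le_trans (ler_norm _) _; apply: le_trans (sip_le_snorm sE Hd Hpp) _.
apply: ler_pM; rewrite ?sqrtr_ge0//; first by rewrite ler_wsqrtr// Ele.
have eE : e = Num.sqrt (e ^+ 2) by rewrite sqrtr_sqr gtr0_norm.
rewrite [leRHS]eE; apply: ler_wsqrtr; apply: le_trans (Ele _ Hpp) _; apply: le_trans hn.
rewrite (sip_sqB sD Hphi Hp) (sip_sqB sD Hp Hphi) (sipC sD Hp Hphi).
move: (dir phi1 phi1) (dir phi phi) (dir phi1 phi) => p q s.
have -> : p - 2 * s + q = q - 2 * s + p by ring.
exact: lexx.
Qed.

Variable M : R -> R.
Hypothesis hM : forall t, 0 <= t -> 0 <= M t.
Variables t1 t2 : R.
Hypotheses (t1_gt0 : 0 < t1) (t12 : t1 < t2) (M12 : M t1 < M t2).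

Lemma sub_supersolution_fails : exists (Theta : R) (usub usup : 'rV[R]_N -> R),
  0 < Theta /\
  (H10 Omega usub /\ {in Omega, continuous usub}) /\
  (H10 Omega usup /\ {in Omega, continuous usup}) /\
  weak_subsolution Omega M usub (fun x => Theta * usub x) /\
  weak_supersolution Omega M usup (fun x => Theta * usup x) /\
  (forall x, Omega x -> usub x <= usup x) /\
  le_on_boundary Omega usub (cst 0) /\
  le_on_boundary Omega (cst 0) usup /\
  ~ (exists u : 'rV[R]_N -> R,
        [/\ H10 Omega u,
            weak_solution Omega M u (fun x => Theta * u x),
            ae_le Omega usub u &
            ae_le Omega u usup]).
Proof.
have M1 : 0 <= M t1 by apply: hM; exact: ltW.
have M2 : 0 < M t2 := le_lt_trans M1 M12.
have l0 := lam1_gt0 oO bO nO hN.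
have [phi1 [Hphi cphi phi0 phi11 phiE]] := first_eigenfunction oO bO nO hN.
have [kap [C [chi [psi [kap0 C0 tchi tpsi [hpsi hchi hout hneg]]]]]] :=
  localized_bumps oO bO nO hN Hphi cphi phi0 phi11.
pose Theta := lam1 * (M t1 + M t2) / 2.
pose b := Theta / M t2.
(* The common gap of [Theta], chosen halfway, from [lam1 * M t1] and [lam1 * M t2]. *)
pose De := lam1 * (M t2 - M t1) / 2.
have De0 : 0 < De by rewrite divr_gt0// mulr_gt0// subr_gt0.
have De1 : Theta = M t1 * lam1 + De by rewrite /Theta /De; field.
have De2 : M t2 * lam1 = Theta + De by rewrite /Theta /De; field.
have Th0 : 0 < Theta by rewrite De1 ltr_wpDl// mulr_ge0// ltW.
have b0 : 0 <= b by rewrite divr_ge0// ltW.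
have bl : b < lam1 by rewrite ltr_pdivrMr// mulrC De2 ltrDl.
have q0 : 0 < C * (M t2 + Theta) by rewrite mulr_gt0// addr_gt0.
(* The largest terms caused by the bump are bounded by [eta * C * (M t2 + Theta)]; this is
   [De * kap], hence at most the margin [De * phi1] where the bump lives. *)
pose eta := De * kap / (C * (M t2 + Theta)).
have eta0 : 0 < eta by rewrite divr_gt0// mulr_gt0.
have etaE : eta * (C * (M t2 + Theta)) = De * kap by rewrite divfK// gt_eqF.
have Lphi := H10_L2 Hphi; have Hpsi := tH tpsi; have Lpsi := tL2 tpsi.
have LDpsi := tL2 (test_laplacian tpsi).
pose u1 := 1 *: phi1 + eta *: psi.
(* This represents [- Delta u1] as an L2 function, which reduces the weak inequalities to pointwise
   ones. *)
pose Lu1 := lam1 *: phi1 + (- eta) *: laplacian psi.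
have Hu1 : H10 Omega u1 by exact: (sip_comb sD).
have L_u1 : L2 Omega u1 := H10_L2 Hu1.
have L_Lu1 : L2 Omega Lu1 by exact: (sip_comb sI).
have u1E x : u1 x = phi1 x + eta * psi x by rewrite -[phi1 x]mul1r.
have Lu1E x : Lu1 x = lam1 * phi1 x - eta * laplacian psi x by rewrite -mulNr.
have u1dir v : H10 Omega v -> dir u1 v = ip Lu1 v.
  move=> Hv; have Lv := H10_L2 Hv.
  rewrite (sip_combl sD _ _ Hphi Hpsi Hv) (sip_combl sI _ _ Lphi LDpsi Lv).
  rewrite phiE// mul1r (sipC sD Hpsi Hv) (dirichlet_test oO bO Hv tpsi).
  by rewrite (sipC sI Lv LDpsi) [eta * _]mulrN [(- eta) * _]mulNr.
(* Together with [sup_pt]: a multiple of [u1] of energy [t1] is a subsolution, and it would be a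
   supersolution if its coefficient were [M t2]. Adding [s *: d] supplies the missing energy and
   preserves the second inequality. *)
have sub_pt x : Omega x -> M t1 * Lu1 x <= Theta * u1 x.
  move=> Ox; rewrite u1E Lu1E; have [pk|pk] := ltP (phi1 x) kap.
    have [-> -> _] := hout x Ox pk; rewrite !mulr0 subr0 addr0 mulrA ler_wpM2r ?phi0//.
    by rewrite De1 lerDl ltW.
  have [/andP[p0 pC] LC] := hpsi x.
  have h1 : De * kap <= De * phi1 x by rewrite ler_pM2l.
  have h2 : - laplacian psi x <= C by apply: le_trans LC; rewrite -normrN ler_norm.
  have h3 : M t1 * (eta * - laplacian psi x) <= M t1 * (eta * C).
    by rewrite ler_wpM2l// ler_pM2l.
  have h4 : M t1 * (eta * C) <= eta * (C * (M t2 + Theta)).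
    rewrite mulrC -mulrA ler_pM2l// ler_pM2l//.
    by rewrite (le_trans (ltW M12))// lerDl ltW.
  have h5 : 0 <= Theta * (eta * psi x) := mulr_ge0 (ltW Th0) (mulr_ge0 (ltW eta0) p0).
  rewrite mulrBr -mulrN -mulrN mulrDr {1}De1 mulrDl -mulrA -addrA lerD2l.
  apply: le_trans h3 _; apply: le_trans h4 _; rewrite etaE.
  by rewrite (le_trans h1)// lerDl.
have sup_pt x : Omega x -> Theta * u1 x <= M t2 * Lu1 x.
  move=> Ox; rewrite u1E Lu1E; have [pk|pk] := ltP (phi1 x) kap.
    have [-> -> _] := hout x Ox pk; rewrite !mulr0 subr0 addr0 mulrA ler_wpM2r ?phi0//.
    by rewrite De2 lerDl ltW.
  have [/andP[p0 pC] LC] := hpsi x.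
  have h1 : De * kap <= De * phi1 x by rewrite ler_pM2l.
  have h2 : laplacian psi x <= C by apply: le_trans LC; exact: ler_norm.
  have h3 : M t2 * (eta * laplacian psi x) <= M t2 * (eta * C).
    by rewrite ler_wpM2l ?(ltW M2)// ler_pM2l.
  have h4 : Theta * (eta * psi x) <= Theta * (eta * C).
    by rewrite ler_wpM2l ?(ltW Th0)// ler_pM2l.
  have -> : M t2 * (lam1 * phi1 x - eta * laplacian psi x) =
    (Theta + De) * phi1 x - M t2 * (eta * laplacian psi x) by rewrite mulrBr [M t2 * (lam1 * _)]mulrA De2.
  rewrite [X in X <= _]mulrDr [(Theta + De) * _]mulrDl lerBrDr -addrA lerD2l.
  apply: le_trans h1; rewrite -etaE.
  have -> : eta * (C * (M t2 + Theta)) = Theta * (eta * C) + M t2 * (eta * C).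
    by rewrite [LHS]mulrA [LHS]mulrDr [RHS]addrC; congr (_ + _); exact: mulrC.
  exact: lerD.
have psiphi : 0 <= ip psi phi1.
  apply: L2_inner_ge0 => //; apply: aeW => x; last exact: phi0.
  by move=> _; have [/andP[]] := hpsi x.
have E0 : 0 < dir u1 u1.
  have x1 : lam1 <= dir u1 phi1.
    rewrite (sipC sD Hu1 Hphi) phiE// ler_peMr ?(ltW l0)//.
    rewrite (sip_combr sI _ _ Lphi Lpsi Lphi) phi11 mulr1 lerDl (sipC sI Lphi Lpsi).
    exact: (mulr_ge0 (ltW eta0) psiphi).
  rewrite lt_neqAle (sip_ge0 sD Hu1) andbT eq_sym; apply/eqP => E0.
  have := sip_CS sD Hu1 Hphi; rewrite E0 mul0r leNgt exprn_gt0//.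
  exact: lt_le_trans x1.
pose c0 := Num.sqrt (t1 / dir u1 u1).
have c00 : 0 < c0 by rewrite sqrtr_gt0 divr_gt0.
have c0E : c0 ^+ 2 * dir u1 u1 = t1.
  by rewrite sqr_sqrtr ?divr_ge0 ?(ltW E0) ?(ltW t1_gt0)// divfK// gt_eqF.
pose zeta := c0 *: u1.
have Hz : H10 Omega zeta by exact: (sipZ sD).
have Lz := H10_L2 Hz.
have zE x : zeta x = c0 * u1 x by [].
have zz : dir zeta zeta = t1.
  by rewrite (sipZl sD _ Hu1 Hz) (sipZr sD _ Hu1 Hu1) mulrA -expr2.
have zdir v : H10 Omega v -> dir zeta v = c0 * ip Lu1 v.
  by move=> Hv; rewrite (sipZl sD _ Hu1 Hv) u1dir.
have cpsi : {in Omega, continuous psi} by move=> x _; exact: (test_continuous tpsi).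
have cu1 : {in Omega, continuous u1} by exact: continuous_comb.
have cz : {in Omega, continuous zeta}.
  have -> : zeta = c0 *: u1 + 0 *: u1 by rewrite scale0r addr0.
  exact: continuous_comb.
pose g : 'rV[R]_N -> R := laplacian chi + lam1 *: chi.
have Lg : L2 Omega g by apply: tL2; apply: testD; [exact: test_laplacian|exact: testZ].
pose P := - ip psi g; have P0 : 0 < P by rewrite oppr_gt0.
(* With [small_resolvent] applied for [e], the pairing of [s *: d] with [(C / kap) *: phi1] is at
   most [Q * e]; the [e] below makes this half of [c0 * (eta * P)]. *)
pose Q := C / kap * ((Num.sqrt t2 + Num.sqrt t1) / (lam1 - b)).
have lb0 : 0 < lam1 - b by rewrite subr_gt0.
have Q0 : 0 < Q.
  by rewrite mulr_gt0 ?divr_gt0// ltr_wpDl ?sqrtr_ge0// sqrtr_gt0.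
have cP0 : 0 < c0 * (eta * P) := mulr_gt0 c00 (mulr_gt0 eta0 P0).
have e0 : 0 < c0 * (eta * P) / (2 * Q) by rewrite divr_gt0// mulr_gt0.
have [d [Hd cd d0 dpos [dd0 dphi]]] := small_resolvent Hphi phiE b0 bl e0.
set e := c0 * (eta * P) / (2 * Q) in e0 dphi.
have Qe : Q * e < c0 * (eta * P).
  have -> : Q * e = c0 * (eta * P) / 2 by rewrite /e; move: (c0 * _) => y; field; rewrite gt_eqF.
  by rewrite ltr_pdivrMr// ltr_pMr// ltr1n.
have Ld := H10_L2 Hd.
pose D := dir d d; pose B := dir zeta d.
have disc : 0 < B ^+ 2 + D * (t2 - t1).
  by rewrite ltr_wpDl ?sqr_ge0// mulr_gt0// subr_gt0.
(* The positive root of [D s^2 + 2 B s = t2 - t1], that is, of the condition that [zeta + s d] have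
   energy [t2]. *)
pose s := (- B + Num.sqrt (B ^+ 2 + D * (t2 - t1))) / D.
have s0 : 0 < s.
  rewrite divr_gt0// addrC subr_gt0 (le_lt_trans (ler_norm B))// -sqrtr_sqr ltr_sqrt//.
  by rewrite ltrDl mulr_gt0// subr_gt0.
have sE : 2 * s * B + s ^+ 2 * D = t2 - t1.
  rewrite /s; set S := Num.sqrt _.
  have S2 : S ^+ 2 = B ^+ 2 + D * (t2 - t1) by rewrite sqr_sqrtr// ltW.
  have Dn : D != 0 by rewrite gt_eqF.
  transitivity ((S ^+ 2 - B ^+ 2) / D); last by rewrite S2; field.
  by clearbody S; field.
pose usup := 1 *: zeta + s *: d.
have Hs : H10 Omega usup by exact: (sip_comb sD).
have Ls := H10_L2 Hs.
have usupE x : usup x = zeta x + s * d x by rewrite -[zeta x]mul1r.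
have ss : dir usup usup = t2.
  rewrite (sip_sq_comb sD _ _ Hz Hd) zz -/B -/D expr1n mul1r mulr1 -addrA sE.
  by rewrite addrC subrK.
(* This bound does not depend on [d]: the size of [s] is not controlled separately, but [s *: d] is
   a difference of functions of energies [t2] and [t1]. *)
have snd : s * nrmD d <= Num.sqrt t2 + Num.sqrt t1.
  have -> : s * nrmD d = nrmD (usup + (- 1) *: zeta).
    have -> : usup + (- 1) *: zeta = s *: d.
      by rewrite /usup scale1r scaleN1r addrAC subrr add0r.
    by rewrite (snormZ sD _ Hd) gtr0_norm.
  apply: le_trans (snormD sD Hs (sipZ sD _ Hz)) _.
  by rewrite (snormZ sD _ Hz) normrN1 mul1r /snorm ss zz.
have cs : {in Omega, continuous usup} by exact: continuous_comb.
have le_us x : Omega x -> zeta x <= usup x.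
  by move=> Ox; rewrite usupE lerDl mulr_ge0// ?d0// ltW.
have H0 : H10 Omega (cst 0 : 'rV[R]_N -> R) by apply: tH; exact: test0.
have subsol v : H10 Omega v -> ae_le Omega (cst 0) v ->
    M t1 * dir zeta v <= ip (fun x => Theta * zeta x) v.
  move=> Hv v0; have Lv := H10_L2 Hv.
  have -> : M t1 * dir zeta v = ip ((M t1 * c0) *: Lu1) v.
    by rewrite zdir// (sipZl sI _ L_Lu1 Lv) mulrA.
  apply: L2_inner_le => //; [exact: (sipZ sI)|exact: (sipZ sI Theta Lz)|].
  apply: aeW => x Ox; rewrite zE -[((M t1 * c0) *: Lu1) x]/(M t1 * c0 * Lu1 x).
  by rewrite mulrAC [leLHS]mulrC [X in _ <= X]mulrCA ler_pM2l// sub_pt.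
exists Theta, zeta, usup; split; first exact: Th0.
split; first by split.
split; first by split.
split; first by move=> v Hv v0; rewrite /kirchhoff normH_sqE zz; exact: subsol.
split.
  move=> v Hv v0; rewrite /kirchhoff normH_sqE ss; have Lv := H10_L2 Hv.
  have bM : M t2 * b = Theta by rewrite mulrC divfK// gt_eqF.
  have supz : Theta * ip zeta v <= M t2 * dir zeta v.
    rewrite -(sipZl sI _ Lz Lv).
    have -> : M t2 * dir zeta v = ip ((M t2 * c0) *: Lu1) v.
      by rewrite zdir// (sipZl sI _ L_Lu1 Lv) mulrA.
    apply: L2_inner_le => //; [exact: (sipZ sI)|exact: (sipZ sI)|].
    apply: aeW => x Ox; rewrite -[(Theta *: zeta) x]/(Theta * (c0 * u1 x)).
    rewrite -[((M t2 * c0) *: Lu1) x]/(M t2 * c0 * Lu1 x).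
    rewrite [leLHS]mulrCA -[leRHS]mulrA [leRHS]mulrCA.
    by apply: ler_wpM2l; [exact: ltW|exact: sup_pt].
  have supd : b * ip d v <= dir d v by rewrite -subr_ge0; exact: dpos.
  have -> : ip (fun x => Theta * usup x) v = Theta * ip usup v := sipZl sI Theta Ls Lv.
  rewrite (sip_combl sI _ _ Lz Ld Lv) (sip_combl sD _ _ Hz Hd Hv) !mul1r.
  rewrite [leLHS]mulrDr [leRHS]mulrDr; apply: lerD => //.
  rewrite -[in leLHS]bM -[leLHS]mulrA; apply: ler_wpM2l; first exact: ltW.
  by rewrite [leLHS]mulrCA; apply: ler_wpM2l => //; exact: ltW.
split; first exact: le_us.
split; first exact: (H10_le_on_boundary oO bO).
split; first exact: (H10_le_on_boundary oO bO).
move=> [u [Hu usol zu us]]; have Lu := H10_L2 Hu.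
pose K := M (normH_sq Omega u).
have sol v : H10 Omega v -> K * dir u v = Theta * ip u v.
  by move=> Hv; have := usol v Hv; rewrite /kirchhoff -/K => ->;
    exact: (sipZl sI Theta Lu (H10_L2 Hv)).
have uphi : 0 < ip u phi1.
  have h1 : ip zeta phi1 <= ip u phi1 by apply: L2_inner_le => //; exact: aeW phi0.
  apply: lt_le_trans h1; rewrite (sipZl sI _ L_u1 Lphi) mulr_gt0//.
  by rewrite (sip_combl sI _ _ Lphi Lpsi Lphi) phi11 mulr1 ltr_pwDl// mulr_ge0// ltW.
(* Testing with [phi1], whose pairing with [u] is positive because [zeta <= u], identifies the
   unknown value [K] of [M]; so [u] satisfies the eigenvalue equation. *)
have Kl : K * lam1 = Theta.
  apply: (mulIf (_ : ip u phi1 != 0)); first by rewrite gt_eqF.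
  by rewrite -(sol _ Hphi) (sipC sD Hu Hphi) (phiE u Hu) (sipC sI Lphi Lu) mulrA.
have K0 : K != 0 by apply/eqP => K0; move: Th0; rewrite -Kl K0 mul0r ltxx.
have Lchi := tL2 tchi; have LDchi := tL2 (test_laplacian tchi).
have eig v : H10 Omega v -> dir v chi = lam1 * ip v chi -> ip v g = 0.
  move=> Hv hv; have Lv := H10_L2 Hv.
  rewrite (sipDr sI LDchi (sipZ sI lam1 Lchi) Lv) (sipZr sI _ Lchi Lv) -hv.
  by rewrite (dirichlet_test oO bO Hv tchi) subrr.
(* Every first eigenfunction is orthogonal to [g], whereas [zeta] is not, because of its bump. *)
have ug : ip u g = 0.
  apply: eig => //; apply: (mulfI K0); rewrite sol ?mulrA ?Kl//; exact: tH.
have phig : ip phi1 g = 0 by apply: eig => //; apply: phiE; exact: tH.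
have zg : ip zeta g = - (c0 * (eta * P)).
  rewrite (sipZl sI _ L_u1 Lg) (sip_combl sI _ _ Lphi Lpsi Lg) phig mulr0 add0r.
  by rewrite /P [eta * - _]mulrN mulrN opprK.
have Luz : L2 Omega (u - zeta) by exact: (sipB sI).
have uzg : ip (u - zeta) g = c0 * (eta * P) by rewrite (sipBl sI Lu Lz Lg) ug zg sub0r opprK.
have Lcphi : L2 Omega ((C / kap) *: phi1) by exact: (sipZ sI).
have Lsd : L2 Omega (s *: d) by exact: (sipZ sI).
(* Pointwise [g <= (C / kap) * phi1]: [g] is bounded by [C] and vanishes where [phi1 < kap]. *)
have h1 : ip (u - zeta) g <= ip (u - zeta) ((C / kap) *: phi1).
  rewrite (sipC sI Luz Lg) (sipC sI Luz Lcphi); apply: L2_inner_le => //.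
    apply: aeW => x Ox; rewrite -[((C / kap) *: phi1) x]/(C / kap * phi1 x).
    have [pk|pk] := ltP (phi1 x) kap.
      have [_ _ gx] := hout x Ox pk; rewrite -[g x]/(laplacian chi x + lam1 * chi x) gx.
      by rewrite mulr_ge0 ?phi0// divr_ge0// ltW.
    apply: le_trans (ler_norm _) _; apply: le_trans (hchi x) _.
    by rewrite mulrAC -mulrA ler_peMr ?(ltW C0)// ler_pdivlMr// mul1r.
  by apply: filterS zu => x hx Ox; rewrite subr_ge0; exact: hx.
have h2 : ip (u - zeta) ((C / kap) *: phi1) <= ip (s *: d) ((C / kap) *: phi1).
  apply: L2_inner_le => //.
    apply: filterS us => x hx Ox; rewrite -[(u - zeta) x]/(u x - zeta x) lerBlDl.
    by rewrite (le_trans (hx Ox))// usupE.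
  apply: aeW => x Ox; rewrite -[((C / kap) *: phi1) x]/(C / kap * phi1 x).
  by rewrite mulr_ge0 ?phi0// divr_ge0// ltW.
have h3 : ip (s *: d) ((C / kap) *: phi1) <= Q * e.
  rewrite (sipZl sI _ Ld Lcphi) (sipZr sI _ Lphi Ld) mulrCA /Q -[leRHS]mulrA.
  apply: ler_wpM2l; first by rewrite divr_ge0// ltW.
  rewrite [leRHS]mulrAC ler_pdivlMr//.
  have h4 : s * ((lam1 - b) * ip d phi1) <= s * (nrmD d * e) by rewrite ler_pM2l.
  rewrite -mulrA [ip d phi1 * _]mulrC; apply: le_trans h4 _.
  by rewrite mulrA; apply: ler_wpM2r => //; exact: ltW.
by have := le_lt_trans (le_trans (le_trans h1 h2) h3) Qe; rewrite uzg ltxx.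
Qed.

End sub_supersolution_method.

Theorem theorem1p1 (R : realType) (N : nat) (hN : (1 <= N)%N)
    (Omega : set 'rV[R]_N) (hOmega : smooth_bounded_domain Omega)
    (M : R -> R) (hM : forall t, 0 <= t -> 0 <= M t)
    (hMincr : exists t1 t2 : R, [/\ 0 < t1, t1 < t2 & M t1 < M t2]) :
  (exists l w : 'rV[R]_N -> R,
      [/\ H10 Omega l /\ {in Omega, continuous l},
          H10 Omega w /\ {in Omega, continuous w},
          weak_lt Omega M l w,
          le_on_boundary Omega l w &
          exists p, Omega p /\ w p < l p]) /\
  (exists l w : 'rV[R]_N -> R,
      [/\ H10 Omega l /\ {in Omega, continuous l},
          H10 Omega w /\ {in Omega, continuous w},
          weak_lt Omega M l w,
          le_on_boundary Omega l w &
          exists p, Omega p /\ l p = w p]) /\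
  (exists (Theta : R) (usub usup : 'rV[R]_N -> R),
      0 < Theta /\
      (H10 Omega usub /\ {in Omega, continuous usub}) /\
      (H10 Omega usup /\ {in Omega, continuous usup}) /\
      weak_subsolution Omega M usub (fun x => Theta * usub x) /\
      weak_supersolution Omega M usup (fun x => Theta * usup x) /\
      (forall x, Omega x -> usub x <= usup x) /\
      le_on_boundary Omega usub (cst 0) /\
      le_on_boundary Omega (cst 0) usup /\
      ~ (exists u : 'rV[R]_N -> R,
            [/\ H10 Omega u,
                weak_solution Omega M u (fun x => Theta * u x),
                ae_le Omega usub u &
                ae_le Omega u usup])).
Proof.
have [nO oO cO bO _] := hOmega; have [t1 [t2 [t10 t12 M12]]] := hMincr.
have [l [w [[Hl Hw] lw bd wl lew]]] := comparison_fails oO bO nO hN hM t10 t12 M12 cO.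
split; first by exists l, w; have [? ?] := Hl; have [? ?] := Hw.
split; first by exists l, w; have [? ?] := Hl; have [? ?] := Hw.
exact: (sub_supersolution_fails oO bO nO hN hM t10 t12 M12).
Qed.
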